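(* For each $N\in\mathbb N$ let $M^{[N,0]}$ be the Markov-modulated Ornstein-Uhlenbeck process obtained under the scaling $Q\mapsto NQ$, with $\boldsymbol\alpha$, $\boldsymbol\gamma$ and $\boldsymbol\sigma$ kept at their original values, i.e. the solution of $$\mathrm dM^{[N,0]}(t)=(\boldsymbol\alpha-\boldsymbol\gamma M^{[N,0]}(t))^{\rm T}\boldsymbol Z^{[N]}(t)\,\mathrm dt+\boldsymbol\sigma^{\rm T}\boldsymbol Z^{[N]}(t)\,\mathrm dB(t),\qquad M^{[N,0]}(0)=m_0,$$ where $m_0\in\mathbb R$ is a constant not depending on $N$. Then, as $N\to\infty$, $M^{[N,0]}$ converges weakly (at the process level) to the ordinary (non-modulated) Ornstein-Uhlenbeck process $\mathscr M_1$ with parameters $(\alpha_\infty,\gamma_\infty,\sigma_\infty)$, defined by $$\mathrm d\mathscr M_1(t)=(\alpha_\infty-\gamma_\infty\mathscr M_1(t))\,\mathrm dt+\sigma_\infty\,\mathrm dB(t),\qquad \mathscr M_1(0)=m_0,$$ with $B$ a standard Brownian motion.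
   Context: $X$ is a continuous-time Markov chain on $\{1,\dots,d\}$ with generator $Q$ having a unique invariant distribution $\boldsymbol\pi$ (column vector, $\boldsymbol\pi^{\rm T}Q=\boldsymbol 0^{\rm T}$, $\mathbf 1^{\rm T}\boldsymbol\pi=1$). The parameter vectors are $\boldsymbol\alpha,\boldsymbol\gamma,\boldsymbol\sigma\in\mathbb R^d$ with $\gamma_i>0$ for all $i$; $\boldsymbol\sigma^2:=(\sigma_1^2,\dots,\sigma_d^2)^{\rm T}$. The time-averaged parameters are $\alpha_\infty:=\boldsymbol\pi^{\rm T}\boldsymbol\alpha$, $\gamma_\infty:=\boldsymbol\pi^{\rm T}\boldsymbol\gamma$, $\sigma_\infty:=\sqrt{\boldsymbol\pi^{\rm T}\boldsymbol\sigma^2}$. $\boldsymbol Z^{[N]}(t)\in\{0,1\}^d$ is the indicator vector of the sped-up chain $X^{[N]}$ (equivalently $X^{[N]}(t)=X(Nt)$), which has generator $NQ$ and initial law not depending on $N$: $Z^{[N]}_i(t)=1$ if $X^{[N]}(t)=i$ and $0$ otherwise. In the equation for $M^{[N,0]}$, $B$ is a standard Brownian motion independent of the chain. Weak convergence at the process level means convergence in distribution in the space of continuous paths on $[0,\infty)$ with the topology of uniform convergence on compacts. *)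

(* Defs.v *)
From HB Require Import structures.
From mathcomp Require Import all_boot all_order all_algebra.
From mathcomp Require Import all_classical all_reals all_analysis.
Set Implicit Arguments.
Unset Strict Implicit.
Unset Printing Implicit Defensive.
Import Order.TTheory GRing.Theory Num.Theory.
Import numFieldNormedType.Exports.
Local Open Scope classical_set_scope.
Local Open Scope ring_scope.

(** Processes are functions [X : R -> T -> V] of a time and an outcome; only
    times [0 <= t] are ever constrained. *)

Section Vectors.
Context {R : realType} {d : nat}.

Definition dotp (u v : 'cV[R]_d) : R := (u^T *m v) ord0 ord0.

Definition generator (Q : 'M[R]_d) : Prop :=
  (forall i j, i != j -> 0 <= Q i j) /\ (forall i, \sum_j Q i j = 0).

Definition invariant_distribution (Q : 'M[R]_d) (p : 'cV[R]_d) : Prop :=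
  [/\ forall i, 0 <= p i ord0, p^T *m Q = 0 & dotp (const_mx 1) p = 1].

Definition unique_invariant_distribution (Q : 'M[R]_d) (p : 'cV[R]_d) : Prop :=
  invariant_distribution Q p /\
  forall q, invariant_distribution Q q -> q = p.

Definition expmx (A : 'M[R]_d) : 'M[R]_d :=
  \matrix_(i, j) limn (series (fun k => (A ^+ k) i j / k`!%:R)).

End Vectors.

Section Processes.
Context {R : realType} {disp : measure_display} {T : measurableType disp}.
Variable P : probability T R.

Definition filtration (F : R -> set (set T)) : Prop :=
  (forall t, 0 <= t -> sigma_algebra setT (F t) /\ F t `<=` measurable) /\
  (forall s t, 0 <= s -> s <= t -> F s `<=` F t).

(** [G] is the sigma-algebra put on the state space [V]. *)
Definition adapted {V : Type} (F : R -> set (set T)) (G : set (set V))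
    (X : R -> T -> V) : Prop :=
  forall t A, 0 <= t -> G A -> F t (X t @^-1` A).

Definition process_sigma_algebra {V : Type} (G : set (set V))
    (X : R -> T -> V) : set (set T) :=
  <<s [set E | exists (t : R) (A : set V), [/\ 0 <= t, G A & E = X t @^-1` A]] >>.

Definition independent_sigma_algebras (F1 F2 : set (set T)) : Prop :=
  forall E1 E2, F1 E1 -> F2 E2 -> P (E1 `&` E2) = (P E1 * P E2)%E.

Definition cadlag_steps {d : nat} (x : R -> 'I_d) : Prop :=
  (forall t, 0 <= t -> \forall s \near t^'+, x s = x t) /\
  (forall t, 0 < t -> exists i, \forall s \near t^'-, x s = i).

(** Markov property: given the values at [t 0 < ... < t n], the conditional
    probability of being in state [i n.+1] at time [t n.+1] is the
    [(i n, i n.+1)] entry of [exp ((t n.+1 - t n) Q)]. *)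
Definition markov_chain {d : nat} (Q : 'M[R]_d) (X : R -> T -> 'I_d) : Prop :=
  [/\ forall (t : R) (i : 'I_d), 0 <= t -> measurable (X t @^-1` [set i]),
      forall w, cadlag_steps (X ^~ w)
    & forall (n : nat) (t : nat -> R) (i : nat -> 'I_d),
        0 <= t 0%N -> (forall k, (k <= n)%N -> t k < t k.+1) ->
        P (\bigcap_(k in `I_n.+2) (X (t k) @^-1` [set i k])) =
        (P (\bigcap_(k in `I_n.+1) (X (t k) @^-1` [set i k]))
         * (expmx ((t n.+1 - t n) *: Q) (i n) (i n.+1))%:E)%E].

Definition initial_law {d : nat} (p0 : 'I_d -> R) (X : R -> T -> 'I_d) : Prop :=
  forall i, P (X 0 @^-1` [set i]) = (p0 i)%:E.

Definition indicator_vector {d : nat} (X : R -> T -> 'I_d) (t : R) (w : T) :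
  'cV[R]_d := \col_i (X t w == i)%:R.

Definition C0oo : set (R -> R) :=
  [set w | {within (`[0, +oo[ : set R), continuous (w : R -> R)}].

(** Standard Brownian motion relative to the filtration [F]. *)
Definition brownian_motion (F : R -> set (set T)) (B : R -> T -> R) : Prop :=
  [/\ adapted F measurable B,
      forall w, B 0 w = 0,
      forall w, C0oo (B ^~ w)
    & forall s t : R, 0 <= s -> s < t ->
        let D := fun w => B t w - B s w in
        (forall A : set R, measurable A ->
           P (D @^-1` A) = normal_prob 0 (Num.sqrt (t - s)) A) /\
        (forall (E : set T) (A : set R), F s E -> measurable A ->
           P (E `&` D @^-1` A) = (P E * P (D @^-1` A))%E)].

(** The elementary integrand
    [\sum_(k < sp_size) sp_coef k * 1_(]sp_time k, sp_time k.+1])]. *)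
Record simple_process := SimpleProcess {
  sp_size : nat;
  sp_time : nat -> R;
  sp_coef : nat -> T -> R }.

Definition sp_adapted (F : R -> set (set T)) (S : simple_process) : Prop :=
  [/\ 0 <= sp_time S 0%N,
      forall k, sp_time S k <= sp_time S k.+1
    & forall k, (forall A : set R, measurable A ->
                   F (sp_time S k) (sp_coef S k @^-1` A)) /\
                exists c : R, forall w, `|sp_coef S k w| <= c].

Definition sp_val (S : simple_process) (s : R) (w : T) : R :=
  \sum_(k < sp_size S)
    sp_coef S k w * (sp_time S k < s <= sp_time S k.+1)%R%:R.

Definition sp_integral (S : simple_process) (B : R -> T -> R) (t : R) (w : T) :
  R :=
  \sum_(k < sp_size S) sp_coef S k w *
    (B (Num.min (sp_time S k.+1) t) w - B (Num.min (sp_time S k) t) w).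

(** [I] is (a version of) the Ito integral of [H] against [B] over [0, t]:
    the L2(P)-limit of the elementary integrals of adapted simple processes
    converging to [H] in L2(dP x ds) on [0, t]. *)
Definition ito_integral (F : R -> set (set T)) (B H : R -> T -> R) (t : R)
    (I : T -> R) : Prop :=
  [/\ adapted F measurable H,
      measurable_fun (`[0, t] `*` setT)
        (fun z : measurableTypeR R * T => H z.1 z.2),
      measurable_fun setT I
    & exists S : nat -> simple_process,
      [/\ forall n, sp_adapted F (S n),
          (\int[P]_w \int[lebesgue_measure]_(s in `[0%R, t])
             ((H s w - sp_val (S n) s w) ^+ 2)%:E)%E @[n --> \oo] --> 0%E
        & 'E_P[(fun w => (I w - sp_integral (S n) B t w) ^+ 2)%R]%E
             @[n --> \oo] --> 0%E]].

(** [dM(t) = b(t) dt + h(t) dB(t)], [M(0) = m0], in integrated form.  Both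
    sides have continuous versions, so asking for the equality almost surely
    at each [t] is the same as asking for it almost surely at all [t]. *)
Definition sde_solution (F : R -> set (set T)) (B : R -> T -> R)
    (b h : R -> T -> R) (m0 : R) (M : R -> T -> R) : Prop :=
  [/\ adapted F measurable M,
      forall w, C0oo (M ^~ w)
    & forall t : R, 0 <= t ->
        {ae P, forall w, lebesgue_measure.-integrable `[0, t]
                           (EFin \o (b ^~ w))} /\
        exists2 I : T -> R, ito_integral F B h t I &
          {ae P, forall w,
            M t w = m0 + (\int[lebesgue_measure]_(s in `[0, t]) b s w) + I w}].

Definition ou_process (B : R -> T -> R) (alpha gamma sigma m0 : R)
    (M : R -> T -> R) : Prop :=
  exists F, [/\ filtration F, brownian_motion F B
    & sde_solution F B (fun t w => alpha - gamma * M t w) (fun _ _ => sigma)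
        m0 M].

Definition mmou_process {d : nat} (X : R -> T -> 'I_d) (B : R -> T -> R)
    (alpha gamma sigma : 'cV[R]_d) (m0 : R) (M : R -> T -> R) : Prop :=
  let Z := indicator_vector X in
  exists F, [/\ filtration F, brownian_motion F B, adapted F setT X
    & sde_solution F B
        (fun t w => dotp (alpha - M t w *: gamma) (Z t w))
        (fun t w => dotp sigma (Z t w))
        m0 M].

Definition independent_processes {d : nat} (X : R -> T -> 'I_d)
    (B : R -> T -> R) : Prop :=
  independent_sigma_algebras (process_sigma_algebra setT X)
                             (process_sigma_algebra measurable B).

End Processes.

(** Functions [R -> R] with the topology of uniform convergence on the compact
    subsets of [0, oo).  It does not see the values at negative times, so the
    bounded continuous functionals on its subspace [C0oo] are exactly those on
    the space C[0, oo). *)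
Notation ucc_paths R := {family compactly_in (`[0, +oo[ : set R), R -> R}.

Definition weak_cvg_C0oo {R : realType}
    (disp : nat -> measure_display) (T : forall n, measurableType (disp n))
    (P : forall n, probability (T n) R) (M : forall n, R -> T n -> R)
    (disp' : measure_display) (T' : measurableType disp')
    (P' : probability T' R) (M' : R -> T' -> R) : Prop :=
  forall Phi : ucc_paths R -> R,
    {within (C0oo : set (ucc_paths R)), continuous Phi} ->
    (exists c : R, forall x, C0oo x -> `|Phi x| <= c) ->
    'E_(P n)[(fun w => Phi (M n ^~ w))]%E @[n --> \oo]
      --> 'E_P'[(fun w => Phi (M' ^~ w))]%E.

(* Main.v *)
(** The chain is sampled on a grid of mesh [h <= N ^ -3], so fine that [M^N] is close to the Euler
    scheme of its equation.  Conditionally on the sampled trajectory [x_0, x_1, ...] of the chain,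
    the noise of this scheme consists of independent centred Gaussian increments of variances
    [h * sigma_(x_k) ^ 2].  It therefore has the law of [rho * (B'(v_(k+1)) - B'(v_k))], where [B'] is
    the Brownian motion driving [M_1], [rho = sigma_oo] (or [1] if [sigma_oo = 0]) and
    [v_k = h * sum_(j < k) sigma_(x_j) ^ 2 / rho ^ 2], and the expectation of a functional of the
    scheme is a mixture, over the trajectories of the chain, of expectations on the space of [M_1].

    If the occupation sums [h * sum_(j < k) (c_(x_j) - c_oo)] are uniformly small for
    [c = alpha, gamma, sigma ^ 2], then the clock [v] is close to the time (or to [0] if
    [sigma_oo = 0]) and, by summation by parts and a discrete Gronwall inequality, the scheme is
    pathwise close to [M_1].  All other trajectories have small total weight: the Poisson
    equation [f = Q g] turns [h * sum_(j < k) f_(x_j) - g_(x_k) / N] into an approximate martingale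
    whose second moment is of order [1 / N]. *)
Require Import Defs.
From HB Require Import structures.
From mathcomp Require Import all_boot all_order all_algebra.
From mathcomp Require Import all_classical all_reals all_analysis.
From mathcomp Require Import measurable_realfun ring lra.
Set Implicit Arguments.
Unset Strict Implicit.
Unset Printing Implicit Defensive.
Import Order.TTheory GRing.Theory Num.Theory.
Import numFieldNormedType.Exports.
Local Open Scope classical_set_scope.
Local Open Scope ring_scope.

(** * Paths and interpolation *)

Section Paths.
Context {R : realType}.
Implicit Types (x : R -> R) (y : nat -> R -> R).

(** The Ito integral is given only as an L2 limit at each fixed time, so suprema of stochastic
    errors are out of reach. The functional is therefore made to see a path through the finitely
    many times [j / m] only; at all other grid times the stochastic error enters through a time
    average of mean squares. Likewise the occupation sums are tested by Chebyshev at a number of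
    times that does not grow with [N].

    The Euler approximation comes without a rate, so the mesh is chosen after [N], and the bounds on
    the chain have to hold for all fine meshes at once. The exponent 3 stems from the one-step
    transition probabilities: their expansion has a remainder of order [(h N) ^ 2], which must stay
    below the [h / N] that each step may contribute if [S / h] steps are to add up to order [1 / N].

    The convergence to [M_1] must be uniform over typical trajectories, since nothing is known about
    how the weights are distributed among them. Uniformity is obtained from a sequence of
    counterexamples, along which almost sure convergence already gives a contradiction. *)

Definition ucc_cvg y x := forall T e : R, 0 < e ->
  \forall n \near \oo, forall t, 0 <= t <= T -> `|y n t - x t| <= e.

Lemma cvg_functional_ucc (Phi : ucc_paths R -> R) y x :
  {within (C0oo : set (ucc_paths R)), continuous Phi} ->
  (forall n, C0oo (y n)) -> C0oo x -> ucc_cvg y x ->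
  Phi (y n) @[n --> \oo] --> Phi x.
Proof.
move=> /subspace_continuousP cPhi Cy Cx yx.
have {}cPhi := cPhi x Cx.
apply: (cvg_trans _ cPhi).
suff yxw : y n @[n --> \oo] --> within (C0oo : set (ucc_paths R)) (nbhs (x : ucc_paths R)).
  by move=> A /= wA; apply: (yxw _ wA).
have yxf : (y @ \oo : set_system (ucc_paths R)) --> (x : ucc_paths R).
  rewrite -fam_cvgE; apply/fam_cvgP => A [A0 cA] P /uniform_nbhs[E [entE EP]].
  move: entE; rewrite -entourage_ballE => -[e /= e0 eE].
  (* [bT] bounds [A] by every number above [T], hence the horizon [T + 1]. The half in [e / 2] turns
     the weak inequality of [ucc_cvg] into the strict one of a ball. *)
  have [T /= bT] := compact_bounded cA.
  have : \forall n \near \oo, forall t, 0 <= t <= T + 1 -> `|y n t - x t| <= e/2.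
    by apply: yx; rewrite divr_gt0.
  apply: filterS => n yn; apply: EP => t At; apply: eE => /=.
  rewrite /ball /= distrC (le_lt_trans (yn _ _))//; last first.
    by rewrite gtr_pMr// invf_lt1// ltr1n.
  have := A0 _ At; rewrite /= in_itv /= andbT => t0; rewrite t0 /=.
  apply: le_trans (bT.2 (T+1) _ _ At); first exact: ler_norm.
  by rewrite ltrDl.
move=> A; rewrite nbhs_simpl /within/= => nA.
have := yxf _ nA; rewrite !nbhs_simpl /=.
by apply: filterS => n; apply; exact: Cy.
Qed.

(** Freezing the path at its value at 0 over negative times turns continuity relative to the
    half-line into plain continuity, to which composition and algebraic lemmas apply directly. *)
Lemma C0oo_max0 x : C0oo x <-> continuous (fun t : R => x (Num.max 0 t)).
Proof.
split=> [/subspace_continuousP cx t|cx].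
  have t0 : (`[0, +oo[%classic : set R) (Num.max 0 t).
    by rewrite /= in_itv /= andbT le_max lexx.
  apply: (cvg_comp _ _ _ (cx _ t0)) => A /= wA.
  have : continuous (fun s : R => Num.max 0 s).
    by move=> s; apply: continuous_max; [exact: cvg_cst|exact: cvg_id].
  move=> /(_ t _ wA) /=.
  by apply: (@filterS _ (nbhs t)) => s; apply; rewrite /= in_itv /= andbT le_max lexx.
apply/subspace_continuousP => t /=; rewrite in_itv /= andbT => t0.
have := cx t; rewrite /continuous_at /= (max_r t0) => {}cx.
move=> A /cx /=; apply: (@filterS _ (nbhs t)) => s /= h.
by rewrite in_itv /= andbT => s0; rewrite -(max_r s0).
Qed.

Lemma C0oo_continuous x : continuous x -> C0oo x.
Proof. by move=> cx; exact: continuous_subspaceT. Qed.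

(** Uniform continuity by compactness of [[0, T]]. Only [s] is confined to that segment: [t] may
    overshoot it, as a random clock or a neighbouring grid node does. *)
Lemma C0oo_unif x T e : C0oo x -> 0 < e ->
  exists2 d, 0 < d &
    forall s t, 0 <= s <= T -> 0 <= t -> `|s - t| < d -> `|x s - x t| < e.
Proof.
move=> /C0oo_max0 cx e0; set xm := fun t => x (Num.max 0 t).
have := @segment_compact R 0 T; rewrite compact_near_coveringP.
move=> /(_ R (0^'+)
  (fun d s => forall t, 0 <= t -> `|s - t| < d -> `|xm s - xm t| < e)).
case => [s /= sT|d /= d0 H].
  have /cvgrPdist_lt/(_ (e / 2)) := cx s.
  rewrite divr_gt0// => /(_ isT)[d /= d0 dx].
  exists ([set s' | `|s - s'| < d / 2], [set d' | d' < d / 2]) => /=.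
    split; first by exists (d / 2) => //=; rewrite divr_gt0.
    by apply: nbhs_right_lt; rewrite divr_gt0.
  move=> [s' d'] /= [ss' dd'] t t0 s't.
  rewrite -(subrKA (xm s)) (le_lt_trans (ler_normD _ _))//.
  rewrite (splitr e) ltrD//.
    by rewrite distrC dx//= (lt_trans ss')// gtr_pMr// invf_lt1// ltr1n.
  rewrite dx//= -(subrKA s') (le_lt_trans (ler_normD _ _))//.
  by rewrite (splitr d) ltrD// (lt_trans s't).
exists (d/2); first by rewrite divr_gt0.
have d2 : d / 2 < d by rewrite gtr_pMr// invf_lt1// ltr1n.
have d20 : 0 < d / 2 by rewrite divr_gt0.
have {}H : `[0, T]%classic `<=` (fun s => forall t, 0 <= t -> `|s - t| < d / 2 -> `|xm s - xm t| < e).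
  by apply: H => //=; rewrite sub0r normrN gtr0_norm.
move=> s t sT t0 st.
have := H s; rewrite /= in_itv/= => /(_ sT t t0 st); rewrite /xm !max_r//.
by case/andP : sT.
Qed.

Lemma C0oo_left (x : R -> R) s : C0oo x -> 0 < s -> x u @[u --> s^'-] --> x s.
Proof.
move=> /C0oo_max0 cx s0; have := cx s; rewrite /continuous_at /= (max_r (ltW s0)) => {}cx.
move=> A /cx /= [e /= e0 eA]; exists (Num.min e s); first by rewrite /= lt_min e0.
move=> u /=; rewrite lt_min => /andP[ue us] us'.
have u0 : 0 <= u by move: us; rewrite gtr0_norm ?subr_gt0//; lra.
by have := eA u ue; rewrite /= max_r.
Qed.

Lemma C0oo_bounded x T : C0oo x ->
  exists c, forall t, 0 <= t <= T -> `|x t| <= c.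
Proof.
move=> /C0oo_max0 cx; have [T0|T0] := leP 0 T; last first.
  by exists 0 => t /andP[t0 tT]; have := le_lt_trans (le_trans t0 tT) T0; rewrite ltxx.
have cxn : {within `[0, T], continuous (fun t : R => `|x (Num.max 0 t)| : R)}.
  apply: continuous_subspaceT => t.
  by apply: (continuous_comp (cx t)); exact: norm_continuous.
have [c _ cP] := EVT_max T0 cxn.
exists (`|x (Num.max 0 c)|) => t tT; have := cP t.
by rewrite in_itv /= tT max_r//; [apply|case/andP: tT].
Qed.

(* The tent function is written as a difference of clamps so that sums of its
   translates telescope. *)
Definition clamp (u : R) : R := Num.min (Num.max u 0) 1.
Definition tent (u : R) : R := clamp (u + 1) - clamp u.

Lemma clamp0 u : u <= 0 -> clamp u = 0.
Proof. by move=> u0; rewrite /clamp max_r// min_l. Qed.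

Lemma clamp1 u : 1 <= u -> clamp u = 1.
Proof.
by move=> u1; rewrite /clamp max_l ?min_r//; exact: le_trans u1.
Qed.

Lemma clampS u v : u <= v -> clamp u <= clamp v.
Proof.
move=> uv; rewrite /clamp; case: (leP u 0) => u0; case: (leP v 0) => v0.
- by [].
- by rewrite min_l// le_min ltW/=.
- by have := lt_le_trans u0 (le_trans uv v0); rewrite ltxx.
- by rewrite le_min !ge_min lexx uv orbT.
Qed.

Lemma tent_ge0 u : 0 <= tent u.
Proof. by rewrite subr_ge0 clampS// lerDl. Qed.

Lemma tent_out u : 1 <= `|u| -> tent u = 0.
Proof.
rewrite ler_normr => /orP[u1|u1].
  by rewrite /tent !clamp1 ?subrr// (le_trans u1)// lerDl.
by rewrite /tent !clamp0 ?subrr//; lra.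
Qed.

Lemma continuous_clamp : continuous clamp.
Proof.
move=> u; apply: (@continuous_min R R (fun u : R => Num.max u 0) (fun=> 1)).
  by apply: (@continuous_max R R id (fun=> 0)); [exact: cvg_id|exact: cvg_cst].
exact: cvg_cst.
Qed.

Lemma continuous_tent : continuous tent.
Proof.
move=> u; apply: cvgB; last exact: continuous_clamp.
apply: (@continuous_comp R R R (fun u => u + 1) clamp u); last exact: continuous_clamp.
by apply: cvgD; [exact: cvg_id|exact: cvg_cst].
Qed.

Lemma sum_tent (n : nat) (u : R) : 0 <= u <= n%:R ->
  \sum_(j < n.+1) tent (u - j%:R) = 1.
Proof.
move=> /andP[u0 un].
have -> : \sum_(j < n.+1) tent (u - j%:R) = clamp (u + 1) - clamp (u - n%:R).
  elim: n {un} => [|n IH]; first by rewrite big_ord_recl big_ord0 addr0 subr0.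
  rewrite big_ord_recr /= IH /tent.
  have -> : u - n.+1%:R + 1 = u - n%:R :> R by rewrite -natr1; ring.
  by rewrite addrA subrK.
by rewrite clamp1 ?lerDr// clamp0 ?subr0// subr_le0.
Qed.

(* Interpolates the values [v j] at the times [j / m], [j <= m ^ 2]; past the time [m] it drops
   to 0. *)
Definition lin (m : nat) (v : nat -> R) (t : R) : R :=
  \sum_(j < (m * m).+1) v j * tent (m%:R * t - j%:R).

Lemma continuous_lin m v : continuous (lin m v).
Proof.
rewrite /lin; apply: continuous_big => //; first exact: add_continuous.
move=> i _ t; apply: cvgM; first exact: cvg_cst.
apply: (@continuous_comp R R R (fun t => m%:R * t - i%:R) tent t); last exact: continuous_tent.
apply: cvgB; last exact: cvg_cst.
by apply: cvgM; [exact: cvg_cst|exact: cvg_id].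
Qed.

Lemma C0oo_lin m v : C0oo (lin m v).
Proof. exact/C0oo_continuous/continuous_lin. Qed.

(** On [[0, m]] the tents form a partition of unity, so [lin m v t] is a convex combination of the
    values at nodes within [1 / m] of [t]. *)
Lemma lin_approx (m : nat) v (t a e : R) : (0 < m)%N -> 0 <= t <= m%:R ->
  (forall j, (j <= m * m)%N -> `|j%:R / m%:R - t| < m%:R^-1 -> `|v j - a| <= e) ->
  `|lin m v t - a| <= e.
Proof.
move=> m0 /andP[t0 tm] H.
have mt : 0 <= m%:R * t <= (m * m)%N%:R.
  by apply/andP; split; [exact: mulr_ge0|rewrite natrM ler_wpM2l].
have -> : lin m v t - a = \sum_(j < (m * m).+1) (v j - a) * tent (m%:R * t - j%:R).
  transitivity (lin m v t - a * \sum_(j < (m * m).+1) tent (m%:R * t - j%:R)).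
    by rewrite sum_tent// mulr1.
  rewrite mulr_sumr -sumrB.
  by apply: eq_bigr => i _; rewrite mulrBl.
rewrite (le_trans (ler_norm_sum _ _ _))//.
have -> : e = \sum_(j < (m * m).+1) e * tent (m%:R * t - j%:R).
  by rewrite -mulr_sumr sum_tent// mulr1.
rewrite ler_sum// => j _.
rewrite normrM (ger0_norm (tent_ge0 _)).
have [h|h] := leP 1 `|m%:R * t - j%:R|; first by rewrite tent_out// !mulr0.
rewrite ler_wpM2r ?tent_ge0// H//; first by rewrite -ltnS.
have m0' : 0 < m%:R :> R by rewrite ltr0n.
rewrite distrC -(ltr_pM2l m0') mulfV ?gt_eqF// -{1}(gtr0_norm m0') -normrM mulrBr.
by rewrite mulrCA divff ?gt_eqF// mulr1.
Qed.

(** The error splits into the discrepancy at the nodes and the oscillation of [x] over one cell. The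
    condition [n < mm n] makes the cells shrink and eventually puts [[0, T]] inside the range
    [[0, mm n]] of the interpolant. The horizon is enlarged to [T + 1] because a node near [t] may
    lie beyond [T]. *)
Lemma ucc_cvg_lin (mm : nat -> nat) (v : nat -> nat -> R) x :
  C0oo x -> (forall n, (n < mm n)%N) ->
  (forall T e : R, 0 < e -> \forall n \near \oo, forall j, (j <= mm n * mm n)%N ->
      j%:R / (mm n)%:R <= T -> `|v n j - x (j%:R / (mm n)%:R)| <= e) ->
  ucc_cvg (fun n => lin (mm n) (v n)) x.
Proof.
move=> Cx mmn H T e e0.
have e20 : 0 < e / 2 by rewrite divr_gt0.
have [d d0 xd] := @C0oo_unif x (T + 1) (e / 2) Cx e20.
have := H (T + 1) (e/2) e20.
have : \forall n \near \oo, (n.+1%:R)^-1 < d.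
  have /cvgrPdist_lt := @cvg_harmonic R; move=> /(_ d d0).
  by apply: filterS => n; rewrite /= sub0r normrN ger0_norm.
have := @nbhs_infty_ger R T.
apply: filterS3 => n nT nd hn t /andP[t0 tT].
have mn : n.+1%:R <= (mm n)%:R :> R by rewrite ler_nat.
have mi : (mm n)%:R^-1 <= n.+1%:R^-1 :> R by rewrite lef_pV2 ?posrE ?ltr0n// (leq_ltn_trans _ (mmn n)).
have mge1 : (mm n)%:R^-1 <= 1 :> R.
  by rewrite (le_trans mi)// invf_le1// ler1n.
apply: lin_approx.
- exact: leq_ltn_trans (mmn n).
- by rewrite t0 (le_trans tT)// (le_trans nT)// ler_nat ltnW.
- move=> j jm jt; rewrite -(subrKA (x (j%:R / (mm n)%:R))).
  rewrite (le_trans (ler_normD _ _))// (splitr e) lerD//.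
    apply: hn => //; move: jt; rewrite ltr_norml => /andP[_]; lra.
  have jm0 : 0 <= j%:R / (mm n)%:R :> R by rewrite mulr_ge0.
  apply/ltW/xd => //; last first.
    by rewrite (lt_le_trans jt)// (le_trans mi)// ltW.
  by rewrite jm0 /=; move: jt; rewrite ltr_norml => /andP[_]; lra.
Qed.

End Paths.

(** * Measurability of functionals of a random path *)

Section Measurability.
Context {R : realType} d (T : measurableType d).

(** Any preimage is a countable union of level sets of [s], so [g] may be arbitrary. This serves
    both functionals of rounded paths and functions of the chain. *)
Lemma measurable_fun_countable (S : countType) (g : S -> R) (s : T -> S) :
  (forall z, measurable (s @^-1` [set z])) -> measurable_fun setT (g \o s).
Proof.
move=> ms _ A mA; rewrite setTI.
have -> : (g \o s) @^-1` A = \bigcup_(z in [set z | A (g z)]) s @^-1` [set z].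
  apply/seteqP; split => [w /= Agw|w [z /= Az]]; last by rewrite /preimage /= => ->.
  by exists (s w).
rewrite bigcup_mkcond; apply: countable_bigcupT_measurable => // z.
by case: ifPn.
Qed.

(* [Y] is approximated by interpolants of its values rounded to a grid; these take countably many
   values, so that no sigma-algebra on the paths is needed. *)
Lemma measurable_functional (Phi : ucc_paths R -> R) (Y : R -> T -> R) :
  {within (C0oo : set (ucc_paths R)), continuous Phi} ->
  (forall w, C0oo (Y ^~ w)) ->
  (forall t : R, 0 <= t -> measurable_fun setT (Y t)) ->
  measurable_fun setT (fun w => Phi (Y ^~ w)).
Proof.
move=> cPhi CY mY.
pose z l (j : nat) w := Num.floor (l.+1%:R * Y (j%:R / l.+1%:R) w).
pose y l w := @lin R l.+1 (fun j => (z l j w)%:~R / l.+1%:R).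
apply: (@measurable_realfun.measurable_fun_cvg d T R setT (fun l w => Phi (y l w)) (fun w => Phi (Y ^~ w)) _ _) => [l|w _]; last first.
  apply: cvg_functional_ucc => // [n|]; first exact: C0oo_lin.
  apply: (@ucc_cvg_lin _ (fun n => n.+1) (fun l j => (z l j w)%:~R / l.+1%:R)) => // S e e0.
  have : \forall n \near \oo, (n.+1%:R)^-1 < e.
    have /cvgrPdist_lt := @cvg_harmonic R; move=> /(_ e e0).
    by apply: filterS => n; rewrite /= sub0r normrN ger0_norm.
  apply: filterS => n ne j _ _; apply: le_trans (ltW ne).
  rewrite /z; set u := Y _ _.
  have n0 : 0 < n.+1%:R :> R by rewrite ltr0n.
  have -> : (Num.floor (n.+1%:R * u))%:~R / n.+1%:R - u =
    ((Num.floor (n.+1%:R * u))%:~R - n.+1%:R * u) / n.+1%:R.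
    by rewrite mulrBl mulrAC divff ?gt_eqF// mul1r.
  rewrite normrM normfV (gtr0_norm n0) -[leRHS]mul1r ler_wpM2r ?invr_ge0 ?(ltW n0)//.
  have := floor_itv (n.+1%:R * u); rewrite ?num_real// intrD => /andP[h1 h2].
  by rewrite ler_norml; apply/andP; split; lra.
pose g (s : seq int) := Phi (@lin R l.+1 (fun j => (nth 0 s j)%:~R / l.+1%:R)).
pose s w := [seq z l j w | j <- iota 0 (l.+1 * l.+1).+1].
have -> : (fun w => Phi (y l w)) = g \o s.
  apply/funext => w /=; rewrite /g /y; congr Phi; apply/funext => t.
  apply: eq_bigr => i _; rewrite (nth_map 0%N) ?size_iota ?ltn_ord//.
  by rewrite nth_iota ?ltn_ord.
apply: measurable_fun_countable => sq.
have mz j k : measurable (z l j @^-1` [set k]).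
  have -> : z l j @^-1` [set k] = Y (j%:R / l.+1%:R) @^-1` `[k%:~R / l.+1%:R, (k + 1)%:~R / l.+1%:R[%classic.
    have n0 : 0 < l.+1%:R :> R by rewrite ltr0n.
    apply/seteqP; split => w /=; rewrite in_itv/= ler_pdivrMr// ltr_pdivlMr// ![_ * l.+1%:R]mulrC.
      by move=> <-; rewrite floor_itv.
    exact: floor_def.
  rewrite -[X in measurable X]setTI; exact: mY.
rewrite /s; elim: (iota _ _) sq => [|j js IH] [|k sq] /=.
- by rewrite (_ : _ @^-1` _ = setT)//; apply/seteqP; split.
- by rewrite (_ : _ @^-1` _ = set0)//; apply/seteqP; split.
- by rewrite (_ : _ @^-1` _ = set0)//; apply/seteqP; split.
- have -> : (fun w => z l j w :: [seq z l j w | j <- js]) @^-1` [set (k :: sq)] =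
    z l j @^-1` [set k] `&` (fun w => [seq z l j w | j <- js]) @^-1` [set sq].
    by apply/seteqP; split => w /= [-> ->].
  exact: measurableI.
Qed.

End Measurability.

Section DiscreteGronwall.
Context {R : realType}.

(** The constant [c] will be the mesh times a Lipschitz constant; [expr1D_expR] then turns the power
    into an exponential of the time horizon. The bound keeps the sum of the [a j] instead of their
    maximum, since only time averages of the residuals will be controlled. *)
Lemma gronwall (a : nat -> R) (e : nat -> R) (c : R) (n : nat) : 0 <= c ->
  (forall k, 0 <= a k) ->
  (forall k, (k <= n)%N -> e k <= a k + c * \sum_(j < k) e j) ->
  forall k, (k <= n)%N -> e k <= a k + c * (1 + c) ^+ n * \sum_(j < k) a j.
Proof.
move=> c0 a0 H.
have S k : (k <= n)%N -> \sum_(j < k) e j <= (1 + c) ^+ k * \sum_(j < k) a j.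
  elim: k => [|k IH] kn; first by rewrite !big_ord0 mulr0.
  rewrite !big_ord_recr /= exprS -mulrA.
  have h1 := IH (ltnW kn); have h2 := H _ (ltnW kn).
  have h3 : a k <= (1 + c) * ((1 + c) ^+ k * a k).
    by rewrite mulrA -exprS ler_peMl// exprn_ege1// lerDl.
  have h4 := ler_wpM2l c0 h1.
  rewrite mulrDr [in leRHS]mulrDr; move: h1 h2 h3 h4.
  set x := \sum_(j < k) e j; set y := _ ^+ k * \sum_(j < k) a j; lra.
move=> k kn; rewrite (le_trans (H _ kn))// lerD2l -mulrA ler_wpM2l//.
rewrite (le_trans (S _ kn))// ler_wpM2r ?sumr_ge0//.
by rewrite ler_weXn2l// lerDl.
Qed.

Lemma expr1D_expR (c : R) n : 0 <= c -> (1 + c) ^+ n <= expR (n%:R * c).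
Proof.
move=> c0; rewrite mulrC expRM_natr lerXn2r ?nnegrE ?addr_ge0// ?expR_ge0//.
exact: expR_ge1Dx.
Qed.

End DiscreteGronwall.

(** * Riemann sums *)

Lemma Rintegral_sum d (T : measurableType d) (R : realType)
    (mu : {measure set T -> \bar R}) (D : set T) (I : Type) (s : seq I)
    (F : I -> T -> R) : measurable D ->
  (forall i, mu.-integrable D (EFin \o F i)) ->
  \int[mu]_(x in D) (\sum_(i <- s) F i x) = \sum_(i <- s) \int[mu]_(x in D) F i x.
Proof.
move=> mD iF; rewrite /Rintegral.
under eq_integral do rewrite -sumEFin.
rewrite integral_sum// -sum_fine// => i _.
by apply: integrable_fin_num => //; exact: (iF i).
Qed.

Lemma integrable_Rsum d (T : measurableType d) (R : realType)
    (mu : {measure set T -> \bar R}) (D : set T) (I : Type) (s : seq I)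
    (F : I -> T -> R) : measurable D ->
  (forall i, mu.-integrable D (EFin \o F i)) ->
  mu.-integrable D (EFin \o (fun x => \sum_(i <- s) F i x)).
Proof.
move=> mD iF; rewrite [X in integrable _ _ X](_ : _ = fun x => (\sum_(i <- s) (F i x)%:E)%E).
  by apply: integrable_sum => // i _; exact: iF.
by apply/funext => x /=; rewrite sumEFin.
Qed.

Lemma integrable_bounded d (T : measurableType d) (R : realType)
    (mu : {measure set T -> \bar R}) (D : set T) (f : T -> R) (c : R) :
  measurable D -> (mu D < +oo)%E -> measurable_fun D f ->
  (forall x, D x -> `|f x| <= c) -> mu.-integrable D (EFin \o f).
Proof.
move=> mD muD mf fc; apply: measurable_bounded_integrable => //.
exists c; split; first exact: num_real.
by move=> e ce x Dx; exact: le_trans (fc _ Dx) (ltW ce).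
Qed.

Section Steps.
Context {R : realType}.
Implicit Types (f : R -> R) (k n : nat).
Local Notation leb := (@lebesgue_measure R).

(** The same coerced boolean as in [sp_val], so that sums of blocks and simple processes agree by
    computation. It is the indicator of the half-open interval from [a] to [b], open on the left. *)
Definition inoc (a b s : R) : R := ((a < s <= b)%R)%:R.

Lemma measurable_inoc (D : set R) (a b : R) : measurable D -> measurable_fun D (inoc a b).
Proof.
move=> mD; rewrite (_ : inoc a b = \1_(`]a, b]%classic)).
  exact: measurable_funTS.
apply/funext => s; rewrite /inoc indicE; congr (nat_of_bool _)%:R.
by apply/idP/idP; rewrite inE /= in_itv.
Qed.

Lemma lebesgue_itv_lty (t : R) : (leb `[0%R, t]%classic < +oo)%E.
Proof. by rewrite lebesgue_measure_itv /=; case: ifPn => _; rewrite ltry. Qed.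

Lemma integrable_inoc (t a b : R) :
  leb.-integrable `[0, t] (EFin \o inoc a b).
Proof.
apply: (@integrable_bounded _ _ _ leb _ _ 1) => //; first exact: lebesgue_itv_lty.
- exact: measurable_inoc.
- by move=> x _; rewrite /inoc ger0_norm// lern1 leq_b1.
Qed.

Lemma integrable_Zinoc (t a b c : R) :
  leb.-integrable `[0, t] (EFin \o (fun s => c * inoc a b s)).
Proof.
apply: (@integrable_bounded _ _ _ leb _ _ `|c|) => //; first exact: lebesgue_itv_lty.
- by apply: measurable_funM => //; exact: measurable_inoc.
- by move=> x _; rewrite normrM ler_piMr// /inoc ger0_norm// lern1 leq_b1.
Qed.

(** In this form, empty intervals and intervals beyond [t] give 0 without a case distinction. *)
Lemma integral_inoc (t a b : R) : 0 <= a -> 0 <= t ->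
  \int[leb]_(s in `[0, t]) inoc a b s =
  Num.max 0 (Num.min b t - Num.min a t).
Proof.
move=> a0 t0; rewrite /Rintegral.
have -> : (\int[leb]_(s in `[0%R, t]) (inoc a b s)%:E)%E = leb `]Num.min a t, Num.min b t]%classic.
  under eq_integral => s _.
    rewrite (_ : inoc a b s = \1_(`]a, b]%classic) s); last first.
      rewrite /inoc indicE; congr (nat_of_bool _)%:R.
      by apply/idP/idP; rewrite inE /= in_itv.
    over.
  rewrite integral_indic//; congr (leb _); apply/seteqP; split => s /=.
    rewrite !in_itv /= => -[/andP[as_ sb] /andP[s0 st]].
    by rewrite gt_min as_ le_min sb st.
  rewrite !in_itv /= gt_min le_min => /andP[/orP[as_|ts] /andP[sb st]].
    by rewrite as_ sb st (le_trans a0 (ltW as_)).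
  by have := lt_le_trans ts st; rewrite ltxx.
rewrite lebesgue_measure_itv /= lte_fin; case: ifPn => h /=.
  by rewrite max_r// subr_ge0 ltW.
by rewrite max_l// subr_le0 leNgt.
Qed.

(** Left endpoints are forced by adaptedness: the same step functions serve as elementary
    integrands. At [s = 0] and beyond [n / ka] the value is 0, whatever [f] is there. *)
Definition step (ka n : nat) f (s : R) : R :=
  \sum_(j < n) f (j%:R / ka%:R) * inoc (j%:R / ka%:R) (j.+1%:R / ka%:R) s.

Lemma stepE ka n f s : (0 < ka)%N -> 0 < s <= n%:R / ka%:R ->
  exists j, [/\ (j < n)%N, j%:R / ka%:R < s, s <= j.+1%:R / ka%:R &
    step ka n f s = f (j%:R / ka%:R)].
Proof.
move=> ka0 /andP[s0 sn].
have ka0' : 0 < ka%:R :> R by rewrite ltr0n.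
have exn : exists n, s <= n%:R / ka%:R by exists n.
case: (ex_minnP exn) => -[|j]; first by rewrite mul0r leNgt s0.
move=> sj minj; have js : j%:R / ka%:R < s.
  by rewrite ltNge; apply/negP => /minj; rewrite ltnn.
have jn := minj _ sn; exists j; split => //.
rewrite /step (bigD1 (Ordinal jn))//= {1}/inoc js sj /= mulr1 big1 ?addr0// => i ij.
rewrite /inoc; case: (ltngtP i j) => h.
- rewrite [X in (_ && X)%:R]lt_geF ?andbF ?mulr0//.
  by rewrite (le_lt_trans _ js)// ler_pM2r ?invr_gt0// ler_nat.
- rewrite [X in (X && _)%:R]le_gtF ?mulr0//.
  by rewrite (le_trans sj)// ler_pM2r ?invr_gt0// ler_nat.
- by move: ij; rewrite -val_eqE /= h eqxx.
Qed.

Lemma measurable_step ka n f (D : set R) : measurable D -> measurable_fun D (step ka n f).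
Proof.
move=> mD; apply: measurable_sum => i; apply: measurable_funM => //.
exact: measurable_inoc.
Qed.

Lemma step_bound ka n f (c s : R) : (0 < ka)%N -> 0 < s <= n%:R / ka%:R ->
  (forall u, 0 <= u <= n%:R / ka%:R -> `|f u| <= c) -> `|step ka n f s| <= c.
Proof.
move=> ka0 sn fc; have [j [jn js _ ->]] := stepE f ka0 sn.
apply: fc; rewrite divr_ge0//= (le_trans (ltW js))//.
by case/andP : sn.
Qed.

(** The sampling point of the cell containing [s] lies strictly below [s] and tends to it, so left
    continuity at almost every [s] gives pointwise convergence; the bound on [f] provides the
    domination. *)
Lemma cvg_step (S : nat) f (c : R) :
  measurable_fun (`[0, S%:R] : set R) f ->
  (forall s : R, 0 <= s <= S%:R -> `|f s| <= c) ->
  {ae leb, forall s : R, 0 < s -> f u @[u --> s^'-] --> f s} ->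
  (\int[leb]_(s in `[0%R, S%:R]) (`|f s - step ka (S * ka) f s|)%:E)%E
    @[ka --> \oo] --> 0%E.
Proof.
move=> mf fc ae.
have SE ka : (0 < ka)%N -> (S * ka)%:R / ka%:R = S%:R :> R.
  by move=> ka0; rewrite natrM mulfK// pnatr_eq0 -lt0n.
pose D := `]0, S%:R]%classic : set R.
have mD : measurable D by exact: measurable_itv.
have sD : D `<=` `[0, S%:R] by move=> s; rewrite /D /= !in_itv /= => /andP[/ltW -> ->].
have mfD : measurable_fun D f by apply: measurable_funS mf.
(* The point 0, where every step function vanishes, is removed as a null set, and the mesh is
   shifted to [ka.+1] to keep it nonzero. *)
suff H : (\int[leb]_(s in D) (`|f s - step ka.+1 (S * ka.+1) f s|)%:E)%E
    @[ka --> \oo] --> 0%E.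
  rewrite -cvg_shiftS /=; apply: cvg_trans H; apply: near_eq_cvg.
  apply: nearW => ka; rewrite /D integral_itv_obnd_cbnd//.
  apply/measurable_EFinP; apply: measurableT_comp => //.
  by apply: measurable_funB => //; exact: measurable_step.
pose g (ka : nat) (s : R) : \bar R := (`|f s - step ka.+1 (S * ka.+1) f s|)%:E.
have mg ka : measurable_fun D (g ka).
  apply/measurable_EFinP; apply: measurableT_comp => //.
  by apply: measurable_funB => //; exact: measurable_step.
have muD : (leb D < +oo)%E.
  by rewrite /D lebesgue_measure_itv /=; case: ifPn => _; rewrite ltry.
have [] := @dominated_convergence _ _ _ leb D mD g (cst 0%E) (cst (c + c)%:E) mg.
- exact: measurable_cst.
- case: ae => N [mN N0 sN]; exists N; split => //; apply: subset_trans sN.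
  apply: subsetC => s /= fs; rewrite /D /= in_itv /= => /andP[s0 sS].
  apply/fine_cvgP; split; first exact: nearW.
  apply/cvgrPdist_le => /= e e0.
  have /cvgrPdist_le/(_ e e0) := fs s0.
  move=> [d /= d0 H].
  have : \forall n \near \oo, (n.+1%:R)^-1 < d.
    have /cvgrPdist_lt := @cvg_harmonic R; move=> /(_ d d0).
    by apply: filterS => n; rewrite /= sub0r normrN ger0_norm.
  apply: filterS => ka kd; rewrite /g sub0r normrN /= normr_id.
  have [||j [jn js sj ->]] := @stepE ka.+1 (S * ka.+1) f s => //.
    by rewrite s0 SE.
  apply: H => //=; rewrite ger0_norm ?subr_ge0 ?ltW//.
  rewrite (le_lt_trans _ kd)// lerBlDl (le_trans sj)//.
  by rewrite -natr1 mulrDl mul1r.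
- apply: (@integrable_bounded _ _ _ leb _ (fun=> c + c) `|c + c|) => //.
- apply: aeW => s ka Ds; rewrite /g /= lee_fin normr_id.
  rewrite (le_trans (ler_normB _ _))// lerD//.
    by apply: fc; have := sD _ Ds; rewrite /= in_itv.
  by apply: step_bound; rewrite ?SE//.
by move=> _ _; rewrite integral_cst// mul0e.
Qed.

Lemma step_prefix ka k n (f : R -> R) s : (0 < ka)%N -> (k <= n)%N -> s <= k%:R / ka%:R ->
  step ka n f s = step ka k f s.
Proof.
move=> ka0 kn sk; rewrite /step.
rewrite -(big_mkord xpredT (fun j => f (j%:R / ka%:R) * inoc (j%:R / ka%:R) (j.+1%:R / ka%:R) s)).
rewrite (big_cat_nat (leq0n k) kn)/= big_mkord.
rewrite [X in _ + X]big_nat_cond [X in _ + X]big1 ?addr0// => i /andP[/andP[ki _] _].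
rewrite /inoc [X in (X && _)%:R]le_gtF ?mulr0//.
by rewrite (le_trans sk)// ler_pM2r ?invr_gt0 ?ltr0n// ler_nat.
Qed.

(** The Riemann sum is the exact integral of the step function, and the error over a prefix is
    dominated by the error over the whole range. The right-hand side therefore serves all [k] at
    once. *)
Lemma riemann_step ka n f k : (0 < ka)%N -> (k <= n)%N ->
  leb.-integrable `[0, n%:R / ka%:R] (EFin \o f) ->
  `|\int[leb]_(s in `[0, k%:R / ka%:R]) f s - ka%:R^-1 * \sum_(j < k) f (j%:R / ka%:R)|
    <= fine (\int[leb]_(s in `[0%R, (n%:R / ka%:R)%R]) (`|f s - step ka n f s|)%:E)%E.
Proof.
move=> ka0 kn iF.
have ka0' : 0 < ka%:R :> R by rewrite ltr0n.
have knR : k%:R / ka%:R <= n%:R / ka%:R :> R by rewrite ler_pM2r ?invr_gt0// ler_nat.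
have ifk : leb.-integrable `[0, k%:R / ka%:R] (EFin \o f).
  apply: integrableS iF => //.
  by move=> s /=; rewrite !in_itv /= => /andP[-> /le_trans ->].
have is_ m (t : R) : leb.-integrable `[0, t] (EFin \o step ka m f).
  by apply: integrable_Rsum => // i; exact: integrable_Zinoc.
have -> : ka%:R^-1 * \sum_(j < k) f (j%:R / ka%:R) =
    \int[leb]_(s in `[0, k%:R / ka%:R]) step ka k f s.
  rewrite /step Rintegral_sum//; last by move=> i; exact: integrable_Zinoc.
  rewrite mulr_sumr; apply: eq_bigr => i _.
  rewrite RintegralZl//; last exact: integrable_inoc.
  rewrite integral_inoc ?divr_ge0//.
  have h1 : i.+1%:R / ka%:R <= k%:R / ka%:R :> R by rewrite ler_pM2r ?invr_gt0// ler_nat.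
  have h2 : i%:R / ka%:R <= i.+1%:R / ka%:R :> R by rewrite ler_pM2r ?invr_gt0// ler_nat.
  rewrite min_l// min_l ?(le_trans h2)// max_r ?subr_ge0// -mulrBl.
  by rewrite -natr1 [_ + 1]addrC addrK mul1r mulrC.
rewrite -RintegralB// (le_trans (le_normr_Rintegral _ _))//.
  by apply: (integrableB _ ifk (is_ k _)).
rewrite /Rintegral fine_le//.
- apply: integrable_fin_num => //.
  exact: (integrable_abse (integrableB _ ifk (is_ k _))).
- apply: integrable_fin_num => //.
  exact: (integrable_abse (integrableB _ iF (is_ n _))).
apply: (@le_trans _ _ (\int[leb]_(s in `[0%R, (k%:R / ka%:R)%R]) (`|f s - step ka n f s|)%:E)%E).
  rewrite le_eqVlt; apply/orP; left; apply/eqP.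
  apply: eq_integral => s; rewrite inE /= in_itv /= => /andP[s0 sk].
  by rewrite (step_prefix _ ka0 kn sk).
apply: ge0_subset_integral => //.
- apply/measurable_EFinP; apply: measurableT_comp => //.
  apply: measurable_funB; last exact: measurable_step.
  by apply/measurable_EFinP; exact: measurable_int iF.
- by move=> s /=; rewrite !in_itv /= => /andP[-> /le_trans ->].
Qed.

End Steps.

(** * Jump times of the chain *)

Section Jumps.
Context {R : realType}.
Local Notation leb := (@lebesgue_measure R).

(** Each point is sent to a pair of rationals enclosing it and no other point of [J]; this map is
    injective on [J]. *)
Lemma isolated_countable (J : set R) :
  (forall s, J s -> exists2 e, 0 < e & forall u, J u -> `|u - s| < e -> u = s) ->
  countable J.
Proof.
move=> H; apply/countable_injP.
have [r rP] : {r : R -> rat * rat & forall s, J s ->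
    ratr (r s).1 < s < ratr (r s).2 /\
    forall u, J u -> ratr (r s).1 < u < ratr (r s).2 -> u = s}.
  apply: (@choice _ _ (fun s (r : rat * rat) => J s ->
    ratr r.1 < s < ratr r.2 /\
    forall u, J u -> ratr r.1 < u < ratr r.2 -> u = s)) => s.
  have [Js|nJs] := pselect (J s); last by exists (0, 0).
  have [e e0 eJ] := H s Js.
  have [p] : exists p : rat, ratr p \in `]s - e, s[%R by apply: rat_in_itvoo; rewrite gtrBl.
  have [q] : exists q : rat, ratr q \in `]s, s + e[%R by apply: rat_in_itvoo; rewrite ltrDl.
  rewrite !in_itv /= => /andP[q1 q2] /andP[p1 p2].
  exists (p, q) => /= _; rewrite p2 q1; split => // u Ju /andP[u1 u2].
  by apply: eJ => //; rewrite ltr_norml; apply/andP; split; lra.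
exists (pickle \o r) => s t; rewrite !inE => Js Jt /= /(pcan_inj pickleK) st.
have [_ h] := rP _ Js; have [h' _] := rP _ Jt; apply/esym/h => //.
by rewrite st.
Qed.

(** A cadlag step path is constant on a one-sided neighbourhood on either side of a time [s > 0], so
    its jump times are isolated, hence countable, hence Lebesgue null. *)
Lemma cadlag_steps_left (d : nat) (x : R -> 'I_d) : cadlag_steps x ->
  {ae leb, forall s, 0 < s -> \forall u \near s^'-, x u = x s}.
Proof.
move=> [xr xl]; set J := [set s | 0 < s /\ ~ \forall u \near s^'-, x u = x s].
suff cJ : countable J.
  exists J; split; first exact: countable_measurable.
    exact: countable_lebesgue_measure0.
  by move=> s /= ns; apply/not_implyP.
apply: isolated_countable => s [s0 _].
have [i [d1 /= d10 H1]] := xl _ s0.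
have [d2 /= d20 H2] := xr _ (ltW s0).
pose e := Num.min d1 d2; have e0 : 0 < e by rewrite lt_min d10.
exists e => // u [u0 nu]; rewrite lt_min => /andP[us1 us2].
case: (ltgtP u s) => // us; exfalso; apply: nu.
- have xui : x u = i by apply: H1 => //=; rewrite distrC.
  rewrite xui; exists (d1 - (s - u)) => /=.
    by rewrite subr_gt0; move: us1; rewrite distrC gtr0_norm// subr_gt0.
  move=> v /= uv vu; apply: H1; last exact: lt_trans us.
  move: us1 uv; rewrite /= distrC !gtr0_norm ?subr_gt0//; first by lra.
  exact: lt_trans us.
- have xus : x u = x s by apply: H2 => //=; rewrite distrC.
  rewrite xus; exists (u - s) => /=; first by rewrite subr_gt0.
  move=> v /= + vu; rewrite gtr0_norm ?subr_gt0// => uv.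
  have sv : s < v by lra.
  apply: H2 => //=; rewrite distrC gtr0_norm ?subr_gt0//.
  by move: us2; rewrite gtr0_norm ?subr_gt0//; lra.
Qed.

End Jumps.

(** * Gaussian increments and the Ito integral *)

Definition pushm d d' (T : measurableType d) (T' : measurableType d') (R : realType)
    (m : {measure set T -> \bar R}) (f : T -> T') (mf : measurable_fun setT f) :
  {measure set T' -> \bar R} :=
  measure_function_pushforward__canonical__measure_function_Measure m mf.

Section NormalScaling.
Context {R : realType}.
Local Notation leb := (@lebesgue_measure R).

Lemma lebesgue_measure_scale (c : R) (A : set R) : c != 0 -> measurable A ->
  leb A = (`|c|%:E * leb ((fun x : R => (c * x)%R) @^-1` A))%E.
Proof.
move=> c0 mA; have c0' : 0 < `|c| by rewrite normr_gt0.
have mc : measurable_fun setT (fun x : measurableTypeR R => c * x : measurableTypeR R) by exact: mulrl_measurable.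
rewrite (@lebesgue_measure_unique R (mscale (NngNum (normr_ge0 c)) (pushm leb mc)))//.
move=> _ [[a b]] _ <-; rewrite /mscale /=.
change (leb `]a, b]%classic = (`|c|%:E * leb ((fun x : R => (c * x)%R) @^-1` `]a, b]%classic))%E).
have [c_gt0|c_le0] := ltP 0 c.
  have -> : (fun x : R => c * x) @^-1` `]a, b]%classic = `]a / c, b / c]%classic.
    by apply/seteqP; split => x /=; rewrite !in_itv /= ltr_pdivrMr// ler_pdivlMr// mulrC.
  rewrite !lebesgue_measure_itv /= !lte_fin ltr_pM2r ?invr_gt0//.
  case: ifPn => _; last by rewrite mule0.
  by rewrite -EFinD -EFinM -mulrBl gtr0_norm// mulrC divfK ?gt_eqF// EFinD.
have {c_le0} c_lt0 : c < 0 by rewrite lt_neqAle c0.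
have -> : (fun x : R => c * x) @^-1` `]a, b]%classic = `[b / c, a / c[%classic.
  by apply/seteqP; split => x /=; rewrite !in_itv /= ltr_ndivlMr// ler_ndivrMr// mulrC => /andP[-> ->].
rewrite !lebesgue_measure_itv /= !lte_fin ltr_nM2r ?invr_lt0//.
case: ifPn => _; last by rewrite mule0.
by rewrite -EFinD -EFinM -mulrBl ltr0_norm// mulrC mulrN divfK ?lt_eqF// opprB EFinD.
Qed.

Lemma ge0_integral_scale (c : R) (D : set R) (f : R -> \bar R) : c != 0 -> measurable D ->
  measurable_fun D f -> (forall x, D x -> 0 <= f x)%E ->
  (\int[leb]_(x in D) f x = `|c|%:E * \int[leb]_(x in (fun x => (c * x)%R) @^-1` D) f (c * x)%R)%E.
Proof.
move=> c0 mD mf f0.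
have mc : measurable_fun setT (fun x : measurableTypeR R => c * x : measurableTypeR R) by exact: mulrl_measurable.
rewrite (@eq_measure_integral _ _ _ _ (mscale (NngNum (normr_ge0 c)) (pushm leb mc))).
  rewrite ge0_integral_mscale// ge0_integral_pushforward// => x.
  by rewrite inE; exact: f0.
by move=> A mA _; exact: (lebesgue_measure_scale c0 mA).
Qed.

(** Used with [c = -1] for the symmetry of the law, with a standard deviation to reduce to the
    standard law, and with the noise coefficients in [increments_law], whose sign is free. *)
Lemma normal_prob_scale (c s : R) (A : set R) : c != 0 -> 0 < s -> measurable A ->
  normal_prob 0 s ((fun x => c * x) @^-1` A) = normal_prob 0 (`|c| * s) A.
Proof.
move=> c0 s0 mA; have c0' : 0 < `|c| by rewrite normr_gt0.
rewrite /normal_prob [RHS](ge0_integral_scale c0)//; last 2 first.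
- by apply/measurable_EFinP/measurable_funTS; exact: measurable_normal_pdf.
- by move=> x _; rewrite lee_fin normal_pdf_ge0.
have mcA : measurable ((fun x : R => c * x) @^-1` A).
  by rewrite -[X in measurable X]setTI; exact: mulrl_measurable.
rewrite -ge0_integralZl//; last 2 first.
- apply/measurable_EFinP/measurable_funTS.
  by apply: (measurableT_comp (measurable_normal_pdf _ _)); exact: mulrl_measurable.
- by move=> x _; rewrite lee_fin normal_pdf_ge0.
apply: eq_integral => x _; rewrite -EFinM; congr EFin.
rewrite !normal_pdfE ?mulf_neq0 ?gt_eqF//.
rewrite /normal_peak /normal_fun !subr0 !exprMn real_normK ?num_real//.
have -> : - (c ^+ 2 * x ^+ 2) / (c ^+ 2 * s ^+ 2 *+ 2) = - x ^+ 2 / (s ^+ 2 *+ 2).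
  have s2 : s ^+ 2 *+ 2 != 0 by rewrite mulrn_eq0 /= sqrf_eq0 gt_eqF.
  by field; rewrite c0 gt_eqF.
rewrite mulrA; congr (_ * _).
have -> : c ^+ 2 * s ^+ 2 * pi *+ 2 = c ^+ 2 * (s ^+ 2 * pi *+ 2) by rewrite mulrnAr mulrA.
by rewrite sqrtrM ?sqr_ge0// sqrtr_sqr invfM mulVKf// gt_eqF.
Qed.

(** From [x ^ 2 / 4 <= expR (x ^ 2 / 4)], the integrand [x ^ 2] against the standard density is
    dominated by a multiple of the normal density of variance 2, which has mass 1. *)
Lemma normal_sqr_lty : (\int[normal_prob (0 : R) 1]_x (x ^+ 2)%:E < +oo)%E.
Proof.
have m2 : measurable_fun setT (fun x : R => (x ^+ 2)%:E).
  by apply/measurable_EFinP; apply: measurable_funX.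
have mpdf (s : R) (D : set R) : measurable D -> measurable_fun D (fun x => (normal_pdf 0 s x)%:E).
  by move=> mD; apply/measurable_EFinP/measurable_funTS; exact: measurable_normal_pdf.
pose C : R := 4 * (normal_peak 1 / normal_peak (Num.sqrt 2)).
have pdf_le (x : R) : x ^+ 2 * normal_pdf 0 1 x <= C * normal_pdf 0 (Num.sqrt 2) x.
  have s2 : Num.sqrt 2 != 0 :> R by rewrite gt_eqF// sqrtr_gt0.
  rewrite !normal_pdfE ?oner_neq0// /C.
  have -> : 4 * (normal_peak 1 / normal_peak (Num.sqrt 2)) *
    (normal_peak (Num.sqrt 2) * normal_fun 0 (Num.sqrt 2) x) =
    normal_peak 1 * (4 * normal_fun 0 (Num.sqrt 2) x) :> R.
    by field; rewrite gt_eqF// normal_peak_gt0.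
  rewrite mulrCA ler_wpM2l ?normal_peak_ge0//.
  rewrite /normal_fun !subr0 expr1n sqr_sqrtr//.
  have -> : - x ^+ 2 / (1 *+ 2) = - (x ^+ 2 / 4) + - x ^+ 2 / (2 *+ 2) by field.
  rewrite expRD mulrA ler_wpM2r ?expR_ge0//.
  have h := expR_ge1Dx (x ^+ 2 / 4); have e0 := expR_gt0 (x ^+ 2 / 4).
  rewrite expRN ler_pdivrMr//; lra.
have C0 : 0 <= C by rewrite mulr_ge0// divr_ge0// normal_peak_ge0.
(* The change of variables to the density is applied to an integrable function, so [x ^ 2] is first
   restricted to [[-n, n]]; the bound does not depend on [n] and passes to the whole line by
   monotone convergence. *)
have bnd n : (\int[normal_prob (0 : R) 1]_(x in `[(- n%:R)%R, n%:R]) (x ^+ 2)%:E <= C%:E)%E.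
  set U := (X in integral _ X _).
  have mU : measurable U by exact: measurable_itv.
  have fin : (normal_prob (0:R) 1).-integrable U (fun x => (x ^+ 2)%:E).
    apply: (@integrable_bounded _ _ _ (normal_prob (0 : R) 1) U (fun x => x ^+ 2) (n%:R ^+ 2)) => //.
    - exact: (le_lt_trans (probability_le1 (normal_prob (0:R) 1) mU) (ltry _)).
    - move=> x; rewrite /U /= in_itv /= => xn.
      by rewrite normrX lerXn2r ?nnegrE// ler_norml.
  rewrite -(Radon_Nikodym_change_of_variables (normal_prob_dominates 0 1))//=.
  apply: (@le_trans _ _ (\int[leb]_(x in U) (x ^+ 2 * normal_pdf 0 1 x)%:E)%E).
    rewrite le_eqVlt; apply/orP; left; apply/eqP; apply: ae_eq_integral => //.
    - apply: emeasurable_funM => //; first exact: measurable_funTS.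
      apply: (measurable_int leb).
      apply: (integrableS _ _ (@subsetT _ _)) => //=.
      by apply: Radon_Nikodym_integrable; exact: normal_prob_dominates.
    - apply/measurable_EFinP; apply: measurable_funM => //.
      by apply/measurable_funTS; exact: measurable_normal_pdf.
    under [X in ae_eq _ _ _ X]eq_fun do rewrite EFinM.
    apply: ae_eqe_mul2l => /=.
    rewrite Radon_NikodymE//=; first exact: normal_prob_dominates.
    move=> abmu; case: cid => /= h [h1 h2 h3].
    apply: integral_ae_eq => //=; first exact: integrableS h2.
    + exact: mpdf.
    + by move=> E E01 mE; rewrite -h3.
  apply: (@le_trans _ _ (\int[leb]_(x in U) (C * normal_pdf 0 (Num.sqrt 2) x)%:E)%E).
    apply: ge0_le_integral => //.
    - by move=> x _; rewrite lee_fin mulr_ge0 ?sqr_ge0 ?normal_pdf_ge0.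
    - apply/measurable_EFinP; apply: measurable_funM => //.
      by apply/measurable_funTS; exact: measurable_normal_pdf.
    - apply/measurable_EFinP; apply: measurable_funM => //.
      by apply/measurable_funTS; exact: measurable_normal_pdf.
    - by move=> x _; rewrite lee_fin.
  under eq_integral do rewrite EFinM.
  rewrite ge0_integralZl//; last 2 first.
  - exact: mpdf.
  - by move=> x _; rewrite lee_fin normal_pdf_ge0.
  rewrite -[leRHS]mule1 lee_wpmul2l ?lee_fin// -(integral_normal_pdf 0 (Num.sqrt 2)).
  apply: ge0_subset_integral => //; first exact: mpdf.
  by move=> x _; rewrite lee_fin normal_pdf_ge0.
apply: (@le_lt_trans _ _ C%:E); last by rewrite ltry.
pose F n := `[(- n%:R)%R, n%:R]%classic : set R.
have UF : \bigcup_i F i = setT.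
  apply/seteqP; split => // x _; exists (Num.bound x) => //.
  by rewrite /F /= in_itv /= -ler_norml ltW// unstable.ltr_norm_bound.
have mF i : measurable (F i) by exact: measurable_itv.
have cF : {homo F : n m / (n <= m)%N >-> (n <= m)%O}.
  move=> m n mn; apply/subsetPset => x; rewrite /F /= !in_itv /= => /andP[h1 h2].
  have mn' : m%:R <= n%:R :> R by rewrite ler_nat.
  by rewrite (le_trans h2 mn') (le_trans _ h1)// lerN2.
have := @ge0_nondecreasing_set_cvg_integral _ (measurableTypeR R) R F (fun x => (x ^+ 2)%:E) (normal_prob (0 : R) 1) cF mF.
move=> /(_ (fun i => measurable_funTS m2)).
have f0 (i : nat) x : F i x -> (0 <= (x ^+ 2)%:E)%E by rewrite lee_fin sqr_ge0.
move=> /(_ f0) /cvge_to_le; rewrite UF; apply.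
by apply: nearW => n; exact: bnd.
Qed.

End NormalScaling.

Section Independence.
Context {R : realType} d (T : measurableType d) (P : probability T R).
Implicit Types (phi psi : T -> R).

(** Independence identifies the joint law with the product of the marginal laws, and Fubini splits
    the integral. *)
Lemma indep_Rintegral phi psi :
  P.-integrable setT (EFin \o phi) -> P.-integrable setT (EFin \o psi) ->
  (forall A B : set R, measurable A -> measurable B ->
    P (phi @^-1` A `&` psi @^-1` B) = (P (phi @^-1` A) * P (psi @^-1` B))%E) ->
  P.-integrable setT (EFin \o (fun w => phi w * psi w)) /\
  \int[P]_w (phi w * psi w) = (\int[P]_w phi w) * (\int[P]_w psi w).
Proof.
move=> iphi ipsi ind.
have mphi : measurable_fun setT phi by apply/measurable_EFinP; exact: measurable_int iphi.
have mpsi : measurable_fun setT psi by apply/measurable_EFinP; exact: measurable_int ipsi.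
pose X : {mfun T >-> R} := mfun_Sub (mem_set mphi).
pose Y : {mfun T >-> R} := mfun_Sub (mem_set mpsi).
pose mu := distribution P X; pose nu := distribution P Y.
have mXY : measurable_fun setT (fun w => (phi w, psi w)).
  exact/measurable_fun_pair.
have joint A : measurable A -> (mu \x nu)%E A = pushm P mXY A.
  apply: product_measure_unique => {}A B mA mB.
  exact: (ind A B mA mB).
pose f (z : R * R) : \bar R := (z.1 * z.2)%:E.
have mf : measurable_fun setT f.
  by apply/measurable_EFinP; apply: measurable_funM.
have mEFin : measurable_fun setT (EFin : R -> \bar R) by exact: EFin_measurable.
have mabs : measurable_fun setT (fun x : R => `|x|%:E).
  by apply/measurable_EFinP; exact: normr_measurable.
have imu : mu.-integrable setT (EFin : R -> \bar R).
  apply/integrableP; split=> //=.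
  rewrite ge0_integral_distribution//=.
  by case/integrableP : iphi.
have inu : nu.-integrable setT (EFin : R -> \bar R).
  apply/integrableP; split=> //=.
  rewrite ge0_integral_distribution//=.
  by case/integrableP : ipsi.
have ifmn : (mu \x nu)%E.-integrable setT f.
  apply/integrableP; split=> //.
  rewrite fubini_tonelli1//=; last first.
    by apply/measurable_EFinP; apply: measurableT_comp => //; exact: measurable_funM.
  rewrite (eq_integral (fun x : R => `|x|%:E * \int[nu]_(y in setT) `|y : R|%:E)%E); last first.
    move=> x _; rewrite /fubini_F /f /= -ge0_integralZl//=.
    by apply: eq_integral => y _; rewrite normrM EFinM.
  have [_ hn] := integrableP _ _ _ inu; have [_ hm] := integrableP _ _ _ imu.
  rewrite ge0_integralZr//; last by apply: integral_ge0.
  by rewrite lte_mul_pinfty// ?integral_ge0// ge0_fin_numE// integral_ge0.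
have ifP : P.-integrable setT (EFin \o (fun w => phi w * psi w)).
  apply/integrableP; split; first by apply/measurable_EFinP; exact: measurable_funM.
  have [_] := integrableP _ _ _ ifmn.
  rewrite (eq_measure_integral (pushm P mXY)); last by move=> A mA _; exact: joint.
  rewrite ge0_integral_pushforward//; exact: measurableT_comp.
split => //.
have HL : (\int[P]_w (phi w * psi w)%:E = \int[mu \x nu]_z f z)%E.
  rewrite (eq_measure_integral (pushm P mXY)); last by move=> A mA _; exact: joint.
  by rewrite integral_pushforward.
have EX : (\int[P]_w (phi w)%:E = \int[mu]_x x%:E)%E.
  by rewrite /mu integral_distribution.
have EY : (\int[P]_w (psi w)%:E = \int[nu]_x x%:E)%E.
  by rewrite /nu integral_distribution.
rewrite /Rintegral HL EX EY -integral12_prod_meas1//.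
have fn : (\int[nu]_x x%:E)%E \is a fin_num by exact: integrable_fin_num.
have fm : (\int[mu]_x x%:E)%E \is a fin_num by exact: integrable_fin_num.
rewrite (eq_integral (fun x : R => x%:E * \int[nu]_y y%:E)%E); last first.
  move=> x _; rewrite /fubini_F /f /=; under eq_integral do rewrite EFinM.
  by rewrite integralZl.
rewrite -(fineK fn) integralZr//.
by rewrite -fineM.
Qed.

End Independence.

Section SubSigmaAlgebra.
Context {R : realType} d (T : measurableType d).

(** A filtration is a family of bare sets of sets; [meas_wrtP] moves to [g_sigma_algebraType], where
    the closure properties of measurable functions are available. *)
Definition meas_wrt (G : set (set T)) (f : T -> R) : Prop :=
  forall A : set R, measurable A -> G (f @^-1` A).

Lemma meas_wrtP (G : set (set T)) (f : T -> R) : sigma_algebra setT G ->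
  meas_wrt G f <-> measurable_fun setT (f : g_sigma_algebraType G -> R).
Proof.
move=> sG; have GE : @measurable _ (g_sigma_algebraType G) = G by exact: sigma_algebra_id.
split=> [Gf _ A mA|mf A mA]; first by rewrite setTI GE; exact: Gf.
by have := mf measurableT A mA; rewrite setTI GE.
Qed.

Lemma meas_wrtM G f g : sigma_algebra setT G -> meas_wrt G f -> meas_wrt G g ->
  meas_wrt G (fun w => f w * g w).
Proof.
move=> sG /(meas_wrtP _ sG) mf /(meas_wrtP _ sG) mg.
by apply/(meas_wrtP _ sG); exact: measurable_funM.
Qed.

Lemma meas_wrtB G f g : sigma_algebra setT G -> meas_wrt G f -> meas_wrt G g ->
  meas_wrt G (fun w => f w - g w).
Proof.
move=> sG /(meas_wrtP _ sG) mf /(meas_wrtP _ sG) mg.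
by apply/(meas_wrtP _ sG); exact: measurable_funB.
Qed.

Lemma meas_wrt_measurable G f : G `<=` measurable -> meas_wrt G f -> measurable_fun setT f.
Proof. by move=> Gm Gf _ A mA; rewrite setTI; apply/Gm/Gf. Qed.

Lemma meas_wrtS G G' f : G `<=` G' -> meas_wrt G f -> meas_wrt G' f.
Proof. by move=> GG' Gf A mA; apply/GG'/Gf. Qed.

End SubSigmaAlgebra.

(** * Moments of Brownian increments given the past *)

Section BrownianMoments.
Context {R : realType} d (T : measurableType d) (P : probability T R).
Variables (F : R -> set (set T)) (B : R -> T -> R).
Hypothesis Ff : filtration F.
Hypothesis Bb : brownian_motion P F B.
Implicit Types (phi c : T -> R).
Local Notation "''I' f" := (P.-integrable setT (EFin \o f)) (at level 10, f at level 9).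
Local Notation E f := (\int[P]_w f w).

(* Only finiteness of the variance of the standard normal law is needed, not
   its value. *)
Definition kappa : R := fine (\int[normal_prob (0 : R) 1]_x (x ^+ 2)%:E).

Lemma kappaE : kappa%:E = (\int[normal_prob (0 : R) 1]_x (x ^+ 2)%:E)%E.
Proof.
rewrite fineK// ge0_fin_numE ?normal_sqr_lty// integral_ge0// => x _.
by rewrite lee_fin sqr_ge0.
Qed.

Lemma kappa_ge0 : 0 <= kappa.
Proof. by rewrite -lee_fin kappaE integral_ge0// => x _; rewrite lee_fin sqr_ge0. Qed.

Definition inc (s t : R) (w : T) : R := B t w - B s w.

Lemma incxx (s : R) w : inc s s w = 0.
Proof. exact: subrr. Qed.

Let sF (t : R) : 0 <= t -> sigma_algebra setT (F t).
Proof. by case: Ff => /(_ t) + _ t0; case/(_ t0). Qed.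

Let Fm (t : R) : 0 <= t -> F t `<=` measurable.
Proof. by case: Ff => /(_ t) + _ t0; case/(_ t0). Qed.

Let FS (s t : R) : 0 <= s -> s <= t -> F s `<=` F t.
Proof. by case: Ff => _; apply. Qed.

Lemma meas_wrt_B (s t : R) : 0 <= s -> s <= t -> meas_wrt (F t) (B s).
Proof. by move=> s0 st; apply: meas_wrtS (FS s0 st) _ => A mA; case: Bb => + _ _ _; apply. Qed.

Lemma meas_wrt_inc (s t : R) u : 0 <= s -> s <= u -> 0 <= t -> t <= u -> meas_wrt (F u) (inc s t).
Proof.
move=> s0 su t0 tu; apply: meas_wrtB; [|exact: meas_wrt_B..].
exact/sF/(le_trans s0).
Qed.

Lemma measurable_inc (s t : R) : 0 <= s -> 0 <= t -> measurable_fun setT (inc s t).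
Proof.
move=> s0 t0; have m0 : 0 <= Num.max s t by rewrite le_max s0.
apply: (meas_wrt_measurable (Fm m0)); apply: meas_wrt_inc => //; rewrite le_max lexx ?orbT//.
Qed.

Lemma inc_law (s t : R) (A : set R) : 0 <= s -> s < t -> measurable A ->
  P (inc s t @^-1` A) = normal_prob 0 (Num.sqrt (t - s)) A.
Proof. by move=> s0 st mA; case: Bb => _ _ _ /(_ s t s0 st) /= [+ _]; apply. Qed.

Lemma ge0_integral_inc (s t : R) (f : R -> \bar R) : 0 <= s -> s < t ->
  measurable_fun setT f -> (forall x, 0 <= f x)%E ->
  (\int[P]_w f (inc s t w) = \int[normal_prob 0 (Num.sqrt (t - s))]_x f x)%E.
Proof.
move=> s0 st mf f0; have t0 : 0 <= t by rewrite (le_trans s0)// ltW.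
have mI : measurable_fun setT (inc s t : T -> measurableTypeR R) by exact: measurable_inc.
transitivity (\int[pushm P mI]_x f x)%E.
  by rewrite ge0_integral_pushforward.
by apply: eq_measure_integral => A mA _; exact: inc_law.
Qed.

Lemma inc_sqr (s t : R) : 0 <= s -> s <= t ->
  (\int[P]_w (inc s t w ^+ 2)%:E = (kappa * (t - s))%:E)%E.
Proof.
move=> s0; rewrite le_eqVlt => /predU1P[<-|st].
  rewrite subrr mulr0; apply: integral0_eq => w _.
  by rewrite /inc subrr expr0n.
have m2 : measurable_fun setT (fun x : R => (x ^+ 2)%:E).
  by apply/measurable_EFinP; apply: measurable_funX.
rewrite (@ge0_integral_inc s t (fun x => (x ^+ 2)%:E))//; last first.
  by move=> x; rewrite lee_fin sqr_ge0.
have r0 : 0 < Num.sqrt (t - s) by rewrite sqrtr_gt0 subr_gt0.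
set r := Num.sqrt _ in r0 *.
have mr : measurable_fun setT (fun x : measurableTypeR R => r * x : measurableTypeR R).
  exact: mulrl_measurable.
rewrite (eq_measure_integral (pushm (normal_prob (0 : R) 1) mr)); last first.
  move=> A mA _; apply/esym.
  have := @normal_prob_scale R r 1 A (lt0r_neq0 r0) ltr01 mA.
  by rewrite mulr1 gtr0_norm.
rewrite ge0_integral_pushforward//; last by move=> x; rewrite lee_fin sqr_ge0.
rewrite preimage_setT /=.
under eq_integral do rewrite exprMn EFinM.
rewrite ge0_integralZl//; last 2 first.
- by move=> x _; rewrite lee_fin sqr_ge0.
- by rewrite lee_fin sqr_ge0.
by rewrite -kappaE -EFinM mulrC sqr_sqrtr// subr_ge0 ltW.
Qed.

Lemma integrable_inc_sqr (s t : R) : 0 <= s -> s <= t -> 'I (fun w => inc s t w ^+ 2).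
Proof.
move=> s0 st; have t0 := le_trans s0 st; apply/integrableP; split.
  by apply/measurable_EFinP; apply: measurable_funX; exact: measurable_inc.
under eq_integral do rewrite /= ger0_norm ?sqr_ge0//.
by rewrite inc_sqr// ltry.
Qed.

Lemma integrable_inc (s t : R) : 0 <= s -> s <= t -> 'I (inc s t).
Proof.
move=> s0 st; have t0 := le_trans s0 st.
apply: (@le_integrable _ _ _ P _ measurableT _ (EFin \o (fun w => 1 + inc s t w ^+ 2))).
- by apply/measurable_EFinP; exact: measurable_inc.
- move=> w _ /=; rewrite lee_fin [leRHS]ger0_norm ?addr_ge0 ?sqr_ge0//.
  set x := inc s t w; rewrite -(real_normK (num_real x)).
  have := sqr_ge0 (`|x| - 1); rewrite sqrrB expr1n mulr1; have := normr_ge0 x; lra.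
- rewrite (_ : _ \o _ = (cst 1%E \+ (EFin \o (fun w => (inc s t w ^+ 2)%R)))%E)//.
  apply: integrableD => //; last exact: integrable_inc_sqr.
  exact: finite_measure_integrable_cst.
Qed.

(** An increment and its opposite have the same law, so the mean equals its own opposite; no
    Gaussian integral is computed. *)
Lemma inc_mean (s t : R) : 0 <= s -> s <= t -> E (inc s t) = 0.
Proof.
move=> s0; rewrite le_eqVlt => /predU1P[<-|st].
  by rewrite /Rintegral integral0_eq// => w _; rewrite /inc subrr.
have t0 : 0 <= t by rewrite (le_trans s0)// ltW.
suff : E (inc s t) = - E (inc s t) by lra.
have intI := integrable_inc s0 (ltW st).
have mD : measurable_fun setT (inc s t : T -> measurableTypeR R) by exact: measurable_inc.
have mDN : measurable_fun setT ((fun w => - inc s t w) : T -> measurableTypeR R) by exact: measurable_funN.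
have mE : measurable_fun setT (EFin : R -> \bar R) by exact: EFin_measurable.
have EN : E (fun w => - inc s t w) = - E (inc s t).
  have := @RintegralZl _ _ _ P setT (inc s t) (-1) measurableT intI.
  rewrite mulN1r => <-; apply: eq_Rintegral => w _; by rewrite mulN1r.
rewrite -EN /Rintegral; congr fine.
have -> : (\int[P]_w (inc s t w)%:E = \int[pushm P mD]_x x%:E)%E.
  by rewrite integral_pushforward.
have iN : 'I (fun w => - inc s t w).
  rewrite [X in integrable _ _ X](_ : _ = (\- (EFin \o inc s t))%E)//.
  exact: integrableN.
have -> : (\int[P]_w (- inc s t w)%:E = \int[pushm P mDN]_x x%:E)%E.
  by rewrite integral_pushforward.
have r0 : 0 < Num.sqrt (t - s) by rewrite sqrtr_gt0 subr_gt0.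
apply: eq_measure_integral => A mA _.
transitivity (normal_prob 0 (Num.sqrt (t - s)) A); first exact: inc_law.
have m1 : measurable ((fun x : R => -1 * x) @^-1` A).
  by rewrite -[X in measurable X]setTI; exact: mulrl_measurable.
have n1 : (-1 : R) != 0 by rewrite oppr_eq0 oner_eq0.
have := @normal_prob_scale R (-1) (Num.sqrt (t - s)) A n1 r0 mA.
rewrite normrN1 mul1r => <-.
rewrite -inc_law//.
change (P ((fun w => -1 * inc s t w) @^-1` A) = P ((fun w => - inc s t w) @^-1` A)).
suff -> : (fun w => -1 * inc s t w) = (fun w => - inc s t w) by [].
by apply/funext => w; rewrite mulN1r.
Qed.

Lemma inc_indep (s t : R) (psi : R -> R) phi : 0 <= s -> s < t -> measurable_fun setT psi ->
  meas_wrt (F s) phi -> 'I phi -> 'I (psi \o inc s t) ->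
  'I (fun w => phi w * psi (inc s t w)) /\
  E (fun w => phi w * psi (inc s t w)) = E phi * E (psi \o inc s t).
Proof.
move=> s0 st mpsi Fphi iphi ipsi; apply: indep_Rintegral => // A A' mA mA'.
have mp : measurable (psi @^-1` A') by rewrite -[X in measurable X]setTI; exact: mpsi.
case: Bb => _ _ _ /(_ s t s0 st) /= [_]; move/(_ _ _ (Fphi _ mA) mp).
by rewrite /inc; apply.
Qed.

Lemma inc_orth (s t : R) phi : 0 <= s -> s <= t -> meas_wrt (F s) phi -> 'I phi ->
  'I (fun w => phi w * inc s t w) /\ E (fun w => phi w * inc s t w) = 0.
Proof.
move=> s0; rewrite le_eqVlt => /predU1P[<- _ _|st Fphi iphi].
  have -> : (fun w => phi w * inc s s w) = cst 0.
    by apply/funext => w; rewrite /inc subrr mulr0.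
  split; first exact: integrable0.
  by rewrite /Rintegral integral0_eq.
have [i1 E1] := @inc_indep s t id phi s0 st (@measurable_id _ _ setT) Fphi iphi (integrable_inc s0 (ltW st)).
split; first exact: i1.
by rewrite [LHS]E1 -[X in _ * X]/(E (inc s t)) (inc_mean s0 (ltW st)) mulr0.
Qed.

Lemma inc_isom (s t : R) phi : 0 <= s -> s <= t -> meas_wrt (F s) phi -> 'I phi ->
  'I (fun w => phi w * inc s t w ^+ 2) /\
  E (fun w => phi w * inc s t w ^+ 2) = kappa * E phi * (t - s).
Proof.
move=> s0; rewrite le_eqVlt => /predU1P[<- _ _|st Fphi iphi].
  have -> : (fun w => phi w * inc s s w ^+ 2) = cst 0.
    by apply/funext => w; rewrite /inc subrr expr0n mulr0.
  split; first exact: integrable0.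
  by rewrite /Rintegral integral0_eq// subrr mulr0.
have m2 : measurable_fun setT (fun x : R => x ^+ 2) by apply: measurable_funX.
have [i1 E1] := @inc_indep s t _ phi s0 st m2 Fphi iphi (integrable_inc_sqr s0 (ltW st)).
split; first exact: i1.
rewrite [LHS]E1 [X in _ * X = _]/Rintegral /= inc_sqr//= ?ltW//; ring.
Qed.

End BrownianMoments.

(** * Isometry for elementary integrals *)

Section Isometry.
Context {R : realType} d (T : measurableType d) (P : probability T R).
Variables (F : R -> set (set T)) (B : R -> T -> R).
Hypothesis Ff : filtration F.
Hypothesis Bb : brownian_motion P F B.
Implicit Types (phi c : T -> R).
Local Notation "''I' f" := (P.-integrable setT (EFin \o f)) (at level 10, f at level 9).
Local Notation E f := (\int[P]_w f w).
Local Notation kappa := (@kappa R).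
Local Notation inc := (inc B).

Definition bounded_rv phi := exists K : R, forall w, `|phi w| <= K.

Lemma bounded_rvM phi c : bounded_rv phi -> bounded_rv c -> bounded_rv (fun w => phi w * c w).
Proof.
move=> [K hK] [L hL]; exists (K * L) => w.
by rewrite normrM ler_pM.
Qed.

Lemma integrable_bounded_rv phi : measurable_fun setT phi -> bounded_rv phi -> 'I phi.
Proof.
move=> mphi [K hK]; apply: (@integrable_bounded _ _ _ P _ _ K) => //.
by rewrite -ge0_fin_numE// fin_num_measure.
Qed.

Let sF (t : R) : 0 <= t -> sigma_algebra setT (F t).
Proof. by case: Ff => /(_ t) + _ t0; case/(_ t0). Qed.

Let Fm (t : R) : 0 <= t -> F t `<=` measurable.
Proof. by case: Ff => /(_ t) + _ t0; case/(_ t0). Qed.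

Let FS (s t : R) : 0 <= s -> s <= t -> F s `<=` F t.
Proof. by case: Ff => _; apply. Qed.

Lemma integrable_inc2 phi (s t s' t' : R) : 0 <= s -> s <= t -> 0 <= s' -> s' <= t' ->
  measurable_fun setT phi -> bounded_rv phi -> 'I (fun w => phi w * (inc s t w * inc s' t' w)).
Proof.
move=> s0 st s'0 st' mphi [K hK].
have t0 := le_trans s0 st; have t'0 := le_trans s'0 st'.
apply: (@le_integrable _ _ _ P _ measurableT _ (EFin \o (fun w => K * (inc s t w ^+ 2 + inc s' t' w ^+ 2)))).
- apply/measurable_EFinP; apply: measurable_funM => //.
  by apply: measurable_funM; exact: measurable_inc Ff Bb _ _ _ _.
- move=> w _ /=; rewrite lee_fin; set x := inc s t w; set y := inc s' t' w.
  have K0 : 0 <= K by rewrite (le_trans _ (hK w)).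
  rewrite [leRHS]ger0_norm ?mulr_ge0 ?addr_ge0 ?sqr_ge0// normrM ler_pM//.
  rewrite -(real_normK (num_real x)) -(real_normK (num_real y)) normrM.
  have := sqr_ge0 (`|x| - `|y|); rewrite sqrrB.
  have := mulr_ge0 (normr_ge0 x) (normr_ge0 y); lra.
- have i2 := integrableD measurableT (integrable_inc_sqr Ff Bb s0 st) (integrable_inc_sqr Ff Bb s'0 st').
  exact: (integrableZl measurableT K i2).
Qed.

Lemma inc_split (s t u : R) w : inc s u w = inc s t w + inc t u w.
Proof. by rewrite /inc; ring. Qed.

(** The earlier increment joins [phi] as a factor known at time [a'], and the later increment is
    centred and independent of that past. *)
Lemma inc_pair_disjoint phi (a b a' b' : R) : 0 <= a -> a <= b -> b <= a' -> a' <= b' ->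
  meas_wrt (F a') phi -> bounded_rv phi ->
  E (fun w => phi w * (inc a b w * inc a' b' w)) = 0.
Proof.
move=> a0 ab ba' ab' Fphi bphi; have b0 := le_trans a0 ab; have a'0 := le_trans b0 ba'.
have Fi : meas_wrt (F a') (fun w => phi w * inc a b w).
  apply: meas_wrtM (sF a'0) Fphi _.
  by apply: (meas_wrt_inc Ff Bb) => //; exact: le_trans ab ba'.
have mphi := meas_wrt_measurable (Fm a'0) Fphi.
have i1 : 'I (fun w => phi w * inc a b w).
  have [_] := integrableP _ _ _ (integrable_inc Ff Bb a0 ab).
  case: bphi => K hK _.
  apply: (@le_integrable _ _ _ P _ measurableT _ (EFin \o (fun w => K * `|inc a b w|))).
  - exact/measurable_EFinP/(meas_wrt_measurable (Fm a'0) Fi).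
  - move=> w _ /=; rewrite lee_fin normrM [leRHS]ger0_norm ?ler_wpM2r//.
    by rewrite mulr_ge0// (le_trans _ (hK w)).
  - have := integrable_abse (integrable_inc Ff Bb a0 ab).
    by move=> /(integrableZl measurableT K).
have [_ <-] := inc_orth Ff Bb a'0 ab' Fi i1.
by apply: eq_Rintegral => w _; rewrite mulrA.
Qed.

Lemma inc_pair_le phi (a b a' b' : R) : 0 <= a -> a <= a' -> a <= b -> a' <= b' ->
  meas_wrt (F a') phi -> bounded_rv phi ->
  E (fun w => phi w * (inc a b w * inc a' b' w)) =
  kappa * E phi * Num.max 0 (Num.min b b' - a').
Proof.
move=> a0 aa' ab ab' Fphi bphi; have a'0 := le_trans a0 aa'.
have b0 := le_trans a0 ab; have b'0 := le_trans a'0 ab'.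
have mphi := meas_wrt_measurable (Fm a'0) Fphi.
have iphi := integrable_bounded_rv mphi bphi.
have [ba'|a'b] := leP b a'.
  rewrite max_l; last by rewrite subr_le0 ge_min ba'.
  by rewrite mulr0 inc_pair_disjoint.
pose m := Num.min b b'.
have a'm : a' <= m by rewrite le_min ab' ltW.
have m0 := le_trans a'0 a'm.
rewrite max_r ?subr_ge0// -/m.
have [_ sq] := inc_isom Ff Bb a'0 a'm Fphi iphi.
have int2 s t s' t' := @integrable_inc2 phi s t s' t'.
have mb : m <= b by rewrite ge_min lexx.
have mb' : m <= b' by rewrite ge_min lexx orbT.
(* Cutting both intervals at [a'] and at [m] leaves the square over the overlap plus products of
   disjoint increments. One of [inc m b'] and [inc m b] is zero, so a single formula covers both
   orders of [b] and [b']. *)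
rewrite (_ : (fun w => _) = (fun w => phi w * (inc a a' w * inc a' b' w) +
   (phi w * inc a' m w ^+ 2 + (phi w * (inc a' m w * inc m b' w) +
    phi w * (inc a' m w * inc m b w))))); last first.
  apply/funext => w; have [bb'|bb'] := leP b b'.
    have -> : m = b by rewrite /m min_l.
    rewrite (inc_split a a' b) (inc_split a' b b').
    rewrite [inc b b w]incxx; ring.
  have -> : m = b' by rewrite /m min_r// ltW.
  rewrite (inc_split a a' b) (inc_split a' b' b).
  rewrite [inc b' b' w]incxx; ring.
have Isq : 'I (fun w => phi w * inc a' m w ^+ 2).
  by have := int2 a' m a' m a'0 a'm a'0 a'm mphi bphi.
have I1 := int2 a a' a' b' a0 aa' a'0 ab' mphi bphi.
have I2 := int2 a' m m b' a'0 a'm m0 mb' mphi bphi.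
have I3 := int2 a' m m b a'0 a'm m0 mb mphi bphi.
have I23 := integrableD measurableT I2 I3.
have Is23 := integrableD measurableT Isq I23.
have Fm_phi : meas_wrt (F m) phi := meas_wrtS (FS a'0 a'm) Fphi.
rewrite RintegralD// RintegralD// RintegralD// sq.
by rewrite !inc_pair_disjoint// !addr0 add0r.
Qed.

Lemma inc_pair c c' (a b a' b' : R) : 0 <= a -> 0 <= a' -> a <= b -> a' <= b' ->
  meas_wrt (F a) c -> bounded_rv c -> meas_wrt (F a') c' -> bounded_rv c' ->
  E (fun w => c w * c' w * (inc a b w * inc a' b' w)) =
  kappa * E (fun w => c w * c' w) * Num.max 0 (Num.min b b' - Num.max a a').
Proof.
move=> a0 a'0 ab ab' Fc bc Fc' bc'; have bcc := bounded_rvM bc bc'.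
have [aa'|/ltW a'a] := leP a a'.
  by rewrite inc_pair_le//; apply: meas_wrtM (sF a'0) _ Fc'; exact: meas_wrtS (FS a0 aa') Fc.
rewrite minC -(@inc_pair_le _ a' b' a b)//; last first.
  by apply: meas_wrtM (sF a0) Fc _; exact: meas_wrtS (FS a'0 a'a) Fc'.
by apply: eq_Rintegral => w _; rewrite [inc a b w * _]mulrC.
Qed.

(* A block [(a, b, c)] stands for the integrand [c * 1_(]a, b])]. *)
Definition block := (R * R * (T -> R))%type.
Definition good_block (x : block) :=
  [/\ 0 <= x.1.1, x.1.1 <= x.1.2, meas_wrt (F x.1.1) x.2 & bounded_rv x.2].
Definition block_inc (t : R) (x : block) (w : T) : R :=
  x.2 w * inc (Num.min x.1.1 t) (Num.min x.1.2 t) w.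
Definition block_val (x : block) (s : R) (w : T) : R := x.2 w * inoc x.1.1 x.1.2 s.

Lemma block_val_pairE (x y : block) (t : R) : 0 <= t -> 0 <= x.1.1 ->
  (fun w => \int[@lebesgue_measure R]_(s in `[0, t]) (block_val x s w * block_val y s w)) =
  (fun w => Num.max 0 (Num.min (Num.min x.1.2 y.1.2) t - Num.min (Num.max x.1.1 y.1.1) t) *
     (x.2 w * y.2 w)).
Proof.
move: x y => [[a b] c] [[a' b'] c'] /= t0 a0.
apply/funext => w; rewrite -(@integral_inoc _ _ _ (Num.min b b')) ?le_max ?a0// mulrC.
rewrite -RintegralZl//; last exact: integrable_inoc.
apply: eq_Rintegral => s _; rewrite /block_val /=.
have -> : inoc (Num.max a a') (Num.min b b') s = inoc a b s * inoc a' b' s.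
  rewrite /inoc -natrM mulnb; congr ((nat_of_bool _)%:R).
  by rewrite gt_max le_min; case: (a < s); case: (s <= b); case: (a' < s); case: (s <= b').
ring.
Qed.

Lemma integrable_block_val x y (t : R) : 0 <= t -> good_block x -> good_block y ->
  'I (fun w => \int[@lebesgue_measure R]_(s in `[0, t]) (block_val x s w * block_val y s w)).
Proof.
move=> t0 [x0 _ Fx bx] [y0 _ Fy by_]; rewrite block_val_pairE//.
have mx := meas_wrt_measurable (Fm x0) Fx; have my := meas_wrt_measurable (Fm y0) Fy.
apply: integrable_bounded_rv; first by apply: measurable_funM => //; exact: measurable_funM.
by apply: bounded_rvM; [exists `|Num.max 0 (Num.min (Num.min x.1.2 y.1.2) t - Num.min (Num.max x.1.1 y.1.1) t)|
  |exact: bounded_rvM].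
Qed.

Lemma block_pair (t : R) x y : 0 <= t -> good_block x -> good_block y ->
  'I (fun w => block_inc t x w * block_inc t y w) /\
  E (fun w => block_inc t x w * block_inc t y w) =
  kappa * E (fun w => \int[@lebesgue_measure R]_(s in `[0, t]) (block_val x s w * block_val y s w)).
Proof.
move: x y => [[a b] c] [[a' b'] c'] t0 [/= a0 ab Fc bc] [/= a'0 ab' Fc' bc'].
have mc := meas_wrt_measurable (Fm a0) Fc.
have mc' := meas_wrt_measurable (Fm a'0) Fc'.
have mcc : measurable_fun setT (fun w => c w * c' w) by exact: measurable_funM.
have icc : 'I (fun w => c w * c' w) by apply: integrable_bounded_rv => //; exact: bounded_rvM.
have mt0 u : 0 <= u -> 0 <= Num.min u t by move=> u0; rewrite le_min u0.
have mtt u v : u <= v -> Num.min u t <= Num.min v t.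
  by move=> uv; rewrite le_min !ge_min uv lexx orbT.
split.
  rewrite (_ : (fun w => _) = (fun w => c w * c' w * (inc (Num.min a t) (Num.min b t) w * inc (Num.min a' t) (Num.min b' t) w))).
    by apply: integrable_inc2; rewrite ?mt0 ?mtt//; exact: bounded_rvM.
  by apply/funext => w; rewrite /block_inc /=; ring.
have -> := @block_val_pairE (a, b, c) (a', b', c') t t0 a0.
rewrite /= RintegralZl//.
(* A block starting after [t] degenerates once cut at [t], while its coefficient need not be known
   at time [t], so [inc_pair] does not apply to it. In these cases both sides are simply 0. *)
have [at_|ta] := leP t a.
  rewrite [X in _ - X]min_r ?le_max ?at_// max_l ?subr_le0 ?ge_min ?lexx ?orbT//.
  rewrite mul0r mulr0 /Rintegral integral0_eq// => w _.
  rewrite /block_inc /= (min_r at_) (min_r (le_trans at_ ab)).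
  by rewrite incxx mulr0 mul0r.
have [at'|ta'] := leP t a'.
  rewrite [X in _ - X]min_r ?le_max ?at' ?orbT// max_l ?subr_le0 ?ge_min ?lexx ?orbT//.
  rewrite mul0r mulr0 /Rintegral integral0_eq// => w _.
  rewrite /block_inc /= (min_r at') (min_r (le_trans at' ab')).
  by rewrite incxx !mulr0.
rewrite [X in _ * (X * _)](_ : _ = Num.max 0 (Num.min (Num.min b t) (Num.min b' t) - Num.max a a')); last first.
  congr (Num.max 0 (_ - _)); last by rewrite min_l// ge_max !ltW.
  by rewrite minACA minxx.
rewrite [X in _ = _ * X]mulrC mulrA -inc_pair//; last 2 first.
- by rewrite le_min ab ltW.
- by rewrite le_min ab' ltW.
apply: eq_Rintegral => w _; rewrite /block_inc /=.
by rewrite (min_l (ltW ta)) (min_l (ltW ta')); ring.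
Qed.


Definition sum_inc (t : R) (bs : seq block) (w : T) : R := \sum_(x <- bs) block_inc t x w.
Definition sum_val (bs : seq block) (s : R) (w : T) : R := \sum_(x <- bs) block_val x s w.
Definition good_blocks (bs : seq block) := forall x, List.In x bs -> good_block x.

Lemma sqr_sum (I : Type) (r : seq I) (f : I -> R) :
  (\sum_(i <- r) f i) ^+ 2 = \sum_(i <- r) \sum_(j <- r) (f i * f j).
Proof. by rewrite expr2 mulr_suml; apply: eq_bigr => i _; rewrite mulr_sumr. Qed.

Lemma eq_big_In (I : Type) (r : seq I) (f g : I -> R) :
  (forall i, List.In i r -> f i = g i) -> \sum_(i <- r) f i = \sum_(i <- r) g i.
Proof.
elim: r => [|i r IH] fg; first by rewrite !big_nil.
by rewrite !big_cons fg ?IH//; [move=> j jr; apply: fg; right|left].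
Qed.

Lemma integral_sum_In (I : Type) (r : seq I) (f : I -> T -> R) :
  (forall i, List.In i r -> 'I (f i)) ->
  'I (fun w => \sum_(i <- r) f i w) /\
  E (fun w => \sum_(i <- r) f i w) = \sum_(i <- r) E (f i).
Proof.
elim: r => [|i r IH] fi.
  have -> : (fun w => \sum_(i <- [::]) f i w) = cst 0 by apply/funext => w; rewrite big_nil.
  by rewrite big_nil; split; [exact: integrable0|rewrite /Rintegral integral0].
have [|iS ES] := IH; first by move=> j jr; apply: fi; right.
have -> : (fun w => \sum_(j <- i :: r) f j w) = (fun w => f i w + \sum_(j <- r) f j w).
  by apply/funext => w; rewrite big_cons.
have ii : 'I (f i) by apply: fi; left.
split; first exact: (integrableD measurableT ii iS).
by rewrite RintegralD// ES big_cons.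
Qed.

Lemma integrable_block_val_s x y (t : R) w :
  (@lebesgue_measure R).-integrable `[0, t] (EFin \o (fun s => block_val x s w * block_val y s w)).
Proof.
apply: (@integrable_bounded _ _ _ (@lebesgue_measure R) _ _ `|x.2 w * y.2 w|) => //.
- exact: lebesgue_itv_lty.
- by apply: measurable_funM; apply: measurable_funM => //; exact: measurable_inoc.
- move=> s _; rewrite /block_val mulrACA normrM ler_piMr//.
  by rewrite /inoc -natrM ger0_norm// lern1 mulnb leq_b1.
Qed.

(** Both squares expand into double sums that [block_pair] matches term by term. Blocks may overlap,
    so the difference of two elementary integrals over different partitions is covered by
    concatenating their blocks. *)
Lemma elementary_isometry (t : R) (bs : seq block) : 0 <= t -> good_blocks bs ->
  (\int[P]_w ((sum_inc t bs w) ^+ 2)%:E =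
   kappa%:E * \int[P]_w \int[@lebesgue_measure R]_(s in `[0%R, t]) ((sum_val bs s w) ^+ 2)%:E)%E.
Proof.
move=> t0 gb.
have inner w : (\int[@lebesgue_measure R]_(s in `[0%R, t]) ((sum_val bs s w) ^+ 2)%:E =
    (\sum_(x <- bs) \sum_(y <- bs) \int[@lebesgue_measure R]_(s in `[0, t])
       (block_val x s w * block_val y s w))%R%:E)%E.
  rewrite (_ : (fun s => _) = EFin \o (fun s => \sum_(x <- bs) \sum_(y <- bs) block_val x s w * block_val y s w)); last first.
    by apply/funext => s; rewrite /sum_val sqr_sum.
  have i1 x : (@lebesgue_measure R).-integrable `[0, t] (EFin \o (fun s => \sum_(y <- bs) block_val x s w * block_val y s w)).
    by apply: integrable_Rsum => // y; exact: integrable_block_val_s.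
  have i2 : (@lebesgue_measure R).-integrable `[0, t] (EFin \o (fun s => \sum_(x <- bs) \sum_(y <- bs) block_val x s w * block_val y s w)).
    by apply: integrable_Rsum.
  rewrite -[LHS]fineK; last exact: integrable_fin_num.
  congr EFin; rewrite -[LHS]/(\int[@lebesgue_measure R]_(s in `[0, t]) (\sum_(x <- bs) \sum_(y <- bs) block_val x s w * block_val y s w)).
  rewrite Rintegral_sum//; apply: eq_bigr => x _; rewrite Rintegral_sum// => y.
  exact: integrable_block_val_s.
under [in RHS]eq_integral do rewrite inner.
under [in LHS]eq_integral do rewrite /sum_inc sqr_sum.
have bp x y : List.In x bs -> List.In y bs -> _ := fun hx hy => block_pair t0 (gb x hx) (gb y hy).
have L x : List.In x bs -> _ := fun hx => @integral_sum_In block bs (fun y w => block_inc t x w * block_inc t y w) (fun y hy => (bp x y hx hy).1).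
have [iL EL] := @integral_sum_In block bs (fun x w => \sum_(y <- bs) block_inc t x w * block_inc t y w) (fun x hx => (L x hx).1).
have bv x y : List.In x bs -> List.In y bs -> _ := fun hx hy => integrable_block_val t0 (gb x hx) (gb y hy).
have L' x : List.In x bs -> _ := fun hx => @integral_sum_In block bs (fun y w => \int[@lebesgue_measure R]_(s in `[0, t]) (block_val x s w * block_val y s w)) (fun y hy => bv x y hx hy).
have [iR ER] := @integral_sum_In block bs (fun x w => \sum_(y <- bs) \int[@lebesgue_measure R]_(s in `[0, t]) (block_val x s w * block_val y s w)) (fun x hx => (L' x hx).1).
rewrite -[LHS]fineK; last exact: integrable_fin_num iL.
rewrite -[X in (_ * X)%E]fineK; last exact: integrable_fin_num iR.
rewrite -EFinM; congr EFin.
rewrite -[LHS]/(E (fun w => \sum_(x <- bs) \sum_(y <- bs) block_inc t x w * block_inc t y w)) EL.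
rewrite -[X in _ * X]/(E (fun w => \sum_(x <- bs) \sum_(y <- bs) \int[@lebesgue_measure R]_(s in `[0, t]) (block_val x s w * block_val y s w))) ER.
rewrite mulr_sumr; apply: eq_big_In => x hx.
rewrite (L x hx).2 (L' x hx).2 mulr_sumr; apply: eq_big_In => y hy.
exact: (bp x y hx hy).2.
Qed.

End Isometry.

(** * Distance from the Ito integral to explicit elementary integrals *)

Section ItoApproximation.
Context {R : realType} d (T : measurableType d) (P : probability T R).
Variables (F : R -> set (set T)) (B : R -> T -> R).
Hypothesis Ff : filtration F.
Hypothesis Bb : brownian_motion P F B.
Local Notation leb := (@lebesgue_measure R).
Local Notation kappa := (@kappa R).
Local Notation block := (@block R d T).
Local Notation simple_process := (@simple_process R d T).

Definition sp_blocks (S : simple_process) : seq block :=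
  [seq (sp_time S k, sp_time S k.+1, sp_coef S k) | k <- index_iota 0 (sp_size S)].

Definition opp_block (x : block) : block := (x.1, fun w => - x.2 w).

Lemma sp_time_ge0 (S : simple_process) k : sp_adapted F S -> 0 <= sp_time S k.
Proof. by case=> S0 SS _; elim: k => // k IH; exact: le_trans (SS k). Qed.

Lemma good_sp_blocks (S : simple_process) : sp_adapted F S -> good_blocks F (sp_blocks S).
Proof.
move=> aS x; rewrite /sp_blocks; elim: (index_iota _ _) => //= k r IH [<-|/IH//].
case: (aS) => _ S1 /(_ k)[S2 S3]; split => //=; exact: sp_time_ge0.
Qed.

Lemma good_opp_blocks bs : good_blocks F bs -> good_blocks F (map opp_block bs).
Proof.
elim: bs => // x bs IH gb y /= [<-|]; last by apply: IH => z zb; apply: gb; right.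
have [x0 x1 Fx [K bK]] := gb _ (or_introl erefl).
split => //=; last by exists K => w; rewrite normrN.
move=> A mA; rewrite (_ : _ @^-1` _ = x.2 @^-1` (-%R @^-1` A))//.
by apply: Fx; rewrite -[X in measurable X]setTI; exact: oppr_measurable.
Qed.

Lemma sum_inc_sp (S : simple_process) t w :
  sum_inc B t (sp_blocks S) w = sp_integral S B t w.
Proof. by rewrite /sum_inc /sp_blocks big_map big_mkord. Qed.

Lemma sum_val_sp (S : simple_process) s w :
  sum_val (sp_blocks S) s w = sp_val S s w.
Proof. by rewrite /sum_val /sp_blocks big_map big_mkord. Qed.

Lemma sum_inc_opp (t : R) bs w : sum_inc B t (map opp_block bs) w = - sum_inc B t bs w.
Proof.
rewrite /sum_inc big_map -sumrN; apply: eq_bigr => x _.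
by rewrite /block_inc /= mulNr.
Qed.

Lemma sum_val_opp (s : R) bs w : sum_val (map opp_block bs) s w = - sum_val bs s w.
Proof.
rewrite /sum_val big_map -sumrN; apply: eq_bigr => x _.
by rewrite /block_val /= mulNr.
Qed.

Lemma measurable_sum_inc (t : R) bs : 0 <= t -> good_blocks F bs ->
  measurable_fun setT (sum_inc B t bs).
Proof.
move=> t0; rewrite /sum_inc; elim: bs => [|x bs IH] gb.
  by rewrite (_ : (fun w => _) = cst 0)//; apply/funext => w; rewrite big_nil.
rewrite (_ : (fun w => _) = (fun w => block_inc B t x w + \sum_(y <- bs) block_inc B t y w)); last first.
  by apply/funext => w; rewrite big_cons.
have [x0 xx Fx _] := gb _ (or_introl erefl).
apply: measurable_funD; last by apply: IH => y yb; apply: gb; right.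
apply: measurable_funM.
  by apply: meas_wrt_measurable Fx; case: Ff => /(_ x.1.1 x0)[].
by apply: (measurable_inc Ff Bb); rewrite le_min t0 andbT// (le_trans x0).
Qed.

Lemma measurable_sum_val bs : good_blocks F bs ->
  measurable_fun setT (fun z : measurableTypeR R * T => sum_val bs z.1 z.2).
Proof.
rewrite /sum_val; elim: bs => [|x bs IH] gb.
  by rewrite (_ : (fun w => _) = cst 0)//; apply/funext => w; rewrite big_nil.
rewrite (_ : (fun w => _) = (fun z => block_val x z.1 z.2 + \sum_(y <- bs) block_val y z.1 z.2)); last first.
  by apply/funext => w; rewrite big_cons.
have [x0 xx Fx _] := gb _ (or_introl erefl).
apply: measurable_funD; last by apply: IH => y yb; apply: gb; right.
apply: measurable_funM.
  apply: (measurableT_comp (f := x.2)); last exact: measurable_snd.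
  by apply: meas_wrt_measurable Fx; case: Ff => /(_ x.1.1 x0)[].
apply: (measurableT_comp (f := inoc x.1.1 x.1.2)); last exact: measurable_fst.
exact: measurable_inoc.
Qed.

Lemma measurable_time_integral (t : R) (g : measurableTypeR R * T -> \bar R) :
  measurable_fun (`[0%R, t] `*` setT) g -> (forall z, 0 <= g z)%E ->
  measurable_fun setT (fun w => \int[leb]_(s in `[0%R, t]) g (s, w))%E.
Proof.
move=> mg g0; have mD : measurable (`[0%R, t]%classic `*` setT : set (measurableTypeR R * T)).
  exact: measurableX.
rewrite (_ : (fun w => _) = fubini_G leb (g \_ (`[0%R, t]%classic `*` setT))).
  apply: measurable_fun_fubini_tonelli_G; first exact/(measurable_restrictT _ mD).
  by move=> z; rewrite patchE; case: ifP.
apply/funext => w; rewrite /fubini_G [LHS]integral_mkcond; apply: eq_integral => s _.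
rewrite !patchE; congr (if _ then _ else _).
by apply/idP/idP; rewrite !inE; [split|case].
Qed.

Let two_kappa_two (x y : \bar R) : (0 <= x)%E -> (0 <= y)%E ->
  (2%:E * (kappa%:E * (2%:E * x + 2%:E * y)) = (4 * kappa)%:E * x + (4 * kappa)%:E * y)%E.
Proof.
move=> x0 y0; have k0 := @kappa_ge0 R.
have q1 : (0 <= 2%:E * x)%E by rewrite mule_ge0.
have q2 : (0 <= 2%:E * y)%E by rewrite mule_ge0.
have kq1 : (0 <= kappa%:E * (2%:E * x))%E by rewrite mule_ge0.
have kq2 : (0 <= kappa%:E * (2%:E * y))%E by rewrite mule_ge0.
rewrite (ge0_muleDr _ q1 q2) (ge0_muleDr _ kq1 kq2) !muleA -!EFinM.
by rewrite (_ : 2 * kappa * 2 = 4 * kappa)//; ring.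
Qed.

(* The factor 4 comes from using [(x + y) ^ 2 <= 2 * x ^ 2 + 2 * y ^ 2] twice. *)
Lemma ito_dist (H : R -> T -> R) (t : R) (I : T -> R) bs : 0 <= t ->
  ito_integral P F B H t I -> good_blocks F bs ->
  (\int[P]_w ((I w - sum_inc B t bs w) ^+ 2)%:E <=
   (4 * kappa)%:E * \int[P]_w \int[leb]_(s in `[0%R, t]) ((H s w - sum_val bs s w) ^+ 2)%:E)%E.
Proof.
move=> t0 [aH mH mI [S [aS HS IS]]] gb.
have k0 := @kappa_ge0 R.
have mHV bs' : good_blocks F bs' -> measurable_fun (`[0%R, t] `*` setT)
   (fun z : measurableTypeR R * T => ((H z.1 z.2 - sum_val bs' z.1 z.2) ^+ 2)%:E).
  move=> gb'; apply/measurable_EFinP; apply: measurable_funX; apply: measurable_funB => //.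
  by apply: measurable_funTS; exact: measurable_sum_val.
pose Q bs' := (\int[P]_w \int[leb]_(s in `[0%R, t]) ((H s w - sum_val bs' s w) ^+ 2)%:E)%E.
have Q0 bs' : (0 <= Q bs')%E.
  by apply: integral_ge0 => w _; apply: integral_ge0 => s _; rewrite lee_fin sqr_ge0.
pose A bs' := (\int[P]_w ((I w - sum_inc B t bs' w) ^+ 2)%:E)%E.
have sqr2 (x y z : R) : (x - z) ^+ 2 <= 2 * (x - y) ^+ 2 + 2 * (y - z) ^+ 2.
  have := sqr_ge0 ((x - y) - (y - z)); rewrite !sqrrB !expr2; lra.
(* Here [bs'] is to be one of the simple processes that define [I]. Passing through it, the isometry
   turns a distance of elementary integrals into a distance of integrands, which is split again
   through [H]. The two terms in [bs'] then vanish in the limit. *)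
have tri bs' : good_blocks F bs' ->
  (A bs <= (2%:E * A bs' + (4 * kappa)%:E * Q bs') + (4 * kappa)%:E * Q bs)%E.
  move=> gb'.
  have mJ := measurable_sum_inc t0 gb; have mJ' := measurable_sum_inc t0 gb'.
  have mA bs'' : good_blocks F bs'' -> measurable_fun setT (fun w => ((I w - sum_inc B t bs'' w) ^+ 2)%:E).
    move=> g; apply/measurable_EFinP; apply: measurable_funX; apply: measurable_funB => //.
    exact: measurable_sum_inc.
  have mJJ : measurable_fun setT (fun w => ((sum_inc B t bs' w - sum_inc B t bs w) ^+ 2)%:E).
    by apply/measurable_EFinP; apply: measurable_funX; exact: measurable_funB.
  have gbb : good_blocks F (bs' ++ map opp_block bs).
    move=> x /(@List.in_app_or _ _ _ _)[]; first exact: gb'.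
    exact: good_opp_blocks.
  have step1 : (A bs <= 2%:E * A bs' + 2%:E * \int[P]_w ((sum_inc B t bs' w - sum_inc B t bs w) ^+ 2)%:E)%E.
    rewrite -!ge0_integralZl//; do ?[exact: mA | by move=> w _; rewrite lee_fin sqr_ge0].
    rewrite -ge0_integralD//; do ?[by apply: measurable_funeM; exact: mA |
      exact: measurable_funeM | by move=> w _; rewrite -EFinM lee_fin mulr_ge0// sqr_ge0].
    apply: ge0_le_integral => //.
    - by move=> w _; rewrite lee_fin sqr_ge0.
    - exact: mA.
    - by apply: emeasurable_funD; apply: measurable_funeM => //; exact: mA.
    - by move=> w _; rewrite -!EFinM -EFinD lee_fin sqr2.
  apply: (le_trans step1); rewrite -addeA leeD2l//.
  have -> : (\int[P]_w ((sum_inc B t bs' w - sum_inc B t bs w) ^+ 2)%:E =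
     kappa%:E * \int[P]_w \int[leb]_(s in `[0%R, t]) ((sum_val bs' s w - sum_val bs s w) ^+ 2)%:E)%E.
    have := elementary_isometry Ff Bb t0 gbb.
    under eq_integral do rewrite /sum_inc big_cat /= -!/(sum_inc _ _ _ _) sum_inc_opp.
    move=> ->; congr (_ * _)%E; apply: eq_integral => w _; apply: eq_integral => s _.
    by rewrite /sum_val big_cat /= -!/(sum_val _ _ _) sum_val_opp.
  set X := (\int[P]_w \int[leb]_(s in `[0%R, t]) ((sum_val bs' s w - sum_val bs s w) ^+ 2)%:E)%E.
  have HX : (X <= 2%:E * Q bs' + 2%:E * Q bs)%E.
    have mV bs'' : good_blocks F bs'' -> measurable_fun (`[0%R, t] `*` setT)
        (fun z : measurableTypeR R * T => sum_val bs'' z.1 z.2).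
      by move=> g; apply: measurable_funTS; exact: measurable_sum_val.
    have mI2 (g : measurableTypeR R * T -> R) : measurable_fun (`[0%R, t] `*` setT) (fun z => (g z ^+ 2)%:E) ->
        measurable_fun setT (fun w => \int[leb]_(s in `[0%R, t]) (g (s, w) ^+ 2)%:E)%E.
      move=> mg; apply: (@measurable_time_integral t (fun z => (g z ^+ 2)%:E)) => //.
      by move=> z; rewrite lee_fin sqr_ge0.
    have mQ bs'' : good_blocks F bs'' -> measurable_fun setT
       (fun w => \int[leb]_(s in `[0%R, t]) ((H s w - sum_val bs'' s w) ^+ 2)%:E)%E.
      by move=> g; apply: (mI2 (fun z => H z.1 z.2 - sum_val bs'' z.1 z.2)); exact: mHV.
    have sec (g : measurableTypeR R * T -> R) w : measurable_fun (`[0%R, t] `*` setT) (fun z => (g z ^+ 2)%:E) ->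
        measurable_fun `[0%R, t] (fun s => (g (s, w) ^+ 2)%:E).
      move=> mg; apply: (measurable_comp (F := `[0%R, t]%classic `*` setT) _ _ mg).
      - exact: measurableX.
      - by move=> _ [s /= s0 <-].
      - exact: (measurable_funS measurableT _ (measurable_pair2 w)).
    have secH bs'' w : good_blocks F bs'' -> measurable_fun `[0%R, t] (fun s => ((H s w - sum_val bs'' s w) ^+ 2)%:E).
      by move=> g; apply: (sec (fun z => H z.1 z.2 - sum_val bs'' z.1 z.2)); exact: mHV.
    have pos (g : R -> R) : (0 <= \int[leb]_(s in `[0%R, t]) ((g s) ^+ 2)%:E)%E.
      by apply: integral_ge0 => s _; rewrite lee_fin sqr_ge0.
    rewrite /Q -!ge0_integralZl//; do ?[exact: mQ | by move=> w _; exact: pos].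
    rewrite -ge0_integralD//; do ?[by apply: measurable_funeM; exact: mQ |
      by move=> w _; rewrite mule_ge0// pos].
    have mVV : measurable_fun (`[0%R, t] `*` setT) (fun z : measurableTypeR R * T =>
       ((sum_val bs' z.1 z.2 - sum_val bs z.1 z.2) ^+ 2)%:E).
      by apply/measurable_EFinP; apply: measurable_funX; apply: measurable_funB; exact: mV.
    apply: ge0_le_integral => //.
    - refine (mI2 (fun z => sum_val bs' z.1 z.2 - sum_val bs z.1 z.2) mVV).
    - by apply: emeasurable_funD; apply: measurable_funeM => //; exact: mQ.
    move=> w _.
    rewrite -!ge0_integralZl//; do ?[exact: secH | by move=> s _; rewrite lee_fin sqr_ge0].
    rewrite -ge0_integralD//; do ?[by apply: measurable_funeM; exact: secH |
      by move=> s _; rewrite -EFinM lee_fin mulr_ge0// sqr_ge0].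
    apply: ge0_le_integral => //.
    - by move=> s _; rewrite lee_fin sqr_ge0.
    - refine (sec (fun z => sum_val bs' z.1 z.2 - sum_val bs z.1 z.2) w mVV).
    - by apply: emeasurable_funD; apply: measurable_funeM => //; exact: secH.
    - move=> s _; rewrite -!EFinM -EFinD lee_fin.
      by rewrite -[X in 2 * X + _]sqrrN opprB sqr2.
  apply: (@le_trans _ _ (2%:E * (kappa%:E * (2%:E * Q bs' + 2%:E * Q bs)))%E).
    by rewrite lee_wpmul2l// lee_wpmul2l// lee_fin.
  by rewrite two_kappa_two.
have lim0 : (2%:E * A (sp_blocks (S n)) + (4 * kappa)%:E * Q (sp_blocks (S n)) + (4 * kappa)%:E * Q bs)%E
    @[n --> \oo] --> (0 + (4 * kappa)%:E * Q bs)%E.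
  apply: cvgeD; [by []| |exact: cvg_cst].
  rewrite -[X in _ --> X]adde0; apply: cvgeD => //.
    have cA : A (sp_blocks (S n)) @[n --> \oo] --> 0%E.
      move: IS; rewrite /A unlock; apply: cvg_trans; apply: near_eq_cvg; apply: nearW => n.
      by apply: eq_integral => w _; rewrite sum_inc_sp.
    by have := cvgeZl (isT : 2%:E \is a fin_num) cA; rewrite mule0.
  have cQ : Q (sp_blocks (S n)) @[n --> \oo] --> 0%E.
    move: HS; apply: cvg_trans; apply: near_eq_cvg; apply: nearW => n.
    by apply: eq_integral => w _; apply: eq_integral => s _; rewrite sum_val_sp.
  by have := cvgeZl (isT : (4 * kappa)%:E \is a fin_num) cQ; rewrite mule0.
rewrite -[leRHS]add0e; apply: (cvge_to_ge lim0); apply: nearW => n.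
by apply: tri; exact: good_sp_blocks.
Qed.

End ItoApproximation.

(** * Laws of finite noise sequences *)

Section Rectangles.
Context {R : realType}.

(** Infinite sequences stand for [n]-tuples: the generated sigma-algebra sees only the first [n]
    coordinates, and the noise can be indexed by [nat] throughout. *)
Definition rectangles (n : nat) : set (set (nat -> R)) :=
  [set E | exists2 A : nat -> set R, (forall k, measurable (A k)) &
     E = [set x | forall k, (k < n)%N -> A k (x k)]].

Definition path_space (n : nat) := g_sigma_algebraType (rectangles n).

Lemma measurable_coord n k : (k < n)%N ->
  measurable_fun setT ((fun x => x k) : path_space n -> R).
Proof.
move=> kn _ A mA; rewrite setTI; apply: sub_sigma_algebra.
exists (fun j => if j == k then A else setT); first by move=> j; case: ifP.
apply/seteqP; split => x /= H; first by move=> j jn; case: eqP => // ->.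
by have := H k kn; rewrite eqxx.
Qed.

Lemma measurable_to_path_space n d (T : measurableType d) (xi : T -> nat -> R) :
  (forall k, (k < n)%N -> measurable_fun setT (xi ^~ k)) ->
  measurable_fun setT (xi : T -> path_space n).
Proof.
move=> mxi; apply: (@measurability _ _ T (path_space n) setT xi (rectangles n)) => //.
move=> _ [_ [A mA ->] <-]; rewrite setTI.
rewrite (_ : _ @^-1` _ = \bigcap_(k in `I_n) (xi ^~ k) @^-1` A k).
  case: n mxi => [|n] mxi.
    by rewrite (_ : \bigcap_(_ in _) _ = setT)//; apply/seteqP; split.
  apply: bigcap_measurable; first by exists 0%N.
  by move=> k /= kn; rewrite -[X in measurable X]setTI; exact: mxi.
by apply/seteqP; split.
Qed.

(** Rectangles are stable under intersection and generate the sigma-algebra, so agreement on them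
    forces the two image measures to coincide. *)
Lemma rectangle_law n d (T : measurableType d) (P : probability T R)
    d' (T' : measurableType d') (P' : probability T' R)
    (xi : T -> nat -> R) (xi' : T' -> nat -> R) (F : (nat -> R) -> R) (c : R) :
  (forall k, (k < n)%N -> measurable_fun setT (xi ^~ k)) ->
  (forall k, (k < n)%N -> measurable_fun setT (xi' ^~ k)) ->
  (forall A : nat -> set R, (forall k, measurable (A k)) ->
     P (\bigcap_(k in `I_n) (xi ^~ k) @^-1` A k) = P' (\bigcap_(k in `I_n) (xi' ^~ k) @^-1` A k)) ->
  measurable_fun setT (F : path_space n -> R) -> (forall x, `|F x| <= c) ->
  \int[P]_w F (xi w) = \int[P']_w F (xi' w).
Proof.
move=> mxi mxi' H mF Fc.
have m1 := measurable_to_path_space mxi; have m2 := measurable_to_path_space mxi'.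
have E (A : set (path_space n)) : measurable A -> pushm P m1 A = pushm P' m2 A.
  apply: (@measure_unique _ R (path_space n) (rectangles n) (fun=> setT)) => //.
  - move=> _ _ [A1 mA1 ->] [A2 mA2 ->]; exists (fun k => A1 k `&` A2 k).
      by move=> k; exact: measurableI.
    by apply/seteqP; split => x /= => [[h1 h2] k kn|h]; split; do ?[exact: h1|exact: h2|move=> k kn; case: (h k kn)].
  - by move=> _; exists (fun=> setT) => //; apply/seteqP; split.
  - by apply/seteqP; split => // x _; exists 0%N.
  - by move=> _ [A' mA' ->]; exact: H.
  - move=> _; rewrite -ge0_fin_numE// (_ : pushm _ _ _ = P setT)//.
    by rewrite fin_num_measure.
have iF d1 (T1 : measurableType d1) (P1 : probability T1 R) (x1 : T1 -> nat -> R) :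
    measurable_fun setT (x1 : T1 -> path_space n) ->
    P1.-integrable setT ((EFin \o F) \o (x1 : T1 -> path_space n)).
  move=> mx; apply: (@integrable_bounded _ _ _ P1 setT (F \o x1) c) => //.
    by rewrite -ge0_fin_numE// fin_num_measure.
  - exact: (measurableT_comp mF mx).
  - by move=> x _; exact: Fc.
have mEF : measurable_fun setT (EFin \o F : path_space n -> \bar R) by exact/measurable_EFinP.
rewrite /Rintegral; congr fine.
transitivity (\int[pushm P m1]_x (F x)%:E)%E.
  by rewrite integral_pushforward//; exact: iF.
rewrite (eq_measure_integral (pushm P' m2)); last by move=> A mA _; exact: E.
by rewrite integral_pushforward//; exact: iF.
Qed.

End Rectangles.

Section GaussianIncrements.
Context {R : realType} d (T : measurableType d) (P : probability T R).
Variables (F : R -> set (set T)) (B : R -> T -> R).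
Hypothesis Ff : filtration F.
Hypothesis Bb : brownian_motion P F B.

(** The parameter [s] is the standard deviation. A state with zero volatility, or equivalently a
    clock that stands still, gives a point mass at 0. *)
Definition gauss (s : R) (A : set R) : \bar R :=
  if s == 0 then \d_(0 : R) A else normal_prob 0 s A.

(** One statement for both sides of the transfer: a regular grid [u] with the volatilities as [c],
    and an irregular clock [u] with constant [c]. *)
Lemma increments_law (u c : nat -> R) (A : nat -> set R) n : 0 <= u 0%N ->
  (forall k, u k <= u k.+1) -> (forall k, measurable (A k)) ->
  P (\bigcap_(k in `I_n) (fun w => c k * inc B (u k) (u k.+1) w) @^-1` A k) =
  (\prod_(k < n) gauss (`|c k| * Num.sqrt (u k.+1 - u k)) (A k))%E.
Proof.
move=> u0 uS mA; have u_ge0 k : 0 <= u k by elim: k => // k IH; exact: le_trans (uS k).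
have sF (t : R) : 0 <= t -> sigma_algebra setT (F t) by case: Ff => /(_ t) + _ t0; case/(_ t0).
have mcA (b : R) (C : set R) : measurable C -> measurable ((fun x : R => b * x) @^-1` C).
  by move=> mC; rewrite -[X in measurable X]setTI; exact: mulrl_measurable.
(* The induction also carries the membership of the event in [F (u n)], which the independence of
   the next increment requires. *)
suff [_ ->] : F (u n) (\bigcap_(k in `I_n) (fun w => c k * inc B (u k) (u k.+1) w) @^-1` A k) /\
  P (\bigcap_(k in `I_n) (fun w => c k * inc B (u k) (u k.+1) w) @^-1` A k) =
  (\prod_(k < n) gauss (`|c k| * Num.sqrt (u k.+1 - u k)) (A k))%E by [].
elim: n => [|n [Fn Pn]].
  rewrite (_ : \bigcap_(_ in _) _ = setT); last by apply/seteqP; split.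
  rewrite big_ord0 probability_setT; split => //.
  have [s0 sC _] := sF _ (u_ge0 0%N).
  by have := sC _ s0; rewrite setD0.
have capS : \bigcap_(k in `I_n.+1) (fun w => c k * inc B (u k) (u k.+1) w) @^-1` A k =
    \bigcap_(k in `I_n) (fun w => c k * inc B (u k) (u k.+1) w) @^-1` A k `&`
    inc B (u n) (u n.+1) @^-1` ((fun x => c n * x) @^-1` A n).
  apply/seteqP; split => w /=.
    by move=> H; split; [move=> k /= kn; apply: H; exact: ltnW|exact: (H n (ltnSn n))].
  by move=> [H1 H2] k /=; rewrite ltnS leq_eqVlt => /predU1P[->//|kn]; exact: H1.
rewrite capS big_ord_recr /= -Pn.
have FS : F (u n) `<=` F (u n.+1) by case: Ff => _; apply.
split.
  have GE : @measurable _ (g_sigma_algebraType (F (u n.+1))) = F (u n.+1).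
    exact/sigma_algebra_id/sF.
  rewrite -GE; apply: measurableI; rewrite GE; first exact: FS.
  by apply: (meas_wrt_inc Ff Bb) => //; exact: mcA.
set E := \bigcap_(_ in _) _ in Fn *.
have [deg|ndeg] := eqVneq (`|c n| * Num.sqrt (u n.+1 - u n)) 0.
  have z w : c n * inc B (u n) (u n.+1) w = 0.
    move/eqP : deg; rewrite mulf_eq0 normr_eq0 => /orP[/eqP ->|]; first by rewrite mul0r.
    rewrite sqrtr_eq0 subr_le0 => le; have -> : u n.+1 = u n by apply/eqP; rewrite eq_le le uS.
    by rewrite /inc subrr mulr0.
  rewrite /gauss deg eqxx diracE.
  have [A0|nA0] := pselect (A n 0).
    rewrite mem_set// mule1; congr (P _); apply/seteqP; split => w; first by case.
    by move=> Ew; split => //=; rewrite z.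
  rewrite memNset// mule0 (_ : _ `&` _ = set0) ?measure0//.
  by apply/seteqP; split => // w [_ /=]; rewrite z.
have c0 : c n != 0 by apply: contraNneq ndeg => ->; rewrite normr0 mul0r.
have uu : u n < u n.+1.
  rewrite lt_neqAle uS andbT; apply: contraNneq ndeg => ->.
  by rewrite subrr sqrtr0 mulr0.
rewrite /gauss (negbTE ndeg).
have s0 : 0 < Num.sqrt (u n.+1 - u n) by rewrite sqrtr_gt0 subr_gt0.
rewrite -normal_prob_scale// -(inc_law Bb)//; last exact: mcA.
case: Bb => _ _ _ /(_ _ _ (u_ge0 n) uu) /= [_]; apply => //; exact: mcA.
Qed.

End GaussianIncrements.

(** * Occupation times of the fast chain *)

Section Poisson.
Context {R : realType} {d : nat}.
Variables (Q : 'M[R]_d) (p : 'cV[R]_d).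
Hypothesis Qgen : generator Q.
Hypothesis pinv : unique_invariant_distribution Q p.

Lemma invariant_ge0_unique (v : 'rV[R]_d) : (forall i, 0 <= v ord0 i) ->
  v *m Q = 0 -> exists c, v = c *: p^T.
Proof.
move=> v0 vQ; pose c := \sum_i v ord0 i.
have c0 : 0 <= c by exact: sumr_ge0.
have [cE|cn0] := eqVneq c 0.
  exists 0; rewrite scale0r; apply/rowP => i; rewrite mxE.
  exact: (psumr_eq0P (fun i _ => v0 i) cE).
exists c; have <- : (c^-1 *: v)^T = p.
  apply: pinv.2; split.
  - by move=> i; rewrite !mxE mulr_ge0// invr_ge0.
  - by rewrite trmxK -scalemxAl vQ scaler0.
  - rewrite /dotp mxE (eq_bigr (fun i => c^-1 * v ord0 i)).
      by rewrite -mulr_sumr mulVf.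
    by move=> i _; rewrite !mxE mul1r.
by rewrite trmxK scalerA mulfV// scale1r.
Qed.

(** Nonnegative off-diagonal entries make every entry of the product nonnegative by the triangle
    inequality, and zero row sums make the entries add up to 0; hence all of them vanish. *)
Lemma abs_invariant (u : 'rV[R]_d) : u *m Q = 0 -> map_mx Num.norm u *m Q = 0.
Proof.
move=> uQ; have [Qoff Qrow] := Qgen.
have ge0 j : 0 <= (map_mx Num.norm u *m Q) ord0 j.
  have : (u *m Q) ord0 j = 0 by rewrite uQ mxE.
  rewrite mxE (bigD1 j)//= => /eqP; rewrite addr_eq0 => /eqP E.
  rewrite mxE (bigD1 j)//= mxE.
  rewrite (eq_bigr (fun i => `|u ord0 i * Q i j|)); last first.
    by move=> i ij; rewrite mxE normrM (ger0_norm (Qoff _ _ ij)).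
  have h : `|u ord0 j * Q j j| <= \sum_(i < d | i != j) `|u ord0 i * Q i j|.
    by rewrite E normrN ler_norm_sum.
  rewrite normrM in h.
  have h2 : - (`|u ord0 j| * Q j j) <= `|u ord0 j| * `|Q j j|.
    by rewrite -mulrN ler_wpM2l// -normrN ler_norm.
  by rewrite -lerBlDl sub0r (le_trans h2 h).
have s0 : \sum_j (map_mx Num.norm u *m Q) ord0 j = 0.
  under eq_bigr do rewrite mxE.
  rewrite exchange_big /= big1// => i _.
  by rewrite -mulr_sumr Qrow mulr0.
apply/rowP => j; rewrite [RHS]mxE.
exact: (psumr_eq0P (fun i _ => ge0 i) s0).
Qed.

(** An invariant signed vector is [(|u| + u) - |u|], a difference of two nonnegative invariant
    vectors, each a multiple of [p] by uniqueness of the invariant distribution. *)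
Lemma left_kernel (u : 'rV[R]_d) : u *m Q = 0 -> exists c, u = c *: p^T.
Proof.
move=> uQ; have aQ := abs_invariant uQ.
have [i|c1 E1] := invariant_ge0_unique _ aQ; first by rewrite mxE.
have [i||c2 E2] := @invariant_ge0_unique (map_mx Num.norm u + u).
- by rewrite !mxE -lerBlDr sub0r -normrN ler_norm.
- by rewrite mulmxDl aQ uQ addr0.
by exists (c2 - c1); rewrite scalerBl -E1 -E2 addrC addKr.
Qed.

(** Fredholm alternative: [f] is in the column space of [Q] as soon as it is orthogonal to the left
    kernel, which is spanned by [p]. The columns of [cokermx] of the transpose provide the kernel
    vectors to test against. *)
Lemma poisson (f : 'cV[R]_d) : dotp p f = 0 -> exists g : 'cV[R]_d, Q *m g = f.
Proof.
move=> pf; have : (f^T <= Q^T)%MS.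
  rewrite submxE; apply/eqP/matrixP => i j; rewrite [RHS]mxE ord1.
  have : Q^T *m col j (cokermx Q^T) = 0 by rewrite colE mulmxA mulmx_coker mul0mx.
  set v := col j _ => Qv.
  have [|c vE] := @left_kernel v^T.
    by rewrite -[Q]trmxK -trmx_mul Qv trmx0.
  have -> : (f^T *m cokermx Q^T) ord0 j = (f^T *m v) ord0 ord0.
    by rewrite !mxE; apply: eq_bigr => k _; congr (_ * _); rewrite /v [RHS]mxE.
  have -> : v = c *: p by rewrite -[v]trmxK vE linearZ /= trmxK.
  rewrite -scalemxAr mxE (_ : (f^T *m p) ord0 ord0 = dotp p f); first by rewrite pf mulr0.
  by rewrite /dotp -[f^T *m p]trmxK trmx_mul trmxK mxE.
move=> /submxP[D fD]; exists D^T.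
by rewrite -[f]trmxK fD trmx_mul trmxK.
Qed.

End Poisson.

Section MatrixExponential.
Context {R : realType} {d : nat}.
Variable Q : 'M[R]_d.
Let q : R := \sum_i \sum_j `|Q i j|.

Let q0 : 0 <= q. Proof. by apply: sumr_ge0 => i _; exact: sumr_ge0. Qed.

Lemma mx_power_bound k i j : `|(Q ^+ k) i j| <= q ^+ k.
Proof.
elim: k i j => [|k IH] i j; first by rewrite !expr0 mxE normr_nat lern1 leq_b1.
rewrite !exprS mxE (le_trans (ler_norm_sum _ _ _))//.
apply: (@le_trans _ _ (\sum_l `|Q i l| * q ^+ k)).
  by apply: ler_sum => l _; rewrite normrM ler_wpM2l.
rewrite -mulr_suml ler_wpM2r ?exprn_ge0// /q [leRHS](bigD1 i)//= lerDl.
by apply: sumr_ge0 => l _; exact: sumr_ge0.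
Qed.

Lemma scale_mx_exp (e : R) k : (e *: Q) ^+ k = e ^+ k *: Q ^+ k.
Proof.
elim: k => [|k IH]; first by rewrite !expr0 scale1r.
by rewrite !exprS IH -[LHS]scalemxAl -scalemxAr scalerA.
Qed.

(** The entries of [Q ^+ k] are at most [q ^+ k], with [q] the sum of all [|Q i j|]. For [e <= 1] a
    factor [e ^+ 2] comes out of the tail of the series, and the rest is bounded by the exponential
    series of [q]. *)
Lemma expmx_expansion : exists2 C : R, 0 <= C & forall e i j, 0 <= e <= 1 ->
  `|expmx (e *: Q) i j - ((i == j)%:R + e * Q i j)| <= C * e ^+ 2.
Proof.
exists (expR q); first exact: expR_ge0.
move=> e i j /andP[e0 e1]; rewrite /expmx mxE.
set u := fun k => _.
have ub k : `|u k| <= e ^+ k * exp_coeff q k.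
  rewrite /u scale_mx_exp mxE /exp_coeff /= 2!normrM (ger0_norm (exprn_ge0 k e0)).
  rewrite normfV normr_nat -mulrA ler_wpM2l ?exprn_ge0// ler_wpM2r ?invr_ge0//.
  exact: mx_power_bound.
have ec0 k : 0 <= exp_coeff q k by rewrite /exp_coeff /= divr_ge0// exprn_ge0.
have cu : cvgn (series u).
  apply: normed_cvg; apply: series_le_cvg (is_cvg_series_exp_coeff q) => k.
  - exact: normr_ge0.
  - exact: ec0.
  - by rewrite (le_trans (ub k))// ler_piMl// exprn_ile1.
have cl : `|series u n - ((i == j)%:R + e * Q i j)| @[n --> \oo]
    --> `|limn (series u) - ((i == j)%:R + e * Q i j)|.
  by apply: cvg_norm; apply: cvgB; [exact: cu|exact: cvg_cst].
apply: (cvgr_to_le cl); exists 2%N => // n /= n2.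
rewrite -(subnK n2) addn2 /series /= big_nat_recl// big_nat_recl//=.
have -> : u 0%N = (i == j)%:R by rewrite /u expr0 mxE fact0 divr1.
have -> : u 1%N = e * Q i j by rewrite /u expr1 mxE (_ : 1`!%N = 1%N)// divr1.
set S2 := (X in _ + (_ + X)).
have -> : (i == j)%:R + (e * Q i j + S2) - ((i == j)%:R + e * Q i j) = S2 by ring.
rewrite /S2 (le_trans (ler_norm_sum _ _ _))//.
apply: (@le_trans _ _ (\sum_(0 <= k < n - 2) e ^+ 2 * exp_coeff q k.+2)).
  apply: ler_sum => k _; rewrite (le_trans (ub _))// ler_wpM2r//.
  by rewrite -addn2 exprD ler_piMl ?exprn_ge0// exprn_ile1.
rewrite -mulr_sumr mulrC ler_wpM2r ?exprn_ge0//.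
apply: (@le_trans _ _ (series (exp_coeff q) (n - 2).+2)).
  rewrite /series /= [leRHS]big_nat_recl// big_nat_recl//= addrA lerDr.
  by rewrite addr_ge0.
apply: nondecreasing_cvgn_le; last exact: is_cvg_series_exp_coeff.
by apply: nondecreasing_series => k _ _.
Qed.

End MatrixExponential.

Section Histories.
Context {R : realType} {d : nat}.

(* Histories list the visited states, the most recent one first. *)
Fixpoint histories (k : nat) : seq (seq 'I_d) :=
  if k is k'.+1 then [seq l :: s | s <- histories k', l <- enum 'I_d]
  else [seq [:: l] | l <- enum 'I_d].

Lemma size_histories k s : s \in histories k -> size s = k.+1.
Proof.
elim: k s => [|k IH] s /=; first by move=> /mapP[l _ ->].
by move=> /allpairsP[[s' l] /= [/IH s'k _ ->]] /=; rewrite s'k.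
Qed.

Lemma histories_uniq k : uniq (histories k).
Proof.
elim: k => [|k IH] /=; first by rewrite map_inj_uniq ?enum_uniq// => i j [].
apply: allpairs_uniq => //; first exact: enum_uniq.
by move=> [s l] [s' l'] /= _ _ [-> ->].
Qed.

Lemma mem_histories k s : (s \in histories k) = (size s == k.+1).
Proof.
apply/idP/eqP => [/size_histories//|].
elim: k s => [|k IH] [|l s]//= [].
  by move=> /size0nil ->; apply/mapP; exists l => //; rewrite mem_enum.
move=> /IH sk; apply/allpairsP; exists (s, l) => /=; split => //.
by rewrite mem_enum.
Qed.

Lemma big_histories k (f : seq 'I_d -> R) :
  \sum_(s <- histories k.+1) f s = \sum_(s <- histories k) \sum_l f (l :: s).
Proof.
rewrite /= big_allpairs_dep; apply: eq_bigr => s _.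
by rewrite big_enum.
Qed.

(** The properties of the trajectory probabilities from which the second-moment bound is derived, so
    that this bound involves no probability space. The state [i0] is only the default of [head],
    histories being nonempty. *)
Definition history_weights (i0 : 'I_d) (A : 'M[R]_d) (w : nat -> seq 'I_d -> R) :=
  [/\ forall k s, 0 <= w k s,
      forall k, \sum_(s <- histories k) w k s = 1
    & forall k s l, s \in histories k -> w k.+1 (l :: s) = w k s * A (head i0 s) l].

End Histories.

(** * Second moment of the occupation sums *)

Section OccupationBound.
Context {R : realType} {d : nat}.
Variables (Q : 'M[R]_d) (p : 'cV[R]_d).
Hypothesis Qgen : generator Q.
Hypothesis pinv : unique_invariant_distribution Q p.

(* With [f = Q g], the process [h * \sum_(j < k) f (X j) - g (X k) / N] is a
   martingale up to terms of order [h ^+ 2], with increments of order [1 / N]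
   on jumps, whose total number is of order [N]. *)
Lemma occupation_L2 (f : 'cV[R]_d) (S : R) : dotp p f = 0 -> 0 <= S ->
  exists2 K : R, 0 <= K & forall (i0 : 'I_d) (N : nat) (h : R) w, (0 < N)%N -> 0 < h ->
    h * N%:R ^+ 3 <= 1 -> history_weights i0 (expmx (h *: (N%:R *: Q))) w ->
    forall k, k%:R * h <= S ->
    \sum_(s <- histories k) w k s * (h * \sum_(x <- behead s) f x ord0) ^+ 2 <= K / N%:R.
Proof.
move=> pf S0; have [g Qg] := poisson Qgen pinv pf.
have [C C0 HC] := expmx_expansion Q.
pose q : R := \sum_i \sum_j `|Q i j|.
pose Fm : R := \sum_i `|f i ord0|; pose Gm : R := \sum_i `|g i ord0|.
have q0 : 0 <= q by apply: sumr_ge0 => i _; exact: sumr_ge0.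
have Fm0 : 0 <= Fm by exact: sumr_ge0.
have Gm0 : 0 <= Gm by exact: sumr_ge0.
have le1 (u : 'I_d -> R) i : `|u i| <= \sum_j `|u j|.
  by rewrite (bigD1 i)//= lerDl sumr_ge0.
have fF i : `|f i ord0| <= Fm by exact: (le1 (fun i => f i ord0)).
have gG i : `|g i ord0| <= Gm by exact: (le1 (fun i => g i ord0)).
have qQ i : \sum_l `|Q i l| <= q.
  by rewrite /q [leRHS](bigD1 i)//= lerDl; apply: sumr_ge0 => l _; exact: sumr_ge0.
(* [L / N] will bound one increment of the compensated process, and [Wm] the process itself up to
   the horizon. [K1] collects the errors of one step, each of order [h / N]; over at most [S / h]
   steps they add up to [S * K1 / N]. *)
pose L := Fm + 2 * Gm; pose Wm := S * Fm + Gm.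
have L0 : 0 <= L by rewrite addr_ge0// mulr_ge0.
have Wm0 : 0 <= Wm by rewrite addr_ge0// mulr_ge0.
pose K1 := d%:R * C * Wm ^+ 2 + 2 * Wm * (d%:R * C * L) + (Fm ^+ 2 + (q + d%:R * C) * L ^+ 2).
have K10 : 0 <= K1.
  by rewrite !addr_ge0 ?mulr_ge0 ?addr_ge0 ?exprn_ge0// mulr_ge0.
pose K2 := Gm ^+ 2 + S * K1.
have K20 : 0 <= K2 by rewrite addr_ge0 ?mulr_ge0// exprn_ge0.
exists (2 * K2 + 2 * Gm ^+ 2); first by rewrite addr_ge0// mulr_ge0// exprn_ge0.
move=> i0 N h w N0 h0 hN [w0 w1 wS] k kh.
have N1 : 1 <= N%:R :> R by rewrite ler1n.
have Np : 0 < N%:R :> R by rewrite ltr0n.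
pose iN : R := N%:R^-1.
have iN0 : 0 < iN by rewrite invr_gt0.
have NiN : N%:R * iN = 1 by rewrite mulfV// gt_eqF.
have iN1 : iN <= 1 by rewrite invf_le1.
pose e := h * N%:R.
have e0 : 0 <= e by rewrite mulr_ge0// ltW.
have eN2 : e * N%:R ^+ 2 <= 1 by rewrite /e -mulrA -exprS.
have e1 : e <= 1 by rewrite (le_trans _ eN2)// ler_peMr// exprn_ege1.
have hN1 : h <= iN.
  rewrite -(ler_pM2r Np) [iN * _]mulrC NiN (le_trans _ eN2)//.
  by rewrite ler_peMr// exprn_ege1.
have h1 : h <= 1 by exact: le_trans iN1.
(* Here the mesh condition enters: [(h N) ^ 2 <= h / N] amounts to [h N ^ 3 <= 1]. *)
have e2 : e ^+ 2 <= h * iN.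
  have -> : e ^+ 2 = h * N%:R ^+ 3 * (h * iN).
    have -> : h * N%:R ^+ 3 * (h * iN) = (h * N%:R) ^+ 2 * (N%:R * iN) by ring.
    by rewrite NiN mulr1.
  by rewrite ler_piMl// mulr_ge0 ?ltW.
pose A := expmx (h *: (N%:R *: Q)).
have [E [AE HE]] : exists E : 'I_d -> 'I_d -> R,
    (forall i l, A i l = (i == l)%:R + e * Q i l + E i l) /\
    forall i l, `|E i l| <= C * e ^+ 2.
  exists (fun i l => A i l - ((i == l)%:R + e * Q i l)); split=> i l; first by ring.
  by rewrite /A scalerA; apply: HC; rewrite e0.
pose inc (i l : 'I_d) : R := h * f i ord0 - (g l ord0 - g i ord0) * iN.
have incL i l : `|inc i l| <= L * iN.
  rewrite /inc (le_trans (ler_normB _ _))// !normrM (gtr0_norm h0) (gtr0_norm iN0) mulrDl lerD//.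
    by rewrite mulrC ler_pM// ltW.
  rewrite ler_wpM2r ?(ltW iN0)// (le_trans (ler_normB _ _))//.
  by have := gG l; have := gG i; lra.
have sumd (u : 'I_d -> R) (i : 'I_d) : \sum_l (i == l)%:R * u l = u i.
  rewrite (bigD1 i)//= eqxx mul1r big1 ?addr0// => l li.
  by rewrite eq_sym (negbTE li) mul0r.
have sumE (u : 'I_d -> R) (b : R) i : 0 <= b -> (forall l, `|u l| <= b) ->
    `|\sum_l E i l * u l| <= d%:R * C * b * (h * iN).
  move=> b0 ub; rewrite (le_trans (ler_norm_sum _ _ _))//.
  apply: (@le_trans _ _ (\sum_(l < d) C * (h * iN) * b)).
    apply: ler_sum => l _; rewrite normrM ler_pM//.
    by rewrite (le_trans (HE _ _))// ler_wpM2l.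
  rewrite sumr_const card_ord -[leLHS]mulr_natl.
  by rewrite le_eqVlt; apply/orP; left; apply/eqP; ring.
have row0 i : \sum_l Q i l = 0 by apply: Qgen.2.
have a1 i : `|\sum_l A i l - 1| <= d%:R * C * (h * iN).
  have -> : \sum_l A i l - 1 = \sum_l E i l * 1.
    under eq_bigr do rewrite AE; rewrite !big_split /= -mulr_sumr row0.
    under [X in X + _ + _ - 1]eq_bigr do rewrite -[_%:R]mulr1.
    rewrite (sumd (fun=> 1)) mulr0 addr0 addrAC subrr add0r.
    by apply: eq_bigr => l _; rewrite mulr1.
  by rewrite -[X in X * (h * iN)]mulr1; apply: sumE => // l; rewrite normr1.
(* The first-order drift cancels: staying in place contributes [h * f i], and the jumps contribute
   [- e * f i / N = - h * f i] because [Q g = f]. Only the remainder [E] is left. *)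
have b1 i : `|\sum_l A i l * inc i l| <= d%:R * C * L * (h * iN).
  have -> : \sum_l A i l * inc i l = \sum_l E i l * inc i l.
    under eq_bigr do rewrite AE !mulrDl; rewrite !big_split /= sumd.
    under [X in _ + X + _]eq_bigr do rewrite -mulrA.
    rewrite -mulr_sumr (_ : \sum_l Q i l * inc i l = - (f i ord0) * iN).
      rewrite /inc subrr mul0r subr0 /e.
      have -> : h * f i ord0 + h * N%:R * (- f i ord0 * iN) = h * f i ord0 * (1 - N%:R * iN) by ring.
      by rewrite NiN subrr mulr0 add0r.
    transitivity (\sum_l (Q i l * (h * f i ord0 + g i ord0 * iN) - Q i l * g l ord0 * iN)).
      by apply: eq_bigr => l _; rewrite /inc; ring.
    rewrite sumrB -!mulr_suml row0 mul0r sub0r mulNr; congr (- (_ * _)).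
    by rewrite -Qg mxE.
  apply: sumE => // l; rewrite (le_trans (incL _ _))//.
  by rewrite ler_piMr.
(* Jumps have rate [e = h N] and squared size of order [1 / N ^ 2], which gives [h / N]; the squared
   increment of a step without jump is of order [h ^ 2 <= h / N]. *)
have c1 i : `|\sum_l A i l * inc i l ^+ 2| <= (Fm ^+ 2 + (q + d%:R * C) * L ^+ 2) * (h * iN).
  have -> : \sum_l A i l * inc i l ^+ 2 = inc i i ^+ 2 +
      e * (\sum_l Q i l * inc i l ^+ 2) + \sum_l E i l * inc i l ^+ 2.
    under eq_bigr do rewrite AE !mulrDl; rewrite !big_split /= (sumd (fun l => inc i l ^+ 2)).
    by rewrite mulr_sumr; congr (_ + _ + _); apply: eq_bigr => l _; rewrite mulrA.
  have inc2 l : `|inc i l ^+ 2| <= L ^+ 2 * iN ^+ 2.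
    by rewrite normrX -exprMn lerXn2r ?nnegrE// mulr_ge0// ltW.
  have iN2 : iN ^+ 2 <= 1 by rewrite exprn_ile1// ltW.
  rewrite mulrDl mulrDl mulrDl addrA (le_trans (ler_normD _ _))// lerD//; last first.
    apply: sumE => [|l]; first exact: exprn_ge0.
    by rewrite (le_trans (inc2 l))// ler_piMr// exprn_ge0.
  rewrite (le_trans (ler_normD _ _))// lerD//.
    rewrite /inc subrr mul0r subr0 exprMn normrM (ger0_norm (sqr_ge0 h)) mulrC ler_pM ?sqr_ge0//.
      by rewrite normrX lerXn2r ?nnegrE.
    by rewrite expr2 ler_wpM2l// ltW.
  rewrite normrM (ger0_norm e0).
  apply: (@le_trans _ _ (e * (q * (L ^+ 2 * iN ^+ 2)))).
    rewrite ler_wpM2l// (le_trans (ler_norm_sum _ _ _))//.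
    apply: (@le_trans _ _ (\sum_l `|Q i l| * (L ^+ 2 * iN ^+ 2))).
      by apply: ler_sum => l _; rewrite normrM ler_wpM2l.
    by rewrite -mulr_suml ler_wpM2r ?qQ// mulr_ge0 ?exprn_ge0 ?(ltW iN0).
  have -> : e * (q * (L ^+ 2 * iN ^+ 2)) = q * L ^+ 2 * (h * iN) * (N%:R * iN) by rewrite /e; ring.
  by rewrite NiN mulr1.
pose W s := h * (\sum_(x <- behead s) f x ord0) - g (head i0 s) ord0 * iN.
have Wb k' s : k'%:R * h <= S -> s \in histories k' -> `|W s| <= Wm.
  move=> kS; rewrite mem_histories => /eqP sk.
  rewrite /W (le_trans (ler_normB _ _))// /Wm !normrM (gtr0_norm h0) (gtr0_norm iN0) lerD//.
    rewrite (le_trans (ler_wpM2l (ltW h0) (ler_norm_sum _ _ _)))//.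
    apply: (@le_trans _ _ (h * (k'%:R * Fm))).
      rewrite ler_wpM2l ?(ltW h0)// (le_trans (ler_sum _ (fun i _ => fF i)))//.
      by rewrite big_const_seq count_predT iter_addr addr0 size_behead sk mulr_natl.
    by rewrite mulrA [h * _]mulrC ler_wpM2r.
  by rewrite -[leRHS]mulr1 ler_pM// ltW.
have WS s l : s \in histories (size s).-1 -> W (l :: s) = W s + inc (head i0 s) l.
  case: s => [|x s]; first by rewrite mem_histories.
  move=> _.
  by rewrite /W /inc /= big_cons; ring.
pose M k' := \sum_(s <- histories k') w k' s * W s ^+ 2.
have MS k' : k'.+1%:R * h <= S -> M k'.+1 <= M k' + K1 * (h * iN).
  move=> kS; rewrite /M big_histories.
  have k'S : k'%:R * h <= S by rewrite (le_trans _ kS)// ler_pM2r// ler_nat.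
  rewrite -[X in _ + X]mul1r -(w1 k') mulr_suml -big_split /=.
  rewrite big_seq [leRHS]big_seq; apply: ler_sum => s sk.
  under eq_bigr => l _ do rewrite wS// -mulrA.
  rewrite -mulr_sumr -mulrDr ler_wpM2l//.
  have sk' : s \in histories (size s).-1 by rewrite (size_histories sk).
  set i := head i0 s.
  have -> : \sum_l A i l * W (l :: s) ^+ 2 = W s ^+ 2 + (W s ^+ 2 * (\sum_l A i l - 1) +
     2 * W s * (\sum_l A i l * inc i l) + \sum_l A i l * inc i l ^+ 2).
    rewrite mulrBr mulr1 !mulr_sumr addrA addrA [X in X + _ + _]addrC subrK -!big_split /=.
    by apply: eq_bigr => l _; rewrite WS// -/i; ring.
  have -> : K1 * (h * iN) = d%:R * C * Wm ^+ 2 * (h * iN) + 2 * Wm * (d%:R * C * L) * (h * iN) +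
      (Fm ^+ 2 + (q + d%:R * C) * L ^+ 2) * (h * iN) by rewrite /K1; ring.
  rewrite lerD2l lerD//; last exact: le_trans (ler_norm _) (c1 _).
  have Wb' := Wb _ _ k'S sk.
  rewrite lerD//.
    rewrite (le_trans (ler_norm _))// normrM [leLHS]mulrC -mulrA [Wm ^+ 2 * _]mulrC mulrA ler_pM//.
    by rewrite normrX lerXn2r ?nnegrE.
  rewrite (le_trans (ler_norm _))// normrM -[2 * Wm * _ * _]mulrA ler_pM//.
  by rewrite normrM normr_nat ler_wpM2l.
have M0 : M 0%N <= Gm ^+ 2 * iN.
  rewrite /M -[leRHS]mul1r -(w1 0%N) mulr_suml.
  rewrite big_seq [leRHS]big_seq; apply: ler_sum => s; rewrite mem_histories.
  case: s => [|x []]// _; rewrite ler_wpM2l// /W /= big_nil mulr0 sub0r sqrrN exprMn.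
  rewrite ler_pM ?sqr_ge0//.
    by rewrite -(real_normK (num_real (g x ord0))) lerXn2r ?nnegrE.
  by rewrite expr2 ler_piMl// ltW.
have MK k' : k'%:R * h <= S -> M k' <= K2 * iN.
  move=> kS; apply: (@le_trans _ _ (Gm ^+ 2 * iN + k'%:R * h * K1 * iN)).
    elim: k' kS => [|k' IH] kS; first by rewrite !mul0r addr0.
    have k'S : k'%:R * h <= S by rewrite (le_trans _ kS)// ler_pM2r// ler_nat.
    rewrite (le_trans (MS _ kS))// -natr1.
    have := IH k'S; set a := M k'; set b := Gm ^+ 2 * iN.
    have -> : b + (k'%:R + 1) * h * K1 * iN = b + k'%:R * h * K1 * iN + K1 * (h * iN) by ring.
    by rewrite lerD2r.
  by rewrite -mulrDl ler_wpM2r ?(ltW iN0)// lerD2l ler_wpM2r.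
have iNE : (2 * K2 + 2 * Gm ^+ 2) / N%:R = 2 * (K2 * iN) + 2 * Gm ^+ 2 * iN by rewrite /iN; ring.
rewrite iNE (@le_trans _ _ (\sum_(s <- histories k) w k s * (2 * W s ^+ 2 + 2 * Gm ^+ 2 * iN)))//.
  apply: ler_sum => s _; rewrite ler_wpM2l//.
  set D := h * _; have -> : D = W s + g (head i0 s) ord0 * iN by rewrite /W subrK.
  set y := g _ _ * iN.
  have hy : y ^+ 2 <= Gm ^+ 2 * iN.
    rewrite /y exprMn ler_pM ?sqr_ge0//; last by rewrite expr2 ler_piMl// ltW.
    by rewrite -(real_normK (num_real (g _ _))) lerXn2r ?nnegrE.
  have gen (a b c' : R) : b ^+ 2 <= c' -> (a + b) ^+ 2 <= 2 * a ^+ 2 + 2 * c'.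
    by have := sqr_ge0 (a - b); rewrite sqrrB sqrrD; lra.
  by rewrite -[2 * _ * iN]mulrA gen.
under eq_bigr do rewrite mulrDr mulrCA.
by rewrite big_split /= -mulr_sumr -mulr_suml w1 mul1r lerD2r ler_wpM2l// MK.
Qed.

End OccupationBound.

Section ChainHistories.
Context {R : realType} {d : nat} disp (T : measurableType disp) (P : probability T R).
Variables (X : R -> T -> 'I_d) (h : R).

Fixpoint history (k : nat) (w : T) : seq 'I_d :=
  X (k%:R * h) w :: (if k is k'.+1 then history k' w else [::]).

Lemma size_history k w : size (history k w) = k.+1.
Proof. by elim: k => //= k ->. Qed.

Lemma history_in k w : history k w \in histories k.
Proof. by rewrite mem_histories size_history. Qed.

(** Restores chronological order, histories having the latest state first; beyond the end of [s] it
    takes the default value [i0]. *)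
Definition traj (i0 : 'I_d) (s : seq 'I_d) (j : nat) : 'I_d := nth i0 (rev s) j.

Lemma traj_history i0 k w j : (j <= k)%N -> traj i0 (history k w) j = X (j%:R * h) w.
Proof.
rewrite /traj; elim: k j => [|k IH] j; first by rewrite leqn0 => /eqP ->.
rewrite leq_eqVlt => /predU1P[->|jk] /=; rewrite rev_cons nth_rcons size_rev size_history.
  by rewrite ltnn eqxx.
by rewrite jk IH.
Qed.

Lemma sum_behead_history k w (f : 'I_d -> R) :
  \sum_(x <- behead (history k w)) f x = \sum_(j < k) f (X (j%:R * h) w).
Proof.
case: k => [|k] /=; first by rewrite big_nil big_ord0.
elim: k => [|k IH] /=; first by rewrite big_seq1 big_ord_recl big_ord0 addr0.
by rewrite big_cons IH [RHS]big_ord_recr /= addrC.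
Qed.

Lemma history_preimage i0 k s : s \in histories k ->
  history k @^-1` [set s] = \bigcap_(j in `I_k.+1) X (j%:R * h) @^-1` [set traj i0 s j].
Proof.
rewrite mem_histories => /eqP sk; apply/seteqP; split => w /=.
  by move=> <- j /= jk; rewrite traj_history// -ltnS.
move=> H; apply: (@can_inj _ _ rev rev revK).
apply: (@eq_from_nth _ i0); first by rewrite !size_rev size_history sk.
move=> j; rewrite size_rev size_history => jk.
by rewrite -[LHS]/(traj i0 (history k w) j) traj_history//; exact: H.
Qed.

Hypothesis h0 : 0 < h.
Variable Q : 'M[R]_d.
Hypothesis mX : markov_chain P Q X.

Lemma measurable_X (t : R) i : 0 <= t -> measurable (X t @^-1` [set i]).
Proof. by case: mX => + _ _; apply. Qed.

Let jh0 (j : nat) : 0 <= j%:R * h. Proof. by rewrite mulr_ge0// ltW. Qed.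

Lemma measurable_history k s : measurable (history k @^-1` [set s]).
Proof.
elim: k s => [|k IH] [|l s] /=.
- by rewrite (_ : _ @^-1` _ = set0)//; apply/seteqP; split.
- case: s => [|l' s].
    rewrite (_ : _ @^-1` _ = X (0%:R * h) @^-1` [set l]); first exact: measurable_X.
    by apply/seteqP; split => w /=; [case|move=> ->].
  by rewrite (_ : _ @^-1` _ = set0)//; apply/seteqP; split.
- by rewrite (_ : _ @^-1` _ = set0)//; apply/seteqP; split.
- rewrite (_ : _ @^-1` _ = X (k.+1%:R * h) @^-1` [set l] `&` history k @^-1` [set s]).
    by apply: measurableI => //; exact: measurable_X.
  by apply/seteqP; split => w /=; [case=> -> ->|move=> [-> ->]].
Qed.

Definition weight k s : R := fine (P (history k @^-1` [set s])).

Lemma sum_indic_history k w :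
  \sum_(s <- histories k) \1_(history k @^-1` [set s]) w = 1 :> R.
Proof.
rewrite (bigD1_seq (history k w)) ?history_in ?histories_uniq//=.
rewrite indicE mem_set// big1 ?addr0// => s sw.
by rewrite indicE memNset//= => E; move: sw; rewrite -E eqxx.
Qed.

(** The histories split the probability space into finitely many events; this replaces conditioning
    on the chain. *)
Lemma Rintegral_histories k (f : T -> R) : P.-integrable setT (EFin \o f) ->
  \int[P]_w f w = \sum_(s <- histories k) \int[P]_w (f w * \1_(history k @^-1` [set s]) w).
Proof.
move=> iF; rewrite -Rintegral_sum//; last first.
  move=> s; apply: (@le_integrable _ _ _ P _ measurableT _ (EFin \o f)) => //.
    apply/measurable_EFinP; apply: measurable_funM.
      by apply/measurable_EFinP; exact: measurable_int iF.
    by apply: measurable_indic; exact: measurable_history.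
  by move=> w _ /=; rewrite lee_fin normrM ler_piMr// ger0_norm// indicE lern1 leq_b1.
by apply: eq_Rintegral => w _; rewrite -mulr_sumr sum_indic_history mulr1.
Qed.

Lemma Rintegral_indicE (A : set T) : measurable A -> \int[P]_w \1_A w = fine (P A).
Proof. by move=> mA; rewrite /Rintegral integral_indic// setIT. Qed.

Lemma integrable_indicP (A : set T) : measurable A -> P.-integrable setT (EFin \o \1_A).
Proof.
move=> mA; apply: (@integrable_bounded _ _ _ P _ _ 1) => //.
  by rewrite -ge0_fin_numE// fin_num_measure.
by move=> w _; rewrite ger0_norm// indicE lern1 leq_b1.
Qed.

Lemma probability_histories k (A : set T) : measurable A ->
  fine (P A) = \sum_(s <- histories k) fine (P (A `&` history k @^-1` [set s])).
Proof.
move=> mA; rewrite -Rintegral_indicE// (Rintegral_histories k); last exact: integrable_indicP.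
apply: eq_bigr => s _; rewrite -Rintegral_indicE; last first.
  by apply: measurableI => //; exact: measurable_history.
by apply: eq_Rintegral => w _; rewrite indicI.
Qed.

(** The recursion is the Markov property at consecutive grid times, whose gap is [h]; the latest
    state of a history is its head. *)
Lemma weights_history i0 : history_weights i0 (expmx (h *: Q)) weight.
Proof.
split.
- by move=> k s; rewrite fine_ge0.
- move=> k; have := probability_histories k measurableT.
  rewrite probability_setT /= => ->; apply: eq_bigr => s _.
  by rewrite setTI.
- move=> k s l sk; have lsk : l :: s \in histories k.+1.
    by rewrite mem_histories /= (size_histories sk).
  rewrite /weight !(history_preimage i0)//.
  have [_ _ mk] := mX.
  have := mk k (fun j => j%:R * h) (traj i0 (l :: s)) _ _.
  rewrite jh0 => /(_ isT).
  have lt_h j : (j <= k)%N -> j%:R * h < j.+1%:R * h by move=> _; rewrite ltr_pM2r// ltr_nat.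
  move=> /(_ lt_h) ->.
  have trl : traj i0 (l :: s) k.+1 = l.
    by rewrite /traj rev_cons nth_rcons size_rev (size_histories sk) ltnn eqxx.
  have trs j : (j <= k)%N -> traj i0 (l :: s) j = traj i0 s j.
    by move=> jk; rewrite /traj rev_cons nth_rcons size_rev (size_histories sk) ltnS jk.
  rewrite trl trs// -mulrBl -natr1 [_ + 1]addrC addrK mul1r.
  have -> : traj i0 s k = head i0 s.
    by rewrite /traj nth_rev (size_histories sk)// subnn nth0.
  rewrite fineM ?fin_num_measure//; last first.
    by apply: bigcap_measurable; [exists 0%N|move=> j _; exact: measurable_X].
  congr (fine (P _) * _); apply: eq_bigcapr => j jk.
  by rewrite trs// -ltnS.
Qed.

End ChainHistories.

Ltac nneg := repeat first
  [by [] | apply: sqr_ge0 | apply: fine_ge0 | apply: addr_ge0 | apply: divr_ge0 | apply: mulr_ge0 | apply: exprn_ge0 | apply: ler0n].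

(** * Uniform smallness of the occupation sums *)

Section OccupationTail.
Context {R : realType} {d : nat}.
Variables (Q : 'M[R]_d) (p : 'cV[R]_d).
Hypothesis Qgen : generator Q.
Hypothesis pinv : unique_invariant_distribution Q p.

Definition occupation_far (f : 'cV[R]_d) (h S delta : R) (x : nat -> 'I_d) : Prop :=
  exists2 k, k%:R * h <= S & delta < `|h * \sum_(j < k) f (x j) ord0|.

(** Chebyshev is applied only at the multiples of a block length [b], chosen so that the sum moves
    by at most [delta / 2] within a block. The number of blocks depends on neither [N] nor [h], so a
    union bound keeps the order [1 / N]. *)
Lemma occupation_tail (f : 'cV[R]_d) (S delta eps : R) : dotp p f = 0 -> 0 <= S ->
  0 < delta -> 0 < eps ->
  exists N0, forall (N : nat) (h : R) disp (T : measurableType disp) (P : probability T R)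
    (X : R -> T -> 'I_d), (N0 <= N)%N -> (0 < N)%N -> 0 < h -> h * N%:R ^+ 3 <= 1 ->
    markov_chain P (N%:R *: Q) X ->
    measurable [set w | occupation_far f h S delta (fun j => X (j%:R * h) w)] /\
    fine (P [set w | occupation_far f h S delta (fun j => X (j%:R * h) w)]) <= eps.
Proof.
move=> pf S0 d0 e0; have [K K0 HK] := occupation_L2 Qgen pinv pf S0.
pose M : R := 1 + \sum_i `|f i ord0|.
have M0 : 0 < M by rewrite ltr_wpDr// sumr_ge0.
have fM i : `|f i ord0| <= M.
  by rewrite /M (bigD1 i)//= addrCA lerDl addr_ge0// sumr_ge0.
have M0' := ltW M0; have d0' := ltW d0; have e0' := ltW e0.
(* A block will last at least [delta / (4 * M)] in time, so at most [J] of them start before the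
   horizon [S]. *)
pose J := (Num.bound (4 * M * S / delta)).
have JP : 4 * M * S / delta < J%:R.
  by apply: archi_boundP; nneg.
(* The first term brings the [J] Chebyshev bounds below [eps] in total. The second gives
   [4 * M * h <= delta], because [h * N <= 1], so that a block contains at least one step. *)
pose c := J%:R * (4 * K / delta ^+ 2) / eps + 4 * M / delta + 1.
have [N0 HN0] : exists N0, forall N : nat, (N0 <= N)%N -> c <= N%:R.
  exists (Num.bound c) => N NN; apply: (@le_trans _ _ (Num.bound c)%:R).
    by rewrite ltW// archi_boundP// /c; nneg.
  by rewrite ler_nat.
exists N0 => N h disp T P X NN N_gt0 h0 hN mX.
have cN := HN0 N NN.
have Np : 0 < N%:R :> R by rewrite ltr0n.
have [wT _] : exists w : T, True.
  apply/not_existsP => nT; have := probability_setT P.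
  rewrite (_ : setT = set0) ?measure0; last by apply/seteqP; split => // w _; exact: (nT w).
  by move=> /esym/eqP; rewrite onee_eq0.
pose i0 : 'I_d := X 0 wT.
pose D k w := h * \sum_(j < k) f (X (j%:R * h) w) ord0.
have DE k : D k = (fun s => h * \sum_(x <- behead s) f x ord0) \o history X h k.
  by apply/funext => w; rewrite /D /= (@sum_behead_history _ _ _ _ X h k w (fun x => f x ord0)).
have mD k (A : set R) : measurable A -> measurable (D k @^-1` A).
  move=> mA; rewrite -[X in measurable X]setTI.
  have : measurable_fun setT (D k).
    rewrite DE; apply: (@measurable_fun_countable R _ T (seq 'I_d)) => z.
    exact: (measurable_history h0 mX).
  exact.
have mDgt k (b : R) : measurable [set w | b < `|D k w|].
  rewrite (_ : [set w | _] = D k @^-1` [set x | b < `|x|])//; apply: mD.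
  rewrite (_ : [set x | _] = Num.norm @^-1` `]b, +oo[%classic); last first.
    by apply/seteqP; split => x /=; rewrite in_itv /= andbT.
  by rewrite -[X in measurable X]setTI; exact: normr_measurable.
have BadE : [set w | occupation_far f h S delta (fun j => X (j%:R * h) w)] =
    \bigcup_(k in [set k | k%:R * h <= S]) [set w | delta < `|D k w|].
  by apply/seteqP; split => w [k kS Dk]; exists k.
have mBad : measurable [set w | occupation_far f h S delta (fun j => X (j%:R * h) w)].
  by rewrite BadE; apply: bigcup_measurable => k _.
split => //.
have cheb k : k%:R * h <= S ->
    fine (P [set w | delta / 2 < `|D k w|]) <= 4 * K / delta ^+ 2 / N%:R.
  move=> kS; rewrite (probability_histories h0 mX k)//.
  have := HK i0 N h _ N_gt0 h0 hN (weights_history h0 mX i0) k kS.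
  move=> /(ler_wpM2l (_ : 0 <= 4 / delta ^+ 2)).
  rewrite divr_ge0 ?exprn_ge0 ?(ltW d0)// => /(_ isT) HK'.
  apply: (@le_trans _ _ (4 / delta ^+ 2 * (K / N%:R))); last first.
    by rewrite le_eqVlt; apply/orP; left; apply/eqP; ring.
  apply: le_trans HK'; rewrite mulr_sumr; apply: ler_sum => s _.
  set Es := history X h k @^-1` [set s].
  have mEs : measurable Es by exact: (measurable_history h0 mX).
  have [hs|hs] := ltP (delta / 2) `|h * \sum_(x <- behead s) f x ord0|; last first.
    rewrite (_ : _ `&` _ = set0) ?measure0 /=.
      by nneg.
    apply/seteqP; split => // w [/= + ws]; rewrite DE /= ws.
    by rewrite ltNge hs.
  apply: (@le_trans _ _ (weight P X h k s)).
    apply: fine_le; rewrite ?fin_num_measure//; first exact: measurableI.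
    by apply: le_measure; rewrite ?inE//; exact: measurableI.
  rewrite mulrCA ler_peMr ?fine_ge0//.
  rewrite mulrAC ler_pdivlMr ?exprn_gt0// mul1r.
  move: hs; set y := h * _ => hs; rewrite -(real_normK (num_real y)).
  have -> : 4 * `|y| ^+ 2 = (2 * `|y|) ^+ 2 by rewrite exprMn; congr (_ * _); rewrite -natrX.
  rewrite lerXn2r ?nnegrE ?mulr_ge0 ?(ltW d0)//.
  by move: hs; rewrite ltr_pdivrMr// mulrC => /ltW.
(* The real block length over which an occupation sum moves by at most [delta / 2]; as [2 <= x],
   rounding it down loses at most half of it. *)
pose x := delta / (2 * M * h).
have h0' := ltW h0.
have x0 : 0 <= x by rewrite /x; nneg.
pose b := Num.truncn x.
have /andP[bx xb] : b%:R <= x < b.+1%:R by exact: truncn_itv.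
have hbM : h * b%:R * M <= delta / 2.
  have -> : delta / 2 = h * x * M by rewrite /x; field; rewrite !gt_eqF.
  by rewrite ler_wpM2r ?(ltW M0)// ler_wpM2l// ltW.
have hM : 4 * M * h <= delta.
  have hN1 : h * N%:R <= 1.
    rewrite (le_trans _ hN)// ler_wpM2l ?(ltW h0)// exprS ler_peMr//.
    by rewrite exprn_ege1// ler1n.
  have : 4 * M / delta <= N%:R.
    apply: le_trans cN; rewrite /c -addrA addrCA lerDl; nneg.
  rewrite ler_pdivrMr// => h1; apply: (@le_trans _ _ (N%:R * delta * h)).
    by rewrite ler_wpM2r// ltW.
  by rewrite mulrAC [N%:R * h]mulrC ler_piMl// ltW.
have x2 : 2 <= x.
  rewrite /x ler_pdivlMr ?mulr_gt0// (le_trans _ hM)//.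
  by rewrite le_eqVlt; apply/orP; left; apply/eqP; ring.
have b1 : (0 < b)%N by rewrite truncn_gt0 (le_trans _ x2)// ler1n.
have hb : delta / (4 * M) <= h * b%:R.
  have -> : delta / (4 * M) = h * (x / 2) by rewrite /x; field; rewrite !gt_eqF.
  have b1R : 1 <= b%:R :> R by rewrite ler1n.
  by rewrite ler_wpM2l ?(ltW h0)//; move: xb; rewrite -natr1; lra.
pose A j := if (j * b)%N%:R * h <= S then [set w | delta / 2 < `|D (j * b)%N w|] else set0.
have mA j : measurable (A j) by rewrite /A; case: ifP.
have sub : [set w | occupation_far f h S delta (fun j => X (j%:R * h) w)] `<=`
    \big[setU/set0]_(j < J) A j.
  move=> w [k kS Dk]; rewrite -bigcup_mkord.
  have jbk : (k %/ b * b <= k)%N by exact: leq_divM.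
  have jbS : (k %/ b * b)%N%:R * h <= S.
    by rewrite (le_trans _ kS)// ler_wpM2r ?(ltW h0)// ler_nat.
  exists (k %/ b)%N => /=.
    rewrite -(ltr_nat R); apply: le_lt_trans JP.
    rewrite ler_pdivlMr// -[_ * delta]mulr1.
    have -> : (k %/ b)%N%:R * delta * 1 = 4 * M * ((k %/ b)%N%:R * (delta / (4 * M))).
      by field; rewrite gt_eqF.
    rewrite ler_wpM2l ?mulr_ge0 ?(ltW M0)// (le_trans _ jbS)// natrM -mulrA ler_wpM2l//.
    by rewrite [leRHS]mulrC.
  rewrite /A jbS /=; move: Dk; rewrite -/(D k w) => Dk.
  have diff : `|D k w - D (k %/ b * b)%N w| <= delta / 2.
    rewrite /D -mulrBr normrM (gtr0_norm h0).
    rewrite -(big_mkord xpredT (fun j => f (X (j%:R * h) w) ord0)).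
    rewrite -(big_mkord xpredT (fun j => f (X (j%:R * h) w) ord0)).
    rewrite (big_cat_nat (leq0n _) jbk)/= addrAC subrr add0r.
    apply: le_trans hbM; rewrite -mulrA ler_wpM2l ?(ltW h0)//.
    rewrite (le_trans (ler_norm_sum _ _ _))// (le_trans (ler_sum _ (fun i _ => fM _)))//.
    rewrite sumr_const_nat -[leLHS]mulr_natl ler_wpM2r ?(ltW M0)// ler_nat.
    by rewrite {1}(divn_eq k b) addKn ltnW// ltn_pmod.
  rewrite -(ltrD2r (delta / 2)) -splitr (lt_le_trans Dk)//.
  by rewrite -lerBlDl (le_trans _ diff)// lerB_dist.
apply: (@le_trans _ _ (\sum_(j < J) 4 * K / delta ^+ 2 / N%:R)).
  apply: (@le_trans _ _ (\sum_(j < J) fine (P (A j)))).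
    rewrite sum_fine; last by move=> j _; rewrite fin_num_measure.
    apply: fine_le; rewrite ?fin_num_measure//.
      by apply/sum_fin_numP => j _ _; rewrite fin_num_measure.
    apply: (@le_trans _ _ (P (\big[setU/set0]_(j < J) A j))).
      apply: le_measure; rewrite ?inE//.
      by apply: bigsetU_measurable.
    by apply: Boole_inequality.
  apply: ler_sum => j _; rewrite /A; case: ifP => jS; first exact: cheb.
  by rewrite measure0 /=; nneg.
rewrite sumr_const card_ord -[leLHS]mulr_natl mulrA ler_pdivrMr//.
rewrite -ler_pdivrMl// mulrC (le_trans _ cN)// /c -addrA lerDl; nneg.
Qed.

End OccupationTail.

(** * Euler schemes *)

Lemma cvg_nat_ge (u : nat -> nat) : (forall l, (l <= u l)%N) -> u @ \oo --> \oo.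
Proof.
by move=> ul A [N _ NA]; exists N => // l /= Nl; apply: NA; exact: leq_trans Nl (ul l).
Qed.

(** Trades an error for its square, the quantity that the isometry controls; [y] is a free
    threshold, taken as the target accuracy later. *)
Lemma abs_le_sqr {R : realType} (x y : R) : 0 < y -> `|x| <= y + x ^+ 2 / y.
Proof.
move=> y0; rewrite -(ler_pM2r y0) mulrDl divfK ?gt_eqF// -(real_normK (num_real x)).
have := sqr_ge0 (`|x| - y); have := normr_ge0 x; rewrite sqrrB.
have : 0 <= `|x| * y by rewrite mulr_ge0// ltW.
rewrite expr2; lra.
Qed.

Section Euler.
Context {R : realType} {d : nat}.
Variables (alpha gamma : 'cV[R]_d) (m0 : R).

Fixpoint euler (h : R) (x : nat -> 'I_d) (eta : nat -> R) (k : nat) : R :=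
  if k is k'.+1 then
    let y := euler h x eta k' in
    y + h * (alpha (x k') ord0 - gamma (x k') ord0 * y) + eta k'
  else m0.

Lemma eulerE (h : R) (x : nat -> 'I_d) (eta : nat -> R) k : euler h x eta k =
  m0 + h * (\sum_(j < k) (alpha (x j) ord0 - gamma (x j) ord0 * euler h x eta j)) +
  \sum_(j < k) eta j.
Proof.
elim: k => [|k IH]; first by rewrite !big_ord0 mulr0 !addr0.
by rewrite /= {1}IH !big_ord_recr /=; ring.
Qed.

(** The noise cancels in the difference, so a sequence that satisfies the scheme up to residuals [r]
    is compared with it pathwise, by Gronwall with constant [h * G]. *)
Lemma euler_dist (h G : R) (x : nat -> 'I_d) (eta : nat -> R) (y r : nat -> R) n : 0 <= h ->
  (forall i, `|gamma i ord0| <= G) ->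
  (forall k, (k <= n)%N -> y k =
    m0 + h * (\sum_(j < k) (alpha (x j) ord0 - gamma (x j) ord0 * y j)) +
    \sum_(j < k) eta j + r k) ->
  forall k, (k <= n)%N -> `|euler h x eta k - y k| <=
    `|r k| + h * G * (1 + h * G) ^+ n * \sum_(j < k) `|r j|.
Proof.
move=> h0 gG yE; pose e k := `|euler h x eta k - y k|.
case: (posnP d) => [d0|dpos].
  by move: (x 0%N) => -[i]; rewrite d0.
have G0 : 0 <= G by rewrite (le_trans _ (gG (Ordinal dpos))).
apply: (@gronwall R (fun k => `|r k|) e) => //; first exact: mulr_ge0.
move=> k kn; rewrite /e eulerE (yE k kn).
have -> : m0 + h * (\sum_(j < k) (alpha (x j) ord0 - gamma (x j) ord0 * euler h x eta j)) +
    \sum_(j < k) eta j - (m0 + h * (\sum_(j < k) (alpha (x j) ord0 - gamma (x j) ord0 * y j)) +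
    \sum_(j < k) eta j + r k) =
  - r k - h * (\sum_(j < k) gamma (x j) ord0 * (euler h x eta j - y j)).
  rewrite (_ : \sum_(j < k) gamma (x j) ord0 * (euler h x eta j - y j) =
     \sum_(j < k) (alpha (x j) ord0 - gamma (x j) ord0 * y j) -
     \sum_(j < k) (alpha (x j) ord0 - gamma (x j) ord0 * euler h x eta j)); first by ring.
  by rewrite -sumrB; apply: eq_bigr => j _; ring.
rewrite (le_trans (ler_normB _ _))// normrN lerD2l normrM (ger0_norm h0) -mulrA.
rewrite ler_wpM2l// mulr_sumr (le_trans (ler_norm_sum _ _ _))//.
by apply: ler_sum => j _; rewrite normrM ler_wpM2r.
Qed.

(* [it] collects the stochastic integral errors, which are controlled in mean square only. *)
Lemma euler_error (h G rho eta J : R) (x : nat -> 'I_d)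
    (noise y r it : nat -> R) n k :
  0 <= h -> 0 <= G -> 0 <= rho -> 0 < eta -> (forall i, `|gamma i ord0| <= G) ->
  (forall k, (k <= n)%N -> y k =
    m0 + h * (\sum_(j < k) (alpha (x j) ord0 - gamma (x j) ord0 * y j)) +
    \sum_(j < k) noise j + r k) ->
  (forall k, (k <= n)%N -> `|r k| <= rho + `|it k|) ->
  (k <= n)%N -> it k ^+ 2 + h * (\sum_(j < n) it j ^+ 2) <= J ->
  `|euler h x noise k - y k| <=
    (1 + G * expR (h * n%:R * G) * (h * n%:R + 1)) * (rho + eta + J / eta).
Proof.
move=> h0 G0 rho0 eta0 gG yE rle kn HJ.
have s0 : 0 <= h * (\sum_(j < n) it j ^+ 2) by rewrite mulr_ge0// sumr_ge0// => j _; rewrite sqr_ge0.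
have ei : 0 < eta^-1 by rewrite invr_gt0.
have J0 : 0 <= J by rewrite (le_trans _ HJ)// addr_ge0// sqr_ge0.
have rle2 j : (j <= n)%N -> `|r j| <= rho + eta + it j ^+ 2 / eta.
  by move=> jn; rewrite (le_trans (rle j jn))// -addrA lerD2l abs_le_sqr.
have h1 : `|r k| <= rho + eta + J / eta.
  rewrite (le_trans (rle2 k kn))// lerD2l ler_pM2r// (le_trans _ HJ)//.
  by rewrite lerDl.
(* The accumulated part of Gronwall only sees the time average of the residuals; hence a Riemann sum
   of the squares [it j ^+ 2] suffices in place of their maximum. *)
have h2 : h * (\sum_(j < k) `|r j|) <= (h * n%:R + 1) * (rho + eta + J / eta).
  apply: (@le_trans _ _ (h * (\sum_(j < n) (rho + eta + it j ^+ 2 / eta)))).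
    rewrite ler_wpM2l//.
    rewrite (@big_ord_widen _ _ _ k n (fun j => `|r j|) kn) big_mkcond /=.
    apply: ler_sum => j _; case: ifP => _; first by apply: rle2; exact: ltnW.
    by rewrite (le_trans _ (rle2 j (ltnW (ltn_ord j)))).

  rewrite big_split /= sumr_const card_ord -mulr_suml mulrDr mulrA -[X in h * X]mulr_natr.
  rewrite (_ : h * ((rho + eta) * n%:R) = (h * n%:R) * (rho + eta)); last by ring.
  rewrite mulrDl mul1r lerD//.
    by rewrite ler_wpM2l ?mulr_ge0// lerDl mulr_ge0// ltW.
  rewrite -[leLHS]add0r lerD//; first by rewrite addr_ge0// ltW.
  by rewrite ler_pM2r// (le_trans _ HJ)// lerDr sqr_ge0.
rewrite (le_trans (euler_dist h0 gG yE kn))// mulrDl mul1r lerD//.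
rewrite (_ : h * G * (1 + h * G) ^+ n * _ = G * (1 + h * G) ^+ n * (h * (\sum_(j < k) `|r j|))); last by ring.
rewrite -[leRHS]mulrA ler_pM//.
- by rewrite mulr_ge0// exprn_ge0// addr_ge0// mulr_ge0.
- by rewrite mulr_ge0// sumr_ge0.
- rewrite ler_wpM2l// (_ : h * n%:R * G = n%:R * (h * G)); last by ring.
  by apply: expr1D_expR; rewrite mulr_ge0.
Qed.

End Euler.

Section FunctionalConvergence.
Context {R : realType}.

Lemma sum_tent_le1 (n : nat) (u : R) : \sum_(j < n.+1) tent (u - j%:R) <= 1.
Proof.
have -> : \sum_(j < n.+1) tent (u - j%:R) = clamp (u + 1) - clamp (u - n%:R).
  elim: n => [|n IH]; first by rewrite big_ord_recl big_ord0 addr0 subr0.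
  rewrite big_ord_recr /= IH /tent.
  have -> : u - n.+1%:R + 1 = u - n%:R :> R by rewrite -natr1; ring.
  by rewrite addrA subrK.
rewrite lerBlDr -[leLHS]addr0 lerD//; first by rewrite /clamp ge_min lexx orbT.
by rewrite /clamp le_min le_max lexx orbT ler01.
Qed.

Lemma lin_dist m (v v' : nat -> R) (t e : R) :
  (forall j, (j <= m * m)%N -> `|v j - v' j| <= e) -> `|lin m v t - lin m v' t| <= e.
Proof.
move=> H; rewrite /lin -sumrB (le_trans (ler_norm_sum _ _ _))//.
apply: (@le_trans _ _ (\sum_(j < (m * m).+1) e * tent (m%:R * t - j%:R))).
  apply: ler_sum => j _; rewrite -mulrBl normrM (ger0_norm (tent_ge0 _)).
  by rewrite ler_wpM2r ?tent_ge0// H// -ltnS.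
rewrite -mulr_sumr ler_piMr ?sum_tent_le1//.
by rewrite (le_trans _ (H 0%N _)).
Qed.

Lemma ucc_cvg_lin_fixed m (v : nat -> nat -> R) (v' : nat -> R) :
  (forall e, 0 < e -> \forall n \near \oo, forall j, (j <= m * m)%N -> `|v n j - v' j| <= e) ->
  ucc_cvg (fun n => lin m (v n)) (lin m v').
Proof.
by move=> H T e e0; apply: filterS (H e e0) => n hn t _; exact: lin_dist.
Qed.

Lemma lin_sample_cvg (x : R -> R) : C0oo x ->
  ucc_cvg (fun m => lin m.+1 (fun j => x (j%:R / m.+1%:R))) x.
Proof.
move=> Cx; apply: (@ucc_cvg_lin _ (fun m => m.+1) (fun m j => x (j%:R / m.+1%:R))) => //.
by move=> T e e0; apply: nearW => n j _ _; rewrite subrr normr0 ltW.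
Qed.

Context d (T : measurableType d) (P : probability T R).
Variables (Phi : ucc_paths R -> R) (c : R).
Hypothesis cPhi : {within (C0oo : set (ucc_paths R)), continuous Phi}.
Hypothesis bPhi : forall x, C0oo x -> `|Phi x| <= c.

Lemma integrable_functional (Y : R -> T -> R) :
  (forall w, C0oo (Y ^~ w)) -> (forall t : R, 0 <= t -> measurable_fun setT (Y t)) ->
  P.-integrable setT (EFin \o (fun w => Phi (Y ^~ w))).
Proof.
move=> CY mY; apply: (@integrable_bounded _ _ _ P _ _ c) => //.
- by rewrite -ge0_fin_numE// fin_num_measure.
- exact: measurable_functional.
- by move=> w _; exact: bPhi.
Qed.

Lemma expectation_functional (Y : R -> T -> R) :
  (forall w, C0oo (Y ^~ w)) -> (forall t : R, 0 <= t -> measurable_fun setT (Y t)) ->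
  'E_P[(fun w => Phi (Y ^~ w))]%E = (\int[P]_w Phi (Y ^~ w))%:E.
Proof.
move=> CY mY; rewrite unlock /Rintegral fineK//.
exact: (integrable_fin_num measurableT (integrable_functional CY mY)).
Qed.

Lemma cvg_expectation (Y : nat -> R -> T -> R) (Z : R -> T -> R) :
  (forall n w, C0oo (Y n ^~ w)) -> (forall n (t : R), 0 <= t -> measurable_fun setT (Y n t)) ->
  (forall w, C0oo (Z ^~ w)) -> (forall t : R, 0 <= t -> measurable_fun setT (Z t)) ->
  {ae P, forall w, ucc_cvg (fun n => Y n ^~ w) (Z ^~ w)} ->
  \int[P]_w Phi (Y n ^~ w) @[n --> \oo] --> \int[P]_w Phi (Z ^~ w).
Proof.
move=> CY mY CZ mZ YZ.
have [] := @dominated_convergence _ _ _ P setT measurableT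
  (fun n w => (Phi (Y n ^~ w))%:E) (fun w => (Phi (Z ^~ w))%:E) (fun=> c%:E).
- by move=> n; apply/measurable_EFinP; exact: (measurable_functional cPhi (CY n) (mY n)).
- by apply/measurable_EFinP; exact: (measurable_functional cPhi CZ mZ).
- case: YZ => N [mN N0 sN]; exists N; split => //; apply: subset_trans sN.
  apply: subsetC => w /= YZw _; apply: cvg_EFin; first exact: nearW.
  exact: cvg_functional_ucc.
- exact: finite_measure_integrable_cst.
- by apply: aeW => w n _; rewrite /= lee_fin; exact: bPhi.
move=> _ _ cv.
have iZ := integrable_functional CZ mZ.
have : (fine \o (fun n => (\int[P]_w (Phi (Y n ^~ w))%:E)%E)) @ \oo --> fine (\int[P]_w (Phi (Z ^~ w))%:E)%E.
  apply: fine_cvg; rewrite fineK; last exact: (integrable_fin_num measurableT iZ).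
  exact: cv.
exact.
Qed.

(** Indices are chosen with means at most [2 ^- l]; the series of the selected functions is then
    integrable, hence finite almost everywhere, and its terms tend to 0. The property [l <= phi l]
    is what makes the meshes vanish along [phi]. *)
Lemma ae_cvg_subseq (f : nat -> T -> R) :
  (forall n, measurable_fun setT (f n)) -> (forall n w, 0 <= f n w) ->
  (\int[P]_w (f n w)%:E)%E @[n --> \oo] --> 0%E ->
  exists phi : nat -> nat, (forall l, (l <= phi l)%N) /\
    {ae P, forall w, f (phi l) w @[l --> \oo] --> 0}.
Proof.
move=> mf f0 cf.
have [phi phiP] : {phi : nat -> nat & forall l, (l <= phi l)%N /\
    (\int[P]_w (f (phi l) w)%:E <= ((2 ^- l) : R)%:E)%E}.
  apply: (@choice _ _ (fun l k => (l <= k)%N /\ (\int[P]_w (f k w)%:E <= ((2 ^- l) : R)%:E)%E)) => l.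
  have e0 : 0 < 2 ^- l :> R by rewrite invr_gt0 exprn_gt0.
  have /fine_cvgP[fin /cvgrPdist_le /(_ _ e0) H] := cf.
  have [k [[h1 h2] h3]] : exists k, ((\int[P]_w (f k w)%:E)%E \is a fin_num /\
      `|0 - fine (\int[P]_w (f k w)%:E)%E| <= 2 ^- l) /\ (l <= k)%N.
    have [n _ Hn] : \forall k \near \oo, ((\int[P]_w (f k w)%:E)%E \is a fin_num /\
      `|0 - fine (\int[P]_w (f k w)%:E)%E| <= 2 ^- l) /\ (l <= k)%N.
      near=> k; split; last by near: k; exact: nbhs_infty_ge.
      by split; near: k.
    by exists n; apply: Hn => /=.
  exists k; split => //; rewrite -(fineK h1) lee_fin (le_trans _ h2)//.
  by rewrite sub0r normrN ler_norm.
exists phi; split; first by move=> l; case: (phiP l).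
pose s w := (\sum_(0 <= l <oo) (f (phi l) w)%:E)%E.
have fe0 l w : (0 <= (f (phi l) w)%:E)%E by rewrite lee_fin.
have mfe l : measurable_fun setT (fun w => (f (phi l) w)%:E) by exact/measurable_EFinP.
have ms : measurable_fun setT s.
  by apply: ge0_emeasurable_sum => // k x _ _; exact: fe0.
have s0 w : (0 <= s w)%E by apply: nneseries_ge0.
have ints : (\int[P]_w s w < +oo)%E.
  rewrite /s integral_nneseries//.
  apply: (@le_lt_trans _ _ (\sum_(0 <= l <oo) (((2 ^- l) : R)%:E))%E).
    by apply: lee_nneseries => [l _ _|l _]; [apply: integral_ge0|case: (phiP l)].
  apply: (@le_lt_trans _ _ 2%:E); last by rewrite ltry.
  apply: lime_le; first by apply: is_cvg_nneseries => l _ _; rewrite lee_fin invr_ge0 exprn_ge0.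
  apply: nearW => n; rewrite sumEFin lee_fin.
  suff -> : \sum_(0 <= l < n) (2 ^- l : R) = 2 - 2 * 2 ^- n.
    by rewrite lerBlDr lerDl mulr_ge0// invr_ge0 exprn_ge0.
  elim: n => [|n IH]; first by rewrite big_geq// expr0 invr1 mulr1 subrr.
  by rewrite big_nat_recr//= IH exprS invfM mulrA divff// mul1r; ring.
have /integrable_ae : P.-integrable setT s.
  apply/integrableP; split => //.
  by under eq_integral do rewrite gee0_abs//.
move=> /(_ measurableT) [N [mN N0 sN]]; exists N; split => //; apply: subset_trans sN.
apply: subsetC => w /= /(_ I) sw.
have sfin : (s w < +oo)%E by rewrite -ge0_fin_numE.
have tail := @nneseries_tail_cvg R (fun l => (f (phi l) w)%:E) xpredT sfin (fun l _ => fe0 l w).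
have : (f (phi l) w)%:E @[l --> \oo] --> 0%E.
  apply: (squeeze_cvge _ (cvg_cst _) tail); apply: nearW => l; rewrite fe0 /=.
  have := @nneseries_lim_ge R (fun l => (f (phi l) w)%:E) xpredT l l.+1 (fun i _ _ => fe0 i w).
  by rewrite big_nat1.
by move=> /fine_cvgP[_].
Unshelve. all: by end_near.
Qed.

End FunctionalConvergence.

Section IndicatorVector.
Context {R : realType} {d : nat} disp (T : measurableType disp).
Variable X : R -> T -> 'I_d.

Lemma dotp_indicator (u : 'cV[R]_d) t w :
  dotp u (indicator_vector X t w) = u (X t w) ord0.
Proof.
rewrite /dotp mxE (bigD1 (X t w))//= !mxE eqxx mulr1 big1 ?addr0// => j jX.
by rewrite !mxE eq_sym (negbTE jX) mulr0.
Qed.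

Lemma entry_bound (u : 'cV[R]_d) i : `|u i ord0| <= \sum_j `|u j ord0|.
Proof. by rewrite (bigD1 i)//= lerDl sumr_ge0. Qed.

End IndicatorVector.

Lemma measurable_section {R : realType} d (T : measurableType d) d' (U : measurableType d')
    (g : measurableTypeR R * T -> U) (D : set (measurableTypeR R)) w : measurable D ->
  measurable_fun (D `*` setT) g -> measurable_fun D (fun s => g (s, w)).
Proof.
move=> mD mg; have mDT : measurable (D `*` [set: T]) by exact: measurableX.
refine (@measurable_comp _ _ _ (measurableTypeR R) _ _ _ _ D (fun s => (s, w)) mDT _ mg _).
  by move=> _ [s /= s0 <-].
exact: (measurable_funS measurableT _ (measurable_pair2 w)).
Qed.

Section Solutions.
Context {R : realType} disp (T : measurableType disp) (P : probability T R).
Variables (F : R -> set (set T)) (B b h M : R -> T -> R) (m0 : R).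
Hypothesis Ff : filtration F.
Hypothesis sde : sde_solution P F B b h m0 M.

Lemma C0oo_solution w : C0oo (M ^~ w).
Proof. by case: sde. Qed.

Lemma measurable_solution (t : R) : 0 <= t -> measurable_fun setT (M t).
Proof.
move=> t0; apply: (meas_wrt_measurable (G := F t)); first by case: Ff => /(_ t t0)[].
by case: sde => aM _ _ A mA; exact: aM.
Qed.

End Solutions.

Section PathErrors.
Context {R : realType} {d : nat} disp (T : measurableType disp) (P : probability T R).
Variables (X : R -> T -> 'I_d) (B M : R -> T -> R) (F : R -> set (set T)).
Variables (alpha gamma sigma : 'cV[R]_d) (m0 : R).
Hypothesis Ff : filtration F.
Hypothesis Bb : brownian_motion P F B.
Hypothesis Xcad : forall w, cadlag_steps (X ^~ w).
Local Notation leb := (@lebesgue_measure R).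
Definition diffusion (t : R) (w : T) : R := dotp sigma (indicator_vector X t w).
Definition drift (t : R) (w : T) : R := dotp (alpha - M t w *: gamma) (indicator_vector X t w).
Local Notation H := diffusion.
Local Notation b := drift.
Hypothesis sde : sde_solution P F B b H m0 M.

Let Sg : R := \sum_j `|sigma j ord0|.

Lemma diffusionE t w : H t w = sigma (X t w) ord0.
Proof. exact: dotp_indicator. Qed.

Lemma driftE t w : b t w = alpha (X t w) ord0 - gamma (X t w) ord0 * M t w.
Proof. by rewrite /drift dotp_indicator !mxE mulrC. Qed.

Let HS t w : `|H t w| <= Sg.
Proof. by rewrite diffusionE; exact: entry_bound. Qed.

Let Sg0 : 0 <= Sg. Proof. exact: sumr_ge0. Qed.

Definition grid_blocks (ka k : nat) : seq (@block R disp T) :=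
  [seq (j%:R / ka%:R, j.+1%:R / ka%:R, H (j%:R / ka%:R)) | j <- index_iota 0 k].

Lemma ito_H (t : R) : 0 <= t -> exists I, ito_integral P F B H t I.
Proof. by move=> t0; case: sde => _ _ /(_ t t0) [_ [I HI _]]; exists I. Qed.

Let Hadapt : adapted F measurable H.
Proof. by have [I []] := ito_H (lexx 0). Qed.

Lemma good_grid_blocks ka k : (0 < ka)%N -> good_blocks F (grid_blocks ka k).
Proof.
move=> ka0 x; rewrite /grid_blocks; elim: (index_iota _ _) => //= j r IH [<-|/IH//].
have j0 : 0 <= j%:R / ka%:R :> R by rewrite divr_ge0.
split => //=.
- by rewrite ler_pM2r ?invr_gt0 ?ltr0n// ler_nat.
- by move=> A mA; exact: Hadapt.
- by exists Sg => w; exact: HS.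
Qed.

Lemma sum_val_grid ka k s w : sum_val (grid_blocks ka k) s w = step ka k (H ^~ w) s.
Proof. by rewrite /sum_val /grid_blocks big_map big_mkord. Qed.

Lemma sum_inc_grid ka k w : (0 < ka)%N -> sum_inc B (k%:R / ka%:R) (grid_blocks ka k) w =
  \sum_(j < k) H (j%:R / ka%:R) w * inc B (j%:R / ka%:R) (j.+1%:R / ka%:R) w.
Proof.
move=> ka0; rewrite /sum_inc /grid_blocks big_map big_mkord; apply: eq_bigr => j _.
have ki : 0 < ka%:R^-1 :> R by rewrite invr_gt0 ltr0n.
by rewrite /block_inc /= !min_l// ler_pM2r// ler_nat// ltnW.
Qed.

Lemma left_cont_steps (u : 'cV[R]_d) w :
  {ae leb, forall s, 0 < s -> (fun r => u (X r w) ord0) r @[r --> s^'-] --> u (X s w) ord0}.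
Proof.
have [N [mN N0 sN]] := cadlag_steps_left (Xcad w); exists N; split => //.
apply: subset_trans sN; apply: subsetC => s /= Hs s0.
by apply: cvg_near_cst; apply: filterS (Hs s0) => r ->.
Qed.

Let measurable_H w (S : nat) : measurable_fun (`[0, S%:R] : set R) (H ^~ w).
Proof.
have [I [_ mH _ _]] := ito_H (ler0n R S).
exact: (measurable_section w _ mH).
Qed.

(** For each outcome the squared error is at most [2 * Sg] times the absolute error, which tends to
    0 by [cvg_step] since the chain is left continuous at almost every time. Boundedness of the
    volatility then allows dominated convergence over the outcomes. *)
Lemma cvg_grid_error (S : nat) :
  (\int[P]_w \int[leb]_(s in `[0%R, S%:R])
     ((H s w - sum_val (grid_blocks ka.+1 (S * ka.+1)) s w) ^+ 2)%:E)%E @[ka --> \oo] --> 0%E.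
Proof.
have mH2 ka : measurable_fun (`[0, S%:R]%classic `*` setT : set (measurableTypeR R * T))
   (fun z : measurableTypeR R * T => ((H z.1 z.2 - sum_val (grid_blocks ka.+1 (S * ka.+1)) z.1 z.2) ^+ 2)%:E).
  have [I [_ mH _ _]] := ito_H (ler0n R S).
  apply/measurable_EFinP; apply: measurable_funX; apply: measurable_funB => //.
  apply: measurable_funTS; apply: (measurable_sum_val Ff); exact: good_grid_blocks.
have sec ka w : measurable_fun (`[0, S%:R]%classic : set (measurableTypeR R)) (fun s : R => ((H s w - sum_val (grid_blocks ka.+1 (S * ka.+1)) s w) ^+ 2)%:E).
  exact: (measurable_section w _ (mH2 ka)).
pose f ka w := (\int[leb]_(s in `[0%R, S%:R])
     ((H s w - sum_val (grid_blocks ka.+1 (S * ka.+1)) s w) ^+ 2)%:E)%E.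
have SE ka : (S * ka.+1)%:R / ka.+1%:R = S%:R :> R by rewrite natrM mulfK// pnatr_eq0.
have bnd ka w (s : R) : s \in `[0, S%:R] -> `|H s w - sum_val (grid_blocks ka.+1 (S * ka.+1)) s w| <= 2 * Sg.
  rewrite in_itv /= => /andP[]; rewrite le_eqVlt => /predU1P[<-|s0] sS.
    rewrite sum_val_grid /step big1 ?subr0; first by rewrite (le_trans (HS _ _))// ler_peMl// ler1n.
    by move=> j _; rewrite /inoc [X in (X && _)%:R]le_gtF ?mulr0// divr_ge0.
  rewrite (le_trans (ler_normB _ _))// mulrDl mul1r lerD// sum_val_grid.
  by apply: step_bound => //; rewrite SE s0.
have mf ka : measurable_fun setT (f ka).
  apply: (@measurable_time_integral _ _ T S%:R (fun z => ((H z.1 z.2 - sum_val (grid_blocks ka.+1 (S * ka.+1)) z.1 z.2) ^+ 2)%:E)); first exact: mH2.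
  by move=> z; rewrite lee_fin sqr_ge0.
have f0 ka w : (0 <= f ka w)%E by apply: integral_ge0 => s _; rewrite lee_fin sqr_ge0.
have fle ka w : (f ka w <= (2 * Sg)%:E * \int[leb]_(s in `[0%R, S%:R]) (`|H s w - step ka.+1 (S * ka.+1) (H ^~ w) s|)%:E)%E.
  have mabs : measurable_fun (`[0%R, S%:R] : set R) (fun s : R => `|H s w - step ka.+1 (S * ka.+1) (H ^~ w) s|%:E).
    apply/measurable_EFinP; apply: measurableT_comp => //; apply: measurable_funB; first exact: measurable_H.
    exact: measurable_step.
  rewrite -ge0_integralZl//; do ?[by rewrite lee_fin mulr_ge0].
  apply: ge0_le_integral => //.
  - by move=> s _; rewrite lee_fin sqr_ge0.
  - exact: measurable_funeM.
  - move=> s sS; rewrite -EFinM lee_fin -(real_normK (num_real _)) expr2 sum_val_grid.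
    by rewrite ler_wpM2r// -sum_val_grid; apply: bnd.
have f_cvg w : f ka w @[ka --> \oo] --> 0%E.
  have c1 := @cvg_step R S (H ^~ w) Sg (@measurable_H w S) (fun s _ => HS s w).
  have ae : {ae leb, forall s : R, 0 < s -> (H ^~ w) u @[u --> s^'-] --> H s w}.
    have [N [mN N0 sN]] := left_cont_steps sigma w; exists N; split => //.
    apply: subset_trans sN; apply: subsetC => s /= Hs s0; rewrite diffusionE.
    apply: cvg_trans (Hs s0); apply: near_eq_cvg; apply: nearW => r.
    by rewrite diffusionE.
  have c2 := cvgeZl (isT : (2 * Sg)%:E \is a fin_num) (c1 ae).
  rewrite mule0 -cvg_shiftS in c2.
  apply: (@squeeze_cvge _ _ _ _ (fun=> 0%E) _ _ _ 0%E (cvg_cst _) c2); apply: nearW => ka.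
  by rewrite f0 /= fle.
have [] := @dominated_convergence _ _ _ P setT measurableT f (cst 0%E) (cst ((2 * Sg) ^+ 2 * S%:R)%:E) mf.
- exact: measurable_cst.
- by apply: aeW => w _; exact: f_cvg.
- exact: finite_measure_integrable_cst.
- apply: aeW => w ka _; rewrite gee0_abs//.
  apply: (@le_trans _ _ (\int[leb]_(s in `[0%R, S%:R]) (cst ((2 * Sg) ^+ 2)%:E s))%E).
    apply: ge0_le_integral => //.
    - by move=> s _; rewrite lee_fin sqr_ge0.
    - move=> s sS; rewrite lee_fin -(real_normK (num_real _)) lerXn2r ?nnegrE ?mulr_ge0//.
      exact: bnd.
  rewrite integral_cst//= lebesgue_measure_itv /= lte_fin; case: ifP => _.
    by rewrite -EFinB -EFinM subr0.
  by rewrite mule0 lee_fin mulr_ge0// sqr_ge0.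
by move=> _ _; rewrite integral_cst// mul0e.
Qed.

End PathErrors.

Section GridErrors.
Context {R : realType}.

Lemma integral_weighted_sqr_le disp (T : measurableType disp) (P : probability T R) n
    (w : nat -> R) (f : nat -> T -> R) (q : \bar R) :
  (forall k, 0 <= w k) -> (forall k, measurable_fun setT (f k)) ->
  (forall k, (k < n)%N -> (\int[P]_x (f k x ^+ 2)%:E <= q)%E) ->
  (\int[P]_x (\sum_(k < n) w k * f k x ^+ 2)%:E <= (\sum_(k < n) w k)%:E * q)%E.
Proof.
move=> w0 mf; elim: n => [|n IH] fq.
  rewrite (eq_integral (fun=> 0%E)) ?integral0 ?big_ord0 ?mul0e// => x _.
  by rewrite big_ord0.
have m1 : measurable_fun setT (fun x => (\sum_(k < n) w k * f k x ^+ 2)%:E).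
  apply/measurable_EFinP; apply: measurable_sum => k; apply: measurable_funM => //.
  exact: measurable_funX.
have m2 : measurable_fun setT (fun x => (f n x ^+ 2)%:E).
  by apply/measurable_EFinP; exact: measurable_funX.
under eq_integral do rewrite big_ord_recr /= EFinD EFinM.
rewrite ge0_integralD//; last 3 first.
- by move=> x _; rewrite lee_fin sumr_ge0// => k _; rewrite mulr_ge0// sqr_ge0.
- by move=> x _; rewrite mule_ge0 ?lee_fin ?sqr_ge0.
- exact: measurable_funeM.
rewrite ge0_integralZl//; do ?[by rewrite lee_fin]; last by move=> x _; rewrite lee_fin sqr_ge0.
have w1 : 0 <= \sum_(k < n) w k by rewrite sumr_ge0.
rewrite big_ord_recr /= EFinD ge0_muleDl ?lee_fin// leeD//.
  by apply: IH => k kn; apply: fq; exact: ltnW.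
by rewrite lee_wpmul2l ?lee_fin// fq.
Qed.

Lemma measurable_lin disp (T : measurableType disp) m (v : T -> nat -> R) (t : R) :
  (forall j, (j <= m * m)%N -> measurable_fun setT (v ^~ j)) ->
  measurable_fun setT (fun w => lin m (v w) t).
Proof.
move=> mv; apply: measurable_sum => j; apply: measurable_funM => //.
by apply: mv; rewrite -ltnS.
Qed.

End GridErrors.

(** * From the modulated equation to its Euler scheme *)

Section EulerApproximation.
Context {R : realType} {d : nat} disp (T : measurableType disp) (P : probability T R).
Variables (X : R -> T -> 'I_d) (B M : R -> T -> R) (F : R -> set (set T)).
Variables (alpha gamma sigma : 'cV[R]_d) (m0 : R).
Hypothesis Ff : filtration F.
Hypothesis Bb : brownian_motion P F B.
Hypothesis Xcad : forall w, cadlag_steps (X ^~ w).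
Hypothesis mX : forall (t : R) i, 0 <= t -> measurable (X t @^-1` [set i]).
Local Notation leb := (@lebesgue_measure R).
Local Notation H := (diffusion X sigma).
Local Notation b := (drift X M alpha gamma).
Hypothesis sde : sde_solution P F B b H m0 M.
Local Notation grid_blocks := (grid_blocks X sigma).

Definition grid_states (ka : nat) (w : T) (k : nat) : 'I_d := X (k%:R / ka%:R) w.
Definition grid_noise (ka : nat) (w : T) (k : nat) : R :=
  sigma (X (k%:R / ka%:R) w) ord0 * inc B (k%:R / ka%:R) (k.+1%:R / ka%:R) w.
Definition grid_euler (ka : nat) (w : T) (k : nat) : R :=
  euler alpha gamma m0 ka%:R^-1 (grid_states ka w) (grid_noise ka w) k.

Lemma measurable_entry (u : 'cV[R]_d) (t : R) : 0 <= t -> measurable_fun setT (fun w => u (X t w) ord0).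
Proof.
move=> t0; apply: (@measurable_fun_countable R _ T 'I_d (fun i => u i ord0) (X t)).
by move=> i; exact: mX.
Qed.

Lemma measurable_grid_noise ka k : measurable_fun setT (fun w => grid_noise ka w k).
Proof.
by apply: measurable_funM; [apply: measurable_entry|apply: (measurable_inc Ff Bb)]; rewrite divr_ge0.
Qed.

Lemma measurable_grid_euler ka k : measurable_fun setT (fun w => grid_euler ka w k).
Proof.
rewrite /grid_euler; elim: k => [|k IH] /=; first exact: measurable_cst.
apply: measurable_funD; last exact: measurable_grid_noise.
apply: measurable_funD; first exact: IH.
apply: measurable_funM => //; apply: measurable_funB.
  by apply: measurable_entry; rewrite divr_ge0.
by apply: measurable_funM => //; apply: measurable_entry; rewrite divr_ge0.
Qed.

(** For a fixed outcome the drift is bounded on [[0, S]] and left continuous at almost every time: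
    the chain has null jump times and [M] is continuous. *)
Lemma drift_error (S : nat) w : leb.-integrable `[0, S%:R] (EFin \o (b ^~ w)) ->
  fine (\int[leb]_(s in `[0%R, S%:R]) (`|b s w - step ka (S * ka) (b ^~ w) s|)%:E)%E
    @[ka --> \oo] --> 0.
Proof.
move=> ib; have [_ CM _] := sde.
have [c Mc] := C0oo_bounded S%:R (CM w).
have Kb (u : 'cV[R]_d) i : `|u i ord0| <= \sum_j `|u j ord0| := entry_bound u i.
have mb : measurable_fun (`[0, S%:R] : set R) (b ^~ w).
  by apply/measurable_EFinP; exact: measurable_int ib.
have bb s : 0 <= s <= S%:R -> `|b s w| <= \sum_j `|alpha j ord0| + (\sum_j `|gamma j ord0|) * c.
  move=> sS; rewrite driftE (le_trans (ler_normB _ _))// lerD// normrM ler_pM//.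
  exact: Mc.
have ae : {ae leb, forall s : R, 0 < s -> (b ^~ w) u @[u --> s^'-] --> b s w}.
  have h1 := left_cont_steps Xcad alpha w; have h2 := left_cont_steps Xcad gamma w.
  apply: (@filterS2 _ _ (ae_filter_ringOfSetsType leb) _ _ _ _ h1 h2) => s c1 c2 s0.
  rewrite driftE (_ : b ^~ w = (fun u => alpha (X u w) ord0 - gamma (X u w) ord0 * M u w)); last first.
    by apply/funext => u; exact: driftE.
  apply: cvgB; first exact: c1.
  by apply: cvgM; [exact: c2|exact: C0oo_left].
by have /fine_cvgP[_] := cvg_step mb bb ae.
Qed.

Variables (Phi : ucc_paths R -> R) (c : R).
Hypothesis cPhi : {within (C0oo : set (ucc_paths R)), continuous Phi}.
Hypothesis bPhi : forall x, C0oo x -> `|Phi x| <= c.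

(** The chain and the coarse grid [m] are fixed and the fine mesh [1 / (m * r)] tends to 0.
    Convergence is obtained along a subsequence, which is enough for one [r]; the lower bound [r0]
    leaves room for a mesh condition depending on [N]. *)
Lemma euler_approximation (m r0 : nat) (eps : R) : (0 < m)%N -> 0 < eps ->
  exists2 r, (r0 < r)%N & `|\int[P]_w Phi (lin m (fun j => M (j%:R / m%:R) w)) -
     \int[P]_w Phi (lin m (fun j => grid_euler (m * r) w (j * r)))| <= eps.
Proof.
move=> m_gt0 eps0.
have m0' : 0 < m%:R :> R by rewrite ltr0n.
(* The equation yields a version of the stochastic integral for each time separately; one is
   selected for every [t]. *)
have [It ItP] : {It : R -> T -> R & forall t, 0 <= t -> ito_integral P F B H t (It t) /\
   {ae P, forall w, M t w = m0 + (\int[leb]_(s in `[0, t]) b s w) + It t w}}.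
  apply: (@choice _ _ (fun t I => 0 <= t -> ito_integral P F B H t I /\
    {ae P, forall w, M t w = m0 + (\int[leb]_(s in `[0, t]) b s w) + I w})) => t.
  have [t0|t0] := pselect (0 <= t); last by exists (fun=> 0).
  by case: sde => _ _ /(_ t t0)[_ [I HI EI]]; exists I.
pose iota ka k w := It (k%:R / ka%:R) w - \sum_(j < k) grid_noise ka w j.
have miota ka k : measurable_fun setT (iota ka k).
  have kk0 : 0 <= k%:R / ka%:R :> R by rewrite divr_ge0.
  have [[_ _ mI _] _] := ItP _ kk0.
  by apply: measurable_funB => //; apply: measurable_sum => j; exact: measurable_grid_noise.
pose Q ka := (\int[P]_w \int[leb]_(s in `[0%R, m%:R])
     ((H s w - sum_val (grid_blocks ka (m * ka)) s w) ^+ 2)%:E)%E.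
have k0 := @kappa_ge0 R.
have iotaQ ka k : (0 < ka)%N -> (k <= m * ka)%N ->
    (\int[P]_w ((iota ka k w) ^+ 2)%:E <= (4 * @kappa R)%:E * Q ka)%E.
  move=> ka0 kn; have kk0 : 0 <= k%:R / ka%:R :> R by rewrite divr_ge0.
  have kki : 0 < ka%:R^-1 :> R by rewrite invr_gt0 ltr0n.
  have [HI _] := ItP _ kk0.
  have mE : m%:R = (m * ka)%:R / ka%:R :> R by rewrite natrM mulfK// pnatr_eq0 -lt0n.
  have km : k%:R / ka%:R <= m%:R :> R by rewrite mE ler_pM2r// ler_nat.
  have := ito_dist Ff Bb kk0 HI (good_grid_blocks sde (k:=k) ka0).
  have -> : (\int[P]_w ((It (k%:R / ka%:R) w - sum_inc B (k%:R / ka%:R) (grid_blocks ka k) w) ^+ 2)%:E =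
     \int[P]_w ((iota ka k w) ^+ 2)%:E)%E.
    apply: eq_integral => w _; rewrite sum_inc_grid//; congr ((_ - _) ^+ 2)%:E.
    by apply: eq_bigr => j _; rewrite diffusionE.
  move=> /le_trans; apply; rewrite lee_wpmul2l ?lee_fin ?mulr_ge0//.
  have mH k' (t : R) : 0 <= t -> measurable_fun (`[0, t]%classic `*` setT : set (measurableTypeR R * T))
     (fun z : measurableTypeR R * T => ((H z.1 z.2 - sum_val (grid_blocks ka k') z.1 z.2) ^+ 2)%:E).
    move=> t0; have [I [_ mH _ _]] := ito_H sde t0.
    apply/measurable_EFinP; apply: measurable_funX; apply: measurable_funB => //.
    by apply: measurable_funTS; apply: (measurable_sum_val Ff); exact: (good_grid_blocks sde).
  have mI k' (t : R) : 0 <= t -> measurable_fun setT (fun w => \int[leb]_(s in `[0%R, t]) ((H s w - sum_val (grid_blocks ka k') s w) ^+ 2)%:E)%E.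
    move=> t0; apply: (@measurable_time_integral _ _ T t (fun z => ((H z.1 z.2 - sum_val (grid_blocks ka k') z.1 z.2) ^+ 2)%:E)).
      exact: mH.
    by move=> z; rewrite lee_fin sqr_ge0.
  apply: ge0_le_integral => //.
  - by move=> w _; apply: integral_ge0 => s _; rewrite lee_fin sqr_ge0.
  - exact: mI.
  - exact: mI.
  move=> w _; apply: (@le_trans _ _ (\int[leb]_(s in `[0%R, (k%:R / ka%:R)%R])
     ((H s w - sum_val (grid_blocks ka (m * ka)) s w) ^+ 2)%:E)%E).
    rewrite le_eqVlt; apply/orP; left; apply/eqP; apply: eq_integral => s.
    by rewrite inE /= in_itv /= => /andP[_ sk]; rewrite !sum_val_grid (step_prefix _ ka0 kn sk).
  apply: ge0_subset_integral => //.
  - exact: (measurable_section w _ (mH (m * ka)%N m%:R (ltW m0'))).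
  - by move=> s _; rewrite lee_fin sqr_ge0.
  - by move=> s /=; rewrite !in_itv /= => /andP[-> /le_trans ->].

pose kap l := (m * l.+1)%N; pose n l := (m * kap l)%N.
have kap0 l : (0 < kap l)%N by rewrite /kap muln_gt0 m_gt0.
have jn l j : (j < (m * m).+1)%N -> (j * l.+1 <= n l)%N.
  by rewrite ltnS /n /kap mulnA => jm; rewrite leq_mul2r jm orbT.
(* Squared stochastic errors at the [m * m + 1] observed times, plus their Riemann sum over the fine
   grid: the two quantities that [euler_error] requires. The mean of [J] is at most
   [(m ^ 2 + 1 + m)] times one isometry bound. *)
pose J l w := (\sum_(j < (m * m).+1) 1 * iota (kap l) (j * l.+1)%N w ^+ 2) +
  \sum_(k < n l) (kap l)%:R^-1 * iota (kap l) k w ^+ 2.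
have J1 l w : 0 <= \sum_(j < (m * m).+1) 1 * iota (kap l) (j * l.+1)%N w ^+ 2.
  by rewrite sumr_ge0// => i _; rewrite mulr_ge0// sqr_ge0.
have J2 l w : 0 <= \sum_(k < n l) (kap l)%:R^-1 * iota (kap l) k w ^+ 2.
  by rewrite sumr_ge0// => i _; rewrite mulr_ge0// ?invr_ge0// sqr_ge0.
have J0 l w : 0 <= J l w by rewrite addr_ge0.
have mS (a : R) (f : nat -> T -> R) N : (forall k, measurable_fun setT (f k)) ->
    measurable_fun setT (fun w => \sum_(k < N) a * f k w ^+ 2).
  move=> mf; apply: measurable_sum => k; apply: measurable_funM => //; exact: measurable_funX.
have mJ l : measurable_fun setT (J l).
  apply: measurable_funD.
    by apply: (mS 1 (fun j => iota (kap l) (j * l.+1)%N)) => k; exact: miota.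
  by apply: (mS (kap l)%:R^-1 (fun j => iota (kap l) j)) => k; exact: miota.
have Jle l : (\int[P]_w (J l w)%:E <= ((m * m).+1%:R + m%:R)%:E * ((4 * @kappa R)%:E * Q (kap l)))%E.
  rewrite /J; under eq_integral do rewrite EFinD.
  rewrite ge0_integralD//; last 4 first.
  - by move=> w _; rewrite lee_fin.
  - by apply/measurable_EFinP; apply: (mS 1 (fun j => iota (kap l) (j * l.+1)%N)) => k; exact: miota.
  - by move=> w _; rewrite lee_fin.
  - by apply/measurable_EFinP; apply: (mS (kap l)%:R^-1 (fun j => iota (kap l) j)) => k; exact: miota.
  rewrite EFinD ge0_muleDl ?lee_fin// leeD//.
    have := @integral_weighted_sqr_le _ _ _ P (m * m).+1 (fun=> 1) (fun j => iota (kap l) (j * l.+1)%N) ((4 * @kappa R)%:E * Q (kap l)).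
    rewrite sumr_const card_ord; apply => // k km; apply: iotaQ => //; exact: jn.
  have := @integral_weighted_sqr_le _ _ _ P (n l) (fun=> (kap l)%:R^-1) (fun j => iota (kap l) j) ((4 * @kappa R)%:E * Q (kap l)).
  have nE : (kap l)%:R^-1 *+ n l = m%:R :> R.
    by rewrite -[LHS]mulr_natr /n (natrM _ m (kap l)) [X in _ * X]mulrC mulrA mulVf ?mul1r// pnatr_eq0 -lt0n.
  rewrite sumr_const card_ord nE.
  by apply => // k km; apply: iotaQ => //; exact: ltnW.
have Jcvg : (\int[P]_w (J l w)%:E)%E @[l --> \oo] --> 0%E.
  have c1 := cvg_grid_error Ff Xcad sde m.
  have c2 : Q (kap l) @[l --> \oo] --> 0%E.
    have := cvg_comp _ _ (@cvg_nat_ge (fun l => (kap l).-1) _) c1.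
    have ll l : (l <= (kap l).-1)%N by rewrite -ltnS prednK// /kap leq_pmull.
    move=> /(_ ll); apply: cvg_trans; apply: near_eq_cvg; apply: nearW => l /=.
    by rewrite prednK.
  have fi (x : R) : x%:E \is a fin_num by [].
  have := cvgeZl (fi ((m * m).+1%:R + m%:R)) (cvgeZl (fi (4 * @kappa R)) c2).
  rewrite !mule0 => c3.
  apply: (@squeeze_cvge _ _ _ _ (fun=> 0%E) _ _ _ 0%E (cvg_cst _) c3); apply: nearW => l.
  by rewrite Jle andbT; apply: integral_ge0 => w _; rewrite lee_fin.
have [phi [phil Jae]] := ae_cvg_subseq mJ J0 Jcvg.
have CM : forall w, C0oo (M ^~ w) by case: sde.
(* The grid times of all meshes together are countable, so a single null set serves them all. *)
have eqM : {ae P, forall w, forall l k, M (k%:R / (kap l)%:R) w =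
    m0 + (\int[leb]_(s in `[0, k%:R / (kap l)%:R]) b s w) + It (k%:R / (kap l)%:R) w}.
  apply/ae_foralln => l; apply/ae_foralln => k.
  have kk0 : 0 <= k%:R / (kap l)%:R :> R by rewrite divr_ge0.
  by case: (ItP _ kk0).
have ib : {ae P, forall w, leb.-integrable `[0, m%:R] (EFin \o (b ^~ w))}.
  by case: sde => _ _ /(_ m%:R (ltW m0'))[].
pose Y l (t : R) w := lin m (fun j => grid_euler (kap (phi l)) w (j * (phi l).+1)) t.
pose Z (t : R) w := lin m (fun j => M (j%:R / m%:R) w) t.
have cv : \int[P]_w Phi (Y l ^~ w) @[l --> \oo] --> \int[P]_w Phi (Z ^~ w).
  apply: (cvg_expectation cPhi bPhi).
  - by move=> l w; exact: C0oo_lin.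
  - by move=> l t _; apply: measurable_lin => j _; exact: measurable_grid_euler.
  - by move=> w; exact: C0oo_lin.
  - by move=> t _; apply: measurable_lin => j _; apply: (measurable_solution Ff sde); rewrite divr_ge0.
  apply: (@filterS3 _ _ (ae_filter_ringOfSetsType P) _ _ _ _ _ Jae eqM ib) => w Jw eqw ibw.
  apply: (@ucc_cvg_lin_fixed R m (fun l j => grid_euler (kap (phi l)) w (j * (phi l).+1)%N) (fun j => M (j%:R / m%:R) w)) => e e0.
  pose G : R := \sum_j `|gamma j ord0|.
  have G0 : 0 <= G by exact: sumr_ge0.
  pose K := 1 + G * expR (m%:R * G) * (m%:R + 1).
  have K_gt0 : 0 < K by rewrite ltr_pwDl// !mulr_ge0 ?expR_ge0 ?addr_ge0.
  (* [K] is the Gronwall factor of [euler_error] over the horizon [m]. The quadrature error, the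
     threshold and [J / eta] each take one share [eta], which is why [J <= eta ^ 2] is asked. *)
  pose eta := e / (3 * K).
  have eta0 : 0 < eta by rewrite divr_gt0// mulr_gt0.
  pose rho l := fine (\int[leb]_(s in `[0%R, m%:R])
      (`|b s w - step (kap (phi l)) (m * kap (phi l)) (b ^~ w) s|)%:E)%E.
  have rho_cvg : rho l @[l --> \oo] --> 0.
    have := cvg_comp _ _ (@cvg_nat_ge (fun l => kap (phi l)) _) (drift_error ibw).
    by apply=> l; rewrite (leq_trans (phil l))// /kap -ltnS ltnW// ltnS leq_pmull.
  near=> l; move=> j jm.
  have rho_le : rho l <= eta.
    have : `|0 - rho l| <= eta by near: l; move/cvgrPdist_le: rho_cvg; exact.
    by rewrite sub0r normrN; apply: le_trans; exact: ler_norm.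
  have J_le : J (phi l) w <= eta ^+ 2.
    have : `|0 - J (phi l) w| <= eta ^+ 2.
      by near: l; move/cvgrPdist_le: Jw; apply; rewrite exprn_gt0.
    by rewrite sub0r normrN; apply: le_trans; exact: ler_norm.
  have rho0 : 0 <= rho l by apply: fine_ge0; apply: integral_ge0 => s _; rewrite lee_fin.
  set ka := kap (phi l); have ka0 : (0 < ka)%N := kap0 _.
  have hn : ka%:R^-1 * (m * ka)%:R = m%:R :> R.
    by rewrite (natrM _ m ka) [X in _ * X]mulrC mulrA mulVf ?mul1r// pnatr_eq0 -lt0n.
  pose y k := M (k%:R / ka%:R) w.
  pose r k := (\int[leb]_(s in `[0, k%:R / ka%:R]) b s w -
     ka%:R^-1 * \sum_(i < k) b (i%:R / ka%:R) w) + iota ka k w.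
  have -> : M (j%:R / m%:R) w = y (j * (phi l).+1)%N.
    rewrite /y /ka /kap !natrM invfM mulrACA divff ?mulr1// pnatr_eq0//.
  apply: (@le_trans _ _ (K * (rho l + eta + J (phi l) w / eta))).
    rewrite /K -hn.
    apply: (@euler_error _ _ _ _ _ _ _ _ _ _ _ _ y r (fun k => iota ka k w)) => //.
    - exact: entry_bound.
    - move=> k kn; rewrite /y eqw /r /iota -/ka /grid_states.
      under [in RHS]eq_bigr do rewrite -driftE.
      by ring.
    - move=> k kn; rewrite (le_trans (ler_normD _ _))// lerD2r.
      have mE : (m * ka)%:R / ka%:R = m%:R :> R by rewrite mulrC hn.
      have := @riemann_step R ka (m * ka) (b ^~ w) k ka0 kn.
      by rewrite mE => /(_ ibw).
    - exact: jn.
    - rewrite /J lerD//.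
        rewrite (bigD1 (Ordinal (jm : (j < (m * m).+1)%N)))//= mul1r lerDl.
        by rewrite sumr_ge0// => i _; rewrite mulr_ge0// sqr_ge0.
      by rewrite mulr_sumr.
  have J_le2 : J (phi l) w / eta <= eta by rewrite ler_pdivrMr// -expr2.
  apply: (@le_trans _ _ (K * (3 * eta))); last first.
    by rewrite /eta invfM [X in K * X]mulrCA !mulrA; rewrite mulfK ?gt_eqF// mulrAC mulfV ?gt_eqF// mul1r.
  rewrite ler_pM2l//; lra.
move/cvgrPdist_le: cv => /(_ _ eps0) cv.
have [l rl /= hl] : exists2 l, (r0 < (phi l).+1)%N &
    `|\int[P]_w Phi (Z ^~ w) - \int[P]_w Phi (Y l ^~ w)| <= eps.
  have [N _ NP] := cv; exists (maxn N r0); last by apply: NP => /=; rewrite leq_maxl.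
  by rewrite ltnS (leq_trans _ (phil _))// leq_maxr.
by exists (phi l).+1.
Unshelve. all: by end_near.
Qed.

End EulerApproximation.

(** * Transfer to the limiting probability space *)

Section EulerMeasurability.
Context {R : realType} {d : nat} (alpha gamma : 'cV[R]_d) (m0 : R).

Lemma eq_euler (h : R) (x x' : nat -> 'I_d) (eta eta' : nat -> R) k :
  (forall j, (j < k)%N -> x j = x' j) -> (forall j, (j < k)%N -> eta j = eta' j) ->
  euler alpha gamma m0 h x eta k = euler alpha gamma m0 h x' eta' k.
Proof.
elim: k => //= k IH hx he; rewrite hx// he// IH// => j jk; [apply: hx|apply: he]; exact: ltnW.
Qed.

Lemma eq_lin m (v v' : nat -> R) (t : R) : (forall j, (j <= m * m)%N -> v j = v' j) ->
  lin m v t = lin m v' t.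
Proof. by move=> H; apply: eq_bigr => j _; rewrite H// -ltnS. Qed.

Lemma measurable_euler disp (T : measurableType disp) (h : R) (x : nat -> 'I_d)
    (eta : T -> nat -> R) k : (forall j, (j < k)%N -> measurable_fun setT (eta ^~ j)) ->
  measurable_fun setT (fun w => euler alpha gamma m0 h x (eta w) k).
Proof.
elim: k => [|k IH] meta /=; first exact: measurable_cst.
have mk := IH (fun j jk => meta j (ltnW jk)).
apply: measurable_funD; last exact: meta.
apply: measurable_funD => //; apply: measurable_funM => //; apply: measurable_funB => //.
exact: measurable_funM.
Qed.

End EulerMeasurability.

Section Transfer.
Context {R : realType} {d : nat} disp (T : measurableType disp) (P : probability T R).
Variables (X : R -> T -> 'I_d) (B : R -> T -> R) (F : R -> set (set T)) (Q : 'M[R]_d).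
Variables (alpha gamma sigma : 'cV[R]_d) (m0 : R).
Hypothesis Ff : filtration F.
Hypothesis Bb : brownian_motion P F B.
Hypothesis mX : markov_chain P Q X.
Hypothesis XB : independent_processes P X B.
Context disp' (T' : measurableType disp') (P' : probability T' R).
Variables (B' : R -> T' -> R) (F' : R -> set (set T')).
Hypothesis Ff' : filtration F'.
Hypothesis Bb' : brownian_motion P' F' B'.
Variables (Phi : ucc_paths R -> R) (c : R).
Hypothesis cPhi : {within (C0oo : set (ucc_paths R)), continuous Phi}.
Hypothesis bPhi : forall x, C0oo x -> `|Phi x| <= c.
Variables (rho : R) (i0 : 'I_d).
Hypothesis rho0 : 0 < rho.

(* Conditionally on the chain, the noise of the Euler scheme has independent Gaussian increments of
   variance [h * sigma_i ^ 2]; run along [clock], the single motion [rho * B'] reproduces it for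
   every trajectory of the chain. *)
Definition clock (h : R) (x : nat -> 'I_d) (k : nat) : R :=
  h * (\sum_(j < k) (sigma (x j) ord0) ^+ 2) / rho ^+ 2.

Definition clock_noise (h : R) (x : nat -> 'I_d) (w : T') (k : nat) : R :=
  rho * inc B' (clock h x k) (clock h x k.+1) w.

Definition coarse_euler m r (h : R) (x : nat -> 'I_d) (eta : nat -> R) : R -> R :=
  lin m (fun j => euler alpha gamma m0 h x eta (j * r)).

Lemma clock0 h x : clock h x 0 = 0.
Proof. by rewrite /clock big_ord0 mulr0 mul0r. Qed.

Lemma clockS h x k : clock h x k.+1 = clock h x k + h * (sigma (x k) ord0) ^+ 2 / rho ^+ 2.
Proof. by rewrite /clock big_ord_recr /= mulrDr mulrDl. Qed.

Lemma clock_le h x k : 0 <= h -> clock h x k <= clock h x k.+1.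
Proof.
move=> h0; rewrite clockS lerDl divr_ge0// ?exprn_ge0 ?(ltW rho0)//.
by rewrite mulr_ge0// sqr_ge0.
Qed.

Lemma clock_ge0 h x k : 0 <= h -> 0 <= clock h x k.
Proof.
by move=> h0; elim: k => [|k IH]; rewrite ?clock0// (le_trans IH)// clock_le.
Qed.

Lemma measurable_clock_noise h x k : 0 <= h -> measurable_fun setT (fun w => clock_noise h x w k).
Proof.
by move=> h0; apply: measurable_funM => //; apply: (measurable_inc Ff' Bb'); exact: clock_ge0.
Qed.

(** The noise of the scheme along a prescribed trajectory: it is a function of [B] alone, hence
    independent of the chain. *)
Definition frozen_noise ka (x : nat -> 'I_d) (w : T) (k : nat) : R :=
  sigma (x k) ord0 * inc B (k%:R / ka%:R) (k.+1%:R / ka%:R) w.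

Lemma measurable_coarse m r ka (h : R) (x : nat -> 'I_d) : (m * m * r <= ka)%N ->
  measurable_fun setT ((fun eta => Phi (coarse_euler m r h x eta)) : path_space ka -> R).
Proof.
move=> mr; apply: (@measurable_functional R _ (path_space ka) Phi (fun t eta => coarse_euler m r h x eta t)) => //.
  by move=> eta; exact: C0oo_lin.
move=> t _; apply: measurable_lin => j jm.
apply: (@measurable_euler _ _ _ _ _ _ (path_space ka) h x (fun eta => eta)) => k kj.
by apply: measurable_coord; rewrite (leq_trans kj)// (leq_trans _ mr)// leq_mul2r jm orbT.
Qed.

Lemma coarse_bound m r (h : R) (x : nat -> 'I_d) eta : `|Phi (coarse_euler m r h x eta)| <= c.
Proof. by apply: bPhi; exact: C0oo_lin. Qed.

(** Both noises have independent centred Gaussian entries; their standard deviations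
    [|sigma| * sqrt h] and [rho * sqrt (h * sigma ^ 2 / rho ^ 2)] agree, zero volatility
    included. *)
Lemma frozen_noise_law m r ka n x : (0 < ka)%N -> (m * m * r <= n)%N ->
  \int[P]_w Phi (coarse_euler m r ka%:R^-1 x (frozen_noise ka x w)) =
  \int[P']_w Phi (coarse_euler m r ka%:R^-1 x (clock_noise ka%:R^-1 x w)).
Proof.
move=> ka0 mrn; have h0 : 0 < ka%:R^-1 :> R by rewrite invr_gt0 ltr0n.
have ule k : k%:R / ka%:R <= k.+1%:R / ka%:R :> R by rewrite ler_pM2r// ler_nat.
apply: (@rectangle_law R n _ T P _ T' P' (frozen_noise ka x) (clock_noise ka%:R^-1 x)
   (fun eta => Phi (coarse_euler m r ka%:R^-1 x eta)) c).
- move=> k _; apply: measurable_funM => //.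
  by apply: (measurable_inc Ff Bb); rewrite divr_ge0.
- by move=> k _; apply: measurable_clock_noise; exact: ltW.
- move=> A mA.
  have u0 : 0 <= 0%:R / ka%:R :> R by rewrite mul0r.
  have v0 : 0 <= clock ka%:R^-1 x 0 by rewrite clock0.
  have vle k : clock ka%:R^-1 x k <= clock ka%:R^-1 x k.+1 by apply: clock_le; exact: ltW.
  transitivity (\prod_(k < n) gauss (`|sigma (x k) ord0| *
      Num.sqrt (k.+1%:R / ka%:R - k%:R / ka%:R)) (A k))%E.
    exact: (@increments_law _ _ _ P F B Ff Bb (fun k => k%:R / ka%:R) (fun k => sigma (x k) ord0) A n).
  transitivity (\prod_(k < n) gauss (`|rho| *
      Num.sqrt (clock ka%:R^-1 x k.+1 - clock ka%:R^-1 x k)) (A k))%E; last first.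
    exact/esym/(@increments_law _ _ _ P' F' B' Ff' Bb' (clock ka%:R^-1 x) (fun=> rho) A n).
  apply: eq_bigr => k _; congr gauss.
  rewrite -mulrBl -natr1 [_ + 1]addrC addrK mul1r clockS addrAC subrr add0r.
  rewrite (gtr0_norm rho0) -mulrA sqrtrM ?ltW// [in RHS]mulrCA [in LHS]mulrC; congr (_ * _).
  by rewrite sqrtrM ?sqr_ge0// sqrtrV ?sqr_ge0// !sqrtr_sqr (gtr0_norm rho0) mulrCA divff ?mulr1 ?gt_eqF.
- exact: measurable_coarse.
- by move=> eta; exact: coarse_bound.
Qed.

Lemma integrable_coarse m r ka x :
  P.-integrable setT (EFin \o (fun w => Phi (coarse_euler m r ka%:R^-1 x (frozen_noise ka x w)))).
Proof.
apply: (integrable_functional P cPhi bPhi (Y := fun t w => coarse_euler m r ka%:R^-1 x (frozen_noise ka x w) t)).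
  by move=> w; exact: C0oo_lin.
move=> t _; apply: measurable_lin => j _; apply: measurable_euler => k _.
apply: measurable_funM => //; by apply: (measurable_inc Ff Bb); rewrite divr_ge0.
Qed.

Lemma history_sigma_algebra (h : R) k s : 0 < h -> s \in histories k ->
  process_sigma_algebra setT X (history X h k @^-1` [set s]).
Proof.
move=> h0 sk; rewrite (history_preimage X h i0 sk).
apply: (@bigcap_measurable _ (g_sigma_algebraType [set E | exists (t : R) (A : set 'I_d), [/\ 0 <= t, setT A & E = X t @^-1` A]])).
  by exists 0%N.
move=> j _; apply: sub_sigma_algebra; exists (j%:R * h), [set traj i0 s j]; split => //.
by rewrite mulr_ge0// ltW.
Qed.

Lemma noise_sigma_algebra m r ka x (A : set R) : (0 < ka)%N -> measurable A ->
  process_sigma_algebra measurable B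
    ((fun w => Phi (coarse_euler m r ka%:R^-1 x (frozen_noise ka x w))) @^-1` A).
Proof.
move=> ka0 mA.
set G := [set E | exists (t : R) (A : set R), [/\ 0 <= t, measurable A & E = B t @^-1` A]].
have mB (t : R) : 0 <= t -> measurable_fun setT (B t : g_sigma_algebraType G -> R).
  by move=> t0 _ C mC; rewrite setTI; apply: sub_sigma_algebra; exists t, C.
have mf k : (k < m * m * r)%N -> measurable_fun setT ((fun w => frozen_noise ka x w k) : g_sigma_algebraType G -> R).
  by move=> _; apply: measurable_funM => //; apply: measurable_funB; apply: mB; rewrite divr_ge0.
have := @measurable_to_path_space R (m * m * r) _ (g_sigma_algebraType G) (frozen_noise ka x) mf.
move=> /(measurableT_comp (measurable_coarse ka%:R^-1 x (leqnn _))) /(_ measurableT A mA).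
by rewrite setTI.
Qed.

Lemma euler_transfer m r ka n : (0 < ka)%N -> (m * m * r <= n)%N ->
  \int[P]_w Phi (lin m (fun j => grid_euler X B alpha gamma sigma m0 ka w (j * r))) =
  \sum_(s <- histories n) weight P X ka%:R^-1 n s *
    \int[P']_w Phi (coarse_euler m r ka%:R^-1 (traj i0 s) (clock_noise ka%:R^-1 (traj i0 s) w)).
Proof.
move=> ka0 mrn; have h0 : 0 < ka%:R^-1 :> R by rewrite invr_gt0 ltr0n.
have CX : forall (t : R) i, 0 <= t -> measurable (X t @^-1` [set i]) by case: mX.
rewrite (Rintegral_histories h0 mX n); last first.
  apply: (integrable_functional P cPhi bPhi (Y := fun t w => lin m (fun j => grid_euler X B alpha gamma sigma m0 ka w (j * r)) t)).
    by move=> w; exact: C0oo_lin.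
  by move=> t _; apply: measurable_lin => j _; exact: (measurable_grid_euler _ _ _ _ Ff Bb CX).
apply: eq_big_seq => s sn; set A := history _ _ _ @^-1` _.
have mA : measurable A by exact: (measurable_history h0 mX).
transitivity (\int[P]_w (\1_A w * Phi (coarse_euler m r ka%:R^-1 (traj i0 s) (frozen_noise ka (traj i0 s) w)))).
  apply: eq_Rintegral => w _; rewrite mulrC indicE.
  case: (boolP (w \in A)) => [|_]; last by rewrite !mul0r.
  rewrite inE => Aw; rewrite !mul1r; congr Phi; apply/funext => t; apply: eq_lin => j jm.
  have tE k : (k < j * r)%N -> X (k%:R / ka%:R) w = traj i0 s k.
    move=> kj; have -> : s = history X ka%:R^-1 n w by rewrite Aw.
    by rewrite traj_history// ltnW// (leq_trans kj)// (leq_trans _ mrn)// leq_mul2r jm orbT.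
  by apply: eq_euler => k kj; rewrite /grid_states /grid_noise /frozen_noise tE.
have [|||_ ->] := @indep_Rintegral R _ T P (\1_A) (fun w => Phi (coarse_euler m r ka%:R^-1 (traj i0 s) (frozen_noise ka (traj i0 s) w))).
- exact: integrable_indicP.
- exact: integrable_coarse.
- move=> C D mC mD; apply: XB; last exact: noise_sigma_algebra.
  have : @measurable _ (g_sigma_algebraType [set E | exists (t : R) (A : set 'I_d), [/\ 0 <= t, setT A & E = X t @^-1` A]]) A.
    exact: history_sigma_algebra.
  move=> /measurable_indic => /(_ R setT) /(_ measurableT C mC).
  by rewrite setTI.
by rewrite Rintegral_indicE// (frozen_noise_law _ ka0 mrn).
Qed.

End Transfer.

(** * Averaging *)

Section DeterministicLimit.
Context {R : realType}.
Local Notation leb := (@lebesgue_measure R).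

Lemma C0oo_measurable (x : R -> R) (S : R) : C0oo x -> measurable_fun (`[0, S] : set R) x.
Proof.
move=> /C0oo_max0 cx; apply: (@eq_measurable_fun _ _ _ _ _ (fun t : R => x (Num.max 0 t))).
  by move=> t; rewrite inE /= in_itv /= => /andP[t0 _]; rewrite max_r.
by apply: measurable_funTS; exact: continuous_measurable_fun.
Qed.

Lemma C0oo_integrable (x : R -> R) (S : R) : C0oo x ->
  leb.-integrable (`[0, S] : set R) (EFin \o x).
Proof.
move=> Cx; have [c xc] := C0oo_bounded S Cx.
apply: (@integrable_bounded _ (measurableTypeR R) R leb _ x c) => //.
- exact: lebesgue_itv_lty.
- exact: C0oo_measurable.
Qed.

Lemma riemann_C0oo (f : R -> R) (S : nat) (e : R) : C0oo f -> 0 < e ->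
  \forall ka \near \oo, forall k, (k <= S * ka)%N ->
   `|\int[leb]_(s in `[0, k%:R / ka%:R]) f s - ka%:R^-1 * \sum_(j < k) f (j%:R / ka%:R)| <= e.
Proof.
move=> Cf e0; have [c fc] := C0oo_bounded S%:R Cf.
have ae : {ae leb, forall s : R, 0 < s -> f u @[u --> s^'-] --> f s}.
  by apply: aeW => s; exact: C0oo_left.
have /fine_cvgP[_ /cvgrPdist_le /(_ _ e0) H] := cvg_step (C0oo_measurable Cf) fc ae.
near=> ka => k kn.
have ka0 : (0 < ka)%N by near: ka; exact: nbhs_infty_gt.
have SE : (S * ka)%:R / ka%:R = S%:R :> R by rewrite natrM mulfK// pnatr_eq0 -lt0n.
have iS := @C0oo_integrable f ((S * ka)%:R / ka%:R) Cf.
rewrite (le_trans (riemann_step ka0 kn iS))// SE.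
have : `|0 - fine (\int[leb]_(s in `[0%R, S%:R]) (`|f s - step ka (S * ka) f s|)%:E)%E| <= e.
  by near: ka.
by rewrite sub0r normrN; apply: le_trans; exact: ler_norm.
Unshelve. all: by end_near.
Qed.

Lemma clamp_lipschitz (u v : R) : `|clamp u - clamp v| <= `|u - v|.
Proof.
wlog uv : u v / u <= v.
  by move=> H; case/orP: (le_total u v) => uv; [exact: H|rewrite distrC [leRHS]distrC; exact: H].
rewrite distrC [leRHS]distrC !ger0_norm ?subr_ge0 ?clampS//.
have h3 : 0 <= 1 :> R by [].
rewrite /clamp; case: (leP u 0) => u0; case: (leP v 0) => v0; rewrite ?(min_l h3);
  case: (leP u 1) => h1; case: (leP v 1) => h2; lra.
Qed.

Lemma tent_lipschitz (u v : R) : `|tent u - tent v| <= 2 * `|u - v|.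
Proof.
have -> : tent u - tent v = (clamp (u + 1) - clamp (v + 1)) - (clamp u - clamp v) by rewrite /tent; ring.
rewrite (le_trans (ler_normB _ _))// mulrDl mul1r lerD ?clamp_lipschitz//.
by rewrite (le_trans (clamp_lipschitz _ _))// opprD addrACA subrr addr0.
Qed.

Lemma lin_lipschitz m (v : nat -> R) :
  exists2 K : R, 0 <= K & forall s t, `|lin m v s - lin m v t| <= K * `|s - t|.
Proof.
exists (\sum_(j < (m * m).+1) `|v j| * (2 * m%:R)).
  by rewrite sumr_ge0// => j _; rewrite mulr_ge0.
move=> s t; rewrite /lin -sumrB (le_trans (ler_norm_sum _ _ _))// mulr_suml.
apply: ler_sum => j _; rewrite -mulrBr normrM -mulrA ler_wpM2l//.
rewrite (le_trans (tent_lipschitz _ _))// -mulrA ler_wpM2l//.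
by rewrite opprB addrA subrK -mulrBr normrM ger0_norm.
Qed.

Lemma abel_bound (h delta D : R) (c L : nat -> R) n :
  (forall k, (k <= n)%N -> `|h * (\sum_(j < k) c j)| <= delta) ->
  (forall j, `|L j.+1 - L j| <= D) ->
  forall k, (k <= n)%N -> `|h * (\sum_(j < k) c j * L j)| <= delta * (`|L k| + k%:R * D).
Proof.
move=> A_le LD k kn; pose A k := h * (\sum_(j < k) c j).
have -> : h * (\sum_(j < k) c j * L j) = A k * L k - \sum_(j < k) A j.+1 * (L j.+1 - L j).
  elim: k {kn} => [|k IH]; first by rewrite /A !big_ord0 mulr0 mul0r subr0.
  rewrite big_ord_recr /= mulrDr IH [in RHS]big_ord_recr /= /A.
  by rewrite !(@big_ord_recr _ _ _ k) /=; ring.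
rewrite (le_trans (ler_normB _ _))// mulrDr lerD//.
  by rewrite normrM ler_wpM2r// A_le.
rewrite (le_trans (ler_norm_sum _ _ _))// mulrA.
rewrite (_ : delta * k%:R * D = \sum_(j < k) delta * D); last first.
  by rewrite sumr_const card_ord -[RHS]mulr_natr mulrAC.
by apply: ler_sum => j _; rewrite normrM ler_pM// A_le// (leq_trans (ltn_ord j)).
Qed.

(* A signal with small running sums is weakly small: against a Lipschitz function this is
   summation by parts, and a continuous one is uniformly close to an interpolant. *)
Lemma averaging (y : R -> R) (S C e : R) : C0oo y -> 0 <= S -> 0 <= C -> 0 < e ->
  exists2 delta, 0 < delta & forall (h : R) (c : nat -> R) n, 0 <= h -> n%:R * h <= S ->
    (forall j, `|c j| <= C) -> (forall k, (k <= n)%N -> `|h * (\sum_(j < k) c j)| <= delta) ->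
    forall k, (k <= n)%N -> `|h * (\sum_(j < k) c j * y (j%:R * h))| <= e.
Proof.
move=> Cy S0 C0 e0.
have SC : 0 < 2 * (S * C + 1) by rewrite mulr_gt0// ltr_pwDr// mulr_ge0.
(* Replacing [y] by its interpolant [L] costs at most [S * C * e2 <= e / 2]. Below, [D] bounds the
   final value of [L] plus its variation, so [delta * D = e / 2] is left for the summation by parts.
   Each [+ 1] keeps a denominator positive. *)
pose e2 := e / (2 * (S * C + 1)).
have e20 : 0 < e2 by rewrite divr_gt0.
have [m _ /(_ m (leqnn m)) Lm] := @lin_sample_cvg R y Cy S e2 e20.
move: Lm; set L := lin m.+1 _ => Lm.
have [K K0 LK] : exists2 K : R, 0 <= K & forall s t, `|L s - L t| <= K * `|s - t| by exact: lin_lipschitz.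
have [cL LcL] := @C0oo_bounded R L S (@C0oo_lin _ _ _).
pose D := `|cL| + S * K + 1.
have D0 : 0 < D by rewrite ltr_pwDr// addr_ge0// mulr_ge0.
exists (e / (2 * D)); first by rewrite divr_gt0// mulr_gt0.
move=> h c n h0 nh cC A_le k kn.
have jS j : (j <= n)%N -> 0 <= j%:R * h <= S.
  by move=> jn; rewrite mulr_ge0//= (le_trans _ nh)// ler_wpM2r// ler_nat.
have -> : h * (\sum_(j < k) c j * y (j%:R * h)) =
    h * (\sum_(j < k) c j * (y (j%:R * h) - L (j%:R * h))) + h * (\sum_(j < k) c j * L (j%:R * h)).
  by rewrite -mulrDr -big_split; congr (_ * _); apply: eq_bigr => j _ /=; ring.
rewrite (splitr e) (le_trans (ler_normD _ _))// lerD//.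
  rewrite normrM (ger0_norm h0).
  apply: (@le_trans _ _ (h * (\sum_(j < k) C * e2))).
    rewrite ler_wpM2l// (le_trans (ler_norm_sum _ _ _))//; apply: ler_sum => j _.
    rewrite normrM ler_pM// distrC; apply: Lm; apply: jS.
    exact: ltnW (leq_trans (ltn_ord j) kn).
  rewrite sumr_const card_ord -[X in h * X]mulr_natr (_ : h * (C * e2 * k%:R) = k%:R * h * C * e2); last by ring.
  apply: (@le_trans _ _ (S * C * e2)).
    by rewrite ler_wpM2r ?(ltW e20)// ler_wpM2r//; case/andP: (jS k kn).
  rewrite /e2 (_ : S * C * (e / (2 * (S * C + 1))) = e / 2 * (S * C / (S * C + 1))); last by rewrite invfM; ring.
  rewrite -[leRHS]mulr1 ler_wpM2l//; first by rewrite divr_ge0// ltW.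
  by rewrite ler_pdivrMr ?mul1r ?lerDl// ltr_pwDr// mulr_ge0.
have := @abel_bound h _ (K * h) c (fun j => L (j%:R * h)) n A_le _ k kn.
move=> /(_ _)/le_trans; apply.
  by move=> j; rewrite (le_trans (LK _ _))// -mulrBl -natr1 [_ + 1]addrC addrK mul1r ger0_norm.
rewrite (_ : e / (2 * D) * _ = e / 2 * ((`|L (k%:R * h)| + k%:R * (K * h)) / D)); last by rewrite invfM; ring.
rewrite -[leRHS]mulr1 ler_wpM2l//; first by rewrite divr_ge0// ltW.
rewrite ler_pdivrMr// mul1r /D -addrA lerD//.
  by rewrite (le_trans (LcL _ (jS k kn)))// ler_norm.
rewrite (_ : k%:R * (K * h) = k%:R * h * K); last by ring.
by rewrite (@le_trans _ _ (S * K)) ?lerDl// ler_wpM2r//; case/andP: (jS k kn).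
Qed.

End DeterministicLimit.

(** * Schemes along typical trajectories *)

Section AveragedDynamics.
Context {R : realType} {d : nat}.
Variables (alpha gamma sigma : 'cV[R]_d) (m0 a g s rho : R).
Local Notation leb := (@lebesgue_measure R).

Definition typical (S delta h : R) (x : nat -> 'I_d) : Prop :=
  [/\ ~ occupation_far (alpha - const_mx a) h S delta x,
      ~ occupation_far (gamma - const_mx g) h S delta x
    & ~ occupation_far (map_mx (fun u => u ^+ 2) sigma - const_mx (s ^+ 2)) h S delta x].

Lemma not_occupation_far (f : 'cV[R]_d) (h S S' delta delta' : R) x k :
  ~ occupation_far f h S' delta' x -> S <= S' -> delta' <= delta -> k%:R * h <= S ->
  `|h * (\sum_(j < k) f (x j) ord0)| <= delta.
Proof.
move=> far SS dd kh; rewrite leNgt; apply/negP => lt; apply: far; exists k.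
  exact: le_trans kh SS.
exact: le_lt_trans dd lt.
Qed.

(** Allows a trajectory typical for horizon [n] and tolerance [1 / (n + 1)] to be used at any fixed
    horizon and tolerance once [n] is large. *)
Lemma typicalS (h S S' delta delta' : R) x : S <= S' -> delta' <= delta ->
  typical S' delta' h x -> typical S delta h x.
Proof.
move=> SS dd [h1 h2 h3].
by split; (case=> k kh; apply/negP; rewrite -leNgt); [apply: (not_occupation_far h1 SS dd)|
  apply: (not_occupation_far h2 SS dd)|apply: (not_occupation_far h3 SS dd)].
Qed.

Lemma C0oo_affine (y : R -> R) : C0oo y -> C0oo (fun t => a - g * y t).
Proof.
move=> /C0oo_max0 cy; apply/C0oo_max0 => t; apply: cvgB; first exact: cvg_cst.
by apply: cvgM; [exact: cvg_cst|exact: cy].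
Qed.

Hypothesis rho0 : 0 < rho.
Hypothesis srho : s = rho \/ s = 0.

(** The residual splits into four errors, each at most [e / 4]: the Riemann sum of the averaged
    drift, the occupation sum of [alpha], that of [gamma] weighted by the path [y], and the change
    of clock in [b]. *)
Lemma residual_small (y b : R -> R) (S : nat) (e : R) : C0oo y -> C0oo b -> b 0 = 0 -> 0 < e ->
  exists2 delta, 0 < delta & exists k0, forall ka x, (k0 <= ka)%N -> (0 < ka)%N ->
    typical S%:R delta ka%:R^-1 x -> forall k, (k <= S * ka)%N ->
    `|(\int[leb]_(t in `[0, k%:R / ka%:R]) (a - g * y t) + s * b (k%:R / ka%:R)) -
      (ka%:R^-1 * (\sum_(j < k) (alpha (x j) ord0 - gamma (x j) ord0 * y (j%:R / ka%:R))) +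
       rho * b (clock sigma rho ka%:R^-1 x k))| <= e.
Proof.
move=> Cy Cb b00 e0.
have e40 : 0 < e / 4 by rewrite divr_gt0.
have [N _ HN] := riemann_C0oo S (C0oo_affine Cy) e40.
pose C := \sum_j `|gamma j ord0| + `|g|.
have C0 : 0 <= C by rewrite addr_ge0// sumr_ge0.
have [d3 d30 H3] := averaging Cy (ler0n R S) C0 e40.
have e4r : 0 < e / 4 / rho by rewrite divr_gt0.
have [d4 d40 H4] := C0oo_unif S%:R Cb e4r.
(* One entry each for [alpha], [gamma] and the clock. The factor [rho ^+ 2] undoes the normalisation
   of the clock, and the half yields the strict inequality demanded by uniform continuity. *)
exists (Num.min (e / 4) (Num.min d3 (d4 * rho ^+ 2 / 2))).
  by rewrite !lt_min e40 d30 !divr_gt0// mulr_gt0// exprn_gt0.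
exists N => ka x Nka ka0 [T1 T2 T3] k kn.
have h0 : 0 < ka%:R^-1 :> R by rewrite invr_gt0 ltr0n.
have kS j : (j <= S * ka)%N -> j%:R * ka%:R^-1 <= S%:R :> R.
  by move=> jn; rewrite ler_pdivrMr ?ltr0n// -natrM ler_nat.
have dmin := lexx (Num.min (e / 4) (Num.min d3 (d4 * rho ^+ 2 / 2))).
have [dm1 dm2 dm3] : [/\ Num.min (e / 4) (Num.min d3 (d4 * rho ^+ 2 / 2)) <= e / 4,
   Num.min (e / 4) (Num.min d3 (d4 * rho ^+ 2 / 2)) <= d3 &
   Num.min (e / 4) (Num.min d3 (d4 * rho ^+ 2 / 2)) <= d4 * rho ^+ 2 / 2].
  by move: dmin; rewrite {1}le_min => /andP[? ]; rewrite le_min => /andP[].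
have R1 := HN ka Nka k kn.
have R2 : `|ka%:R^-1 * (\sum_(j < k) (alpha (x j) ord0 - a))| <= e / 4.
  have := not_occupation_far T1 (lexx _) dm1 (kS k kn).
  by under eq_bigr do rewrite !mxE.
have R3 : `|ka%:R^-1 * (\sum_(j < k) (gamma (x j) ord0 - g) * y (j%:R / ka%:R))| <= e / 4.
  apply: (H3 ka%:R^-1 (fun j => gamma (x j) ord0 - g) (S * ka)%N (ltW h0) (kS _ (leqnn _)) _ _ k kn).
    move=> j; rewrite (le_trans (ler_normB _ _))// lerD2r.
    by rewrite (bigD1 (x j))//= lerDl sumr_ge0.
  move=> k' kn'; have := not_occupation_far T2 (lexx _) dm2 (kS k' kn').
  by under eq_bigr do rewrite !mxE.
have R4 : `|s * b (k%:R / ka%:R) - rho * b (clock sigma rho ka%:R^-1 x k)| <= e / 4.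
  (* The limiting speed of the clock: 1 when [s = rho], and 0 when [s = 0]. In the second case both
     sides of the identity vanish because [b 0 = 0]. *)
  pose th := s ^+ 2 / rho ^+ 2.
  have [th0 th1] : 0 <= th <= 1 /\ s * b (k%:R / ka%:R) = rho * b (th * (k%:R / ka%:R)).
    rewrite /th; case: srho => ->.
      by rewrite divff ?mul1r ?lexx ?ler01// expf_eq0 gt_eqF.
    by rewrite expr0n /= !mul0r b00 mulr0 lexx ler01.
  rewrite th1 -mulrBr normrM (gtr0_norm rho0) mulrC -ler_pdivlMr//; apply: ltW.
  have t0 : 0 <= k%:R / ka%:R :> R by rewrite divr_ge0.
  apply: H4; last 1 first.
  - have -> : th * (k%:R / ka%:R) - clock sigma rho ka%:R^-1 x k =
       - (ka%:R^-1 * (\sum_(j < k) ((sigma (x j) ord0) ^+ 2 - s ^+ 2))) / rho ^+ 2.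
      by rewrite sumrB sumr_const card_ord /th /clock -[s ^+ 2 *+ k]mulr_natr; ring.
    rewrite normrM normrN normfV (ger0_norm (exprn_ge0 2 (ltW rho0))) ltr_pdivrMr ?exprn_gt0//.
    have := not_occupation_far T3 (lexx _) dm3 (kS k kn).
    under eq_bigr do rewrite !mxE.
    move=> /le_lt_trans; apply; rewrite ltr_pdivrMr// mulrDr mulr1 ltrDl.
    by rewrite mulr_gt0// exprn_gt0.
  - case/andP: th0 => h1 h2; rewrite mulr_ge0//= (le_trans _ (kS k kn))// ler_piMl//.
  - by apply: clock_ge0; [exact: rho0|exact: ltW].
move: R1 R2 R3 R4.
set I := \int[_]_(_ in _) _; set A := ka%:R^-1 * \sum_(j < k) (alpha _ _ - a).
set D := ka%:R^-1 * \sum_(j < k) (gamma _ _ - g) * _; set U := s * _; set V := rho * _.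
set F := ka%:R^-1 * _; set W := ka%:R^-1 * _ => R1 R2 R3 R4.
have -> : I + U - (W + V) = (I - F) - A + D + (U - V).
  rewrite (_ : W = F + A - D); first by ring.
  rewrite /W /F /A /D -mulrDr -mulrBr -big_split -sumrB /=; congr (_ * _).
  by apply: eq_bigr => j _; ring.
rewrite (_ : e = e / 4 + e / 4 + e / 4 + e / 4); last by field.
rewrite (le_trans (ler_normD _ _))// lerD// (le_trans (ler_normD _ _))// lerD//.
by rewrite (le_trans (ler_normB _ _))// lerD.
Qed.

(** A statement about fixed paths: [y] and [b] are one outcome of the limit process and of its
    Brownian motion. The noise telescopes to [rho * b (clock)], so [residual_small] bounds the
    residuals and [euler_error] applies with no stochastic part. *)
Lemma euler_limit (y b : R -> R) (mm rr : nat -> nat) (xx : nat -> nat -> 'I_d) :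
  C0oo y -> C0oo b -> b 0 = 0 ->
  (forall ka k, y (k%:R / ka.+1%:R) =
     m0 + \int[leb]_(t in `[0, k%:R / ka.+1%:R]) (a - g * y t) + s * b (k%:R / ka.+1%:R)) ->
  (forall n, (n < mm n)%N) -> (forall n, (0 < rr n)%N) ->
  (forall n, typical n%:R n.+1%:R^-1 (mm n * rr n)%:R^-1 (xx n)) ->
  ucc_cvg (fun n => coarse_euler alpha gamma m0 (mm n) (rr n) (mm n * rr n)%:R^-1 (xx n)
     (fun k => rho * (b (clock sigma rho (mm n * rr n)%:R^-1 (xx n) k.+1) -
                      b (clock sigma rho (mm n * rr n)%:R^-1 (xx n) k)))) y.
Proof.
move=> Cy Cb b00 yE mn r0 typ; apply: ucc_cvg_lin => // T e e0.
have [S TS] : exists S : nat, T <= S%:R.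
  exists (Num.bound `|T|); apply: ltW; exact: le_lt_trans (ler_norm _) (archi_boundP (normr_ge0 _)).
pose G : R := \sum_j `|gamma j ord0|.
have G0 : 0 <= G by exact: sumr_ge0.
pose K := 1 + G * expR (S%:R * G) * (S%:R + 1).
have K0 : 0 < K by rewrite ltr_pwDl// !mulr_ge0 ?expR_ge0 ?addr_ge0.
(* Two shares, for the residual and for the threshold of [euler_error]; the term [J / eta] is 0
   here. *)
pose eta := e / (2 * K).
have eta0 : 0 < eta by rewrite divr_gt0// mulr_gt0.
have [delta delta0 [k0 Hk]] := residual_small S Cy Cb b00 eta0.
near=> n => j jm jT.
have nS : (S <= n)%N by near: n; exact: nbhs_infty_ge.
have nk : (k0 <= n)%N by near: n; exact: nbhs_infty_ge.
have nd : n.+1%:R^-1 <= delta.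
  by apply: ltW; near: n; exact: near_infty_natSinv_lt (PosNum delta0).
set ka := (mm n * rr n)%N.
have nka : (n < ka)%N by rewrite (leq_trans (mn n))// leq_pmulr.
have ka0 : (0 < ka)%N by exact: leq_ltn_trans nka.
have kaP : ka = ka.-1.+1 by rewrite prednK.
have m_gt0 : (0 < mm n)%N by exact: leq_ltn_trans (mn n).
have typn : typical S%:R delta ka%:R^-1 (xx n).
  by apply: typicalS (typ n) => //; rewrite ler_nat.
have hn : ka%:R^-1 * (S * ka)%:R = S%:R :> R.
  by rewrite (natrM _ S ka) mulrC mulfK// pnatr_eq0 -lt0n.
have jr : (j * rr n <= S * ka)%N.
  have : (j <= S * mm n)%N.
    rewrite -(ler_nat R) natrM -ler_pdivrMr ?ltr0n//; exact: le_trans jT TS.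
  by rewrite /ka mulnA leq_mul2r => ->; rewrite orbT.
pose yy k := y (k%:R / ka%:R).
have -> : y (j%:R / (mm n)%:R) = yy (j * rr n)%N.
  rewrite /yy /ka !natrM invfM mulrACA divff ?mulr1// pnatr_eq0 -lt0n//.
apply: (@le_trans _ _ (K * (eta + eta + 0 / eta))); last first.
  rewrite (_ : K * _ = e)// mul0r addr0 /eta; field.
  by rewrite gt_eqF.
rewrite /K -hn.
set no := fun k => rho * _.
apply: (@euler_error R d alpha gamma m0 ka%:R^-1 G eta eta 0 (xx n) no yy
   (fun k => yy k - (m0 + ka%:R^-1 * (\sum_(i < k) (alpha (xx n i) ord0 - gamma (xx n i) ord0 * yy i)) +
      \sum_(i < k) no i)) (fun=> 0) (S * ka) (j * rr n)) => //.
- exact: ltW.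
- by move=> i; rewrite /G (bigD1 i)//= lerDl sumr_ge0.
- by move=> k _; ring.
- move=> k kn; rewrite normr0 addr0.
  have -> : \sum_(i < k) no i = rho * b (clock sigma rho ka%:R^-1 (xx n) k).
    rewrite -mulr_sumr; congr (_ * _).
    elim: {kn} k => [|k IH]; first by rewrite big_ord0 clock0 b00.
    by rewrite big_ord_recr /= IH; ring.
  have := Hk ka (xx n) (leq_trans nk (ltnW nka)) ka0 typn k kn.
  rewrite {1}/yy kaP yE -kaP; apply: le_trans; rewrite le_eqVlt; apply/orP; left; apply/eqP; congr (`|_|).
  by rewrite /yy; ring.
- by rewrite big1 ?mulr0 ?addr0 ?expr0n// => i _; rewrite expr0n.
Unshelve. all: by end_near.
Qed.

End AveragedDynamics.

Section OuEquation.
Context {R : realType} disp (T : measurableType disp) (P : probability T R).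
Variables (F : R -> set (set T)) (B M : R -> T -> R) (a g s m0 : R).
Hypothesis Ff : filtration F.
Hypothesis Bb : brownian_motion P F B.
Local Notation leb := (@lebesgue_measure R).
Hypothesis sde : sde_solution P F B (fun t w => a - g * M t w) (fun _ _ => s) m0 M.

(** A constant integrand equals the single block from 0 to [t] except at the null time 0, so
    [ito_dist] makes the mean square distance to [s * B t] vanish. *)
Lemma ito_constant (t : R) (I : T -> R) : 0 <= t -> ito_integral P F B (fun _ _ => s) t I ->
  {ae P, forall w, I w = s * B t w}.
Proof.
move=> t0 HI; have [aH _ mI _] := HI.
have B0 w : B 0 w = 0 by case: Bb.
have gb : good_blocks F [:: (0, t, fun=> s) : @block R disp T].
  move=> x [<-|//]; split => //=; first by move=> A mA; exact: aH.
  by exists `|s|.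
have mBt : measurable_fun setT (B t).
  by apply: (meas_wrt_measurable (G := F t)); [case: Ff => /(_ t t0)[]|case: Bb => aB _ _ _ A mA; exact: aB].
have mf : measurable_fun setT (fun w => ((I w - s * B t w) ^+ 2)%:E).
  by apply/measurable_EFinP; apply: measurable_funX; apply: measurable_funB => //; exact: measurable_funM.
have : (\int[P]_w ((I w - s * B t w) ^+ 2)%:E <= 0)%E.
  have := ito_dist Ff Bb t0 HI gb.
  rewrite (_ : (\int[P]_w _)%E = (\int[P]_w ((I w - s * B t w) ^+ 2)%:E)%E); last first.
    apply: eq_integral => w _; rewrite /sum_inc big_seq1 /block_inc /= min_l// minxx /inc B0 subr0//.
  rewrite (_ : (\int[P]_w (\int[_]_(_ in _) _))%E = 0%E) ?mule0//.
  rewrite (eq_integral (fun=> 0%E)) ?integral0// => w _.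
  have [->|tn0] := eqVneq t 0.
    by rewrite set_itv1 integral_set1.
  rewrite -integral_itv_obnd_cbnd; last first.
    apply/measurable_EFinP; apply: measurable_funX; apply: measurable_funB => //.
    apply: measurable_sum => x; apply: measurable_funM => //; exact: measurable_inoc.
  rewrite (eq_integral (fun=> 0%E)) ?integral0// => u; rewrite inE /= in_itv /= => ut.
  by rewrite /sum_val big_seq1 /block_val /inoc /= ut mulr1 subrr expr0n.
move=> int0; have [H _] := @ae_eq_integral_abs _ _ _ P setT measurableT _ mf.
case: (H _) => [|N [mN N0 sN]].
  apply/eqP; rewrite eq_le integral_ge0 // andbT (le_trans _ int0)//.
  by under eq_integral do rewrite gee0_abs ?lee_fin ?sqr_ge0//.
exists N; split => //; apply: subset_trans sN; apply: subsetC => w /= /(_ Logic.I) [] /eqP.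
by rewrite sqrf_eq0 subr_eq0 => /eqP.
Qed.

Lemma ou_equation (t : R) : 0 <= t -> {ae P, forall w,
  M t w = m0 + \int[leb]_(u in `[0, t]) (a - g * M u w) + s * B t w}.
Proof.
move=> t0; case: sde => _ _ /(_ t t0)[_ [I HI MI]].
by apply: (@filterS2 _ _ (ae_filter_ringOfSetsType P) _ _ _ _ MI (ito_constant t0 HI)) => w -> ->.
Qed.

End OuEquation.

Section UniformLimit.
Local Notation leb := lebesgue_measure.
Context {R : realType} {d : nat} disp (T : measurableType disp) (P : probability T R).
Variables (alpha gamma sigma : 'cV[R]_d) (m0 a g s rho : R).
Variables (F : R -> set (set T)) (B M : R -> T -> R).
Hypothesis Ff : filtration F.
Hypothesis Bb : brownian_motion P F B.
Hypothesis sde : sde_solution P F B (fun t w => a - g * M t w) (fun _ _ => s) m0 M.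
Hypothesis rho0 : 0 < rho.
Hypothesis srho : s = rho \/ s = 0.
Variables (Phi : ucc_paths R -> R) (c : R).
Hypothesis cPhi : {within (C0oo : set (ucc_paths R)), continuous Phi}.
Hypothesis bPhi : forall x, C0oo x -> `|Phi x| <= c.

(* By contradiction: along a sequence of typical trajectories the schemes converge almost surely. *)
Lemma uniform_limit (eps : R) : 0 < eps -> exists n, forall m r (x : nat -> 'I_d),
  (n < m)%N -> (0 < r)%N ->
  typical alpha gamma sigma a g s n%:R n.+1%:R^-1 (m * r)%:R^-1 x ->
  `|\int[P]_w Phi (coarse_euler alpha gamma m0 m r (m * r)%:R^-1 x
      (clock_noise sigma B rho (m * r)%:R^-1 x w)) - \int[P]_w Phi (M ^~ w)| <= eps.
Proof.
move=> eps0; apply: contrapT => /forallNP bad.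
(* [z n] packs a coarse grid, a refinement and a trajectory violating the bound. Since the horizon
   [n] and the tolerance [1 / (n + 1)] improve along the sequence, it is eventually typical at every
   fixed scale, as [euler_limit] expects. *)
have [z zP] : {z : nat -> nat * nat * (nat -> 'I_d) & forall n, [/\ (n < (z n).1.1)%N, (0 < (z n).1.2)%N,
   typical alpha gamma sigma a g s n%:R n.+1%:R^-1 ((z n).1.1 * (z n).1.2)%:R^-1 (z n).2 &
   eps < `|\int[P]_w Phi (coarse_euler alpha gamma m0 (z n).1.1 (z n).1.2 ((z n).1.1 * (z n).1.2)%:R^-1 (z n).2
      (clock_noise sigma B rho ((z n).1.1 * (z n).1.2)%:R^-1 (z n).2 w)) - \int[P]_w Phi (M ^~ w)|]}.
  apply: (@choice _ _ (fun n z => [/\ (n < z.1.1)%N, (0 < z.1.2)%N,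
   typical alpha gamma sigma a g s n%:R n.+1%:R^-1 (z.1.1 * z.1.2)%:R^-1 z.2 &
   eps < `|\int[P]_w Phi (coarse_euler alpha gamma m0 z.1.1 z.1.2 (z.1.1 * z.1.2)%:R^-1 z.2
      (clock_noise sigma B rho (z.1.1 * z.1.2)%:R^-1 z.2 w)) - \int[P]_w Phi (M ^~ w)|])) => n.
  apply: contrapT => /forallNP H; apply: (bad n) => m r x nm r0 tx.
  rewrite leNgt; apply/negP => lt; apply: (H (m, r, x)); split => //.
pose h n : R := ((z n).1.1 * (z n).1.2)%:R^-1.
have h0 n : 0 <= h n by rewrite invr_ge0.
pose Y n t w := coarse_euler alpha gamma m0 (z n).1.1 (z n).1.2 (h n) (z n).2 (clock_noise sigma B rho (h n) (z n).2 w) t.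
have eqM : {ae P, forall w, forall ka k, M (k%:R / ka.+1%:R) w =
    m0 + \int[leb]_(t in `[0, k%:R / ka.+1%:R]) (a - g * M t w) + s * B (k%:R / ka.+1%:R) w}.
  apply/ae_foralln => ka; apply/ae_foralln => k; apply: (ou_equation Ff Bb sde).
  by rewrite divr_ge0.
have : \int[P]_w Phi (Y n ^~ w) @[n --> \oo] --> \int[P]_w Phi (M ^~ w).
  apply: (cvg_expectation cPhi bPhi).
  - by move=> n w; exact: C0oo_lin.
  - move=> n t _; apply: measurable_lin => j _; apply: measurable_euler => k _.
    exact: (measurable_clock_noise sigma Ff Bb rho0).
  - exact: (C0oo_solution sde).
  - exact: (measurable_solution Ff sde).
  case: eqM => N [mN N0 sN]; exists N; split => //; apply: subset_trans sN.
  apply: subsetC => w /= eqw.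
  apply: (@euler_limit _ _ alpha gamma sigma m0 a g s rho rho0 srho (M ^~ w) (B ^~ w)
    (fun n => (z n).1.1) (fun n => (z n).1.2) (fun n => (z n).2)) => //.
  - exact: (C0oo_solution sde).
  - by case: Bb.
  - by case: Bb.
  - by move=> n; case: (zP n).
  - by move=> n; case: (zP n).
  - by move=> n; case: (zP n).
move=> /cvgrPdist_le /(_ eps eps0) [n _ /(_ n (leqnn n))].
by case: (zP n) => _ _ _; rewrite distrC => lt /(lt_le_trans lt); rewrite ltxx.
Qed.

End UniformLimit.

Section Averaging.
Context {R : realType} {d : nat}.

Lemma sum_weight_le disp (T : measurableType disp) (P : probability T R) (X : R -> T -> 'I_d)
    (h : R) (Q : 'M[R]_d) n (A : set T) (p : pred (seq 'I_d)) : 0 < h -> markov_chain P Q X ->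
  measurable A -> (forall w, p (history X h n w) -> A w) ->
  \sum_(s <- histories n | p s) weight P X h n s <= fine (P A).
Proof.
move=> h0 mX mA pA; rewrite (probability_histories h0 mX n mA) big_mkcond /=.
apply: ler_sum => s _; case: ifP => ps; last exact: fine_ge0.
rewrite /weight le_eqVlt; apply/orP; left; apply/eqP; congr (fine (P _)).
by apply/seteqP; split => w /=; [move=> hw; split => //; apply: pA; rewrite hw|case].
Qed.

(** A finite history determines the occupation event because the horizon [S] is reached within its
    [n] steps. *)
Lemma occupation_far_prefix (f : 'cV[R]_d) (h S delta : R) (x x' : nat -> 'I_d) n :
  (forall k, k%:R * h <= S -> (k <= n)%N) -> (forall j, (j <= n)%N -> x j = x' j) ->
  occupation_far f h S delta x -> occupation_far f h S delta x'.
Proof.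
move=> Sn xx [k kS lt]; exists k => //; move: lt; congr (_ < `|_ * _|).
by apply: eq_bigr => j _; rewrite xx// (leq_trans (ltnW (ltn_ord j)))// Sn.
Qed.

Lemma dotp_centred (p u : 'cV[R]_d) : dotp (const_mx 1) p = 1 -> dotp p (u - const_mx (dotp p u)) = 0.
Proof.
move=> p1; have E k : dotp p (u - const_mx k) = dotp p u - k * dotp (const_mx 1) p.
  by rewrite /dotp !mxE mulr_sumr -sumrB; apply: eq_bigr => i _; rewrite !mxE mul1r; ring.
by rewrite E p1 mulr1 subrr.
Qed.

End Averaging.

(** * Convergence *)

Section Convergence.
Context {R : realType} {d : nat}.
Variables (Q : 'M[R]_d) (pi : 'cV[R]_d) (alpha gamma sigma : 'cV[R]_d) (m0 : R).
Hypothesis Qgen : generator Q.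
Hypothesis pinv : unique_invariant_distribution Q pi.
Let a := dotp pi alpha.
Let g := dotp pi gamma.
Let s := Num.sqrt (dotp pi (map_mx (fun x => x ^+ 2) sigma)).

Lemma state_exists : 'I_d.
Proof.
case: (posnP d) => [d0|dpos]; last exact: (Ordinal dpos).
have := pinv.1; case=> _ _; rewrite /dotp mxE big1 => [/eqP|i _].
  by rewrite eq_sym oner_eq0.
by have := ltn_ord i; rewrite [X in (_ < X)%N]d0.
Qed.

Lemma sqr_sigma_oo : s ^+ 2 = dotp pi (map_mx (fun x => x ^+ 2) sigma).
Proof.
rewrite sqr_sqrtr// /dotp mxE sumr_ge0// => i _; rewrite !mxE mulr_ge0 ?sqr_ge0//.
by case: pinv => -[].
Qed.

(** [N0] is fixed before the mesh, the probability space and the length of the histories, because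
    the mesh will be selected only once [N] and its space are given. *)
Lemma typical_tail (S delta eps : R) : 0 <= S -> 0 < delta -> 0 < eps ->
  exists N0, forall (N : nat) (h : R) disp (T : measurableType disp) (P : probability T R)
    (X : R -> T -> 'I_d) i0 n, (N0 <= N)%N -> (0 < N)%N -> 0 < h -> h * N%:R ^+ 3 <= 1 ->
    (forall k, k%:R * h <= S -> (k <= n)%N) ->
    markov_chain P (N%:R *: Q) X ->
    \sum_(x <- histories n | ~~ `[< typical alpha gamma sigma a g s S delta h (traj i0 x) >])
      weight P X h n x <= eps.
Proof.
move=> S0 delta0 eps0; have e3 : 0 < eps / 3 by rewrite divr_gt0.
have p1 : dotp (const_mx 1) pi = 1 by case: pinv => -[].
have [N1 H1] := occupation_tail Qgen pinv (dotp_centred alpha p1) S0 delta0 e3.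
have [N2 H2] := occupation_tail Qgen pinv (dotp_centred gamma p1) S0 delta0 e3.
have [N3 H3] := occupation_tail Qgen pinv (dotp_centred (map_mx (fun x => x ^+ 2) sigma) p1) S0 delta0 e3.
exists (maxn N1 (maxn N2 N3)) => N h disp T P X i0 n; rewrite !geq_max => /and3P[N1N N2N N3N] N0 h0 hN Sn mX.
have [mA1 A1] := H1 N h disp T P X N1N N0 h0 hN mX.
have [mA2 A2] := H2 N h disp T P X N2N N0 h0 hN mX.
have [mA3 A3] := H3 N h disp T P X N3N N0 h0 hN mX.
move: mA1 A1 mA2 A2 mA3 A3.
set A1 := [set w | _]; set A2 := [set w | _]; set A3 := [set w | _] => mA1 PA1 mA2 PA2 mA3 PA3.
have mA : measurable (A1 `|` A2 `|` A3) by apply: measurableU => //; exact: measurableU.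
have E w j : (j <= n)%N -> traj i0 (history X h n w) j = X (j%:R * h) w by exact: traj_history.
apply: (le_trans (sum_weight_le h0 mX mA _)).
  move=> w /asboolPn nt; apply: contrapT => /= /not_orP[/not_orP[f1 f2] f3]; apply: nt; split.
  - by apply: contra_not f1; exact: (occupation_far_prefix Sn (E w)).
  - by apply: contra_not f2; exact: (occupation_far_prefix Sn (E w)).
  - by apply: contra_not f3; rewrite sqr_sigma_oo; exact: (occupation_far_prefix Sn (E w)).
apply: (@le_trans _ _ (fine (P A1) + fine (P A2) + fine (P A3))).
  rewrite -!fineD ?fin_numD ?fin_num_measure// fine_le ?fin_numD ?fin_num_measure//.
  rewrite (le_trans (measureU2 _ _ _))//; first exact: measurableU.
  by rewrite leeD2r// measureU2.
rewrite (_ : eps = eps / 3 + eps / 3 + eps / 3); last by field.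
by rewrite !lerD.
Qed.

Variables (disp' : measure_display) (T' : measurableType disp').
Variables (P' : probability T' R) (B' M1 : R -> T' -> R).
Hypothesis ou : ou_process P' B' a g s m0 M1.
Variables (Phi : ucc_paths R -> R) (c : R).
Hypothesis cPhi : {within (C0oo : set (ucc_paths R)), continuous Phi}.
Hypothesis bPhi : forall x, C0oo x -> `|Phi x| <= c.

(** The order of choices matters: [n0] depends on the limit process alone, [N0] on [n0], then [m] on
    the given [N], and [r] on [m] and [N]. The four shares [eps / 4] go to interpolation, the Euler
    scheme, the typical and the atypical trajectories. *)
Lemma expectation_limit (eps : R) : 0 < eps ->
  exists N0, forall (N : nat) disp (T : measurableType disp) (P : probability T R)
    (X : R -> T -> 'I_d) (B M : R -> T -> R), (N0 <= N)%N -> (0 < N)%N ->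
    markov_chain P (N%:R *: Q) X -> independent_processes P X B ->
    mmou_process P X B alpha gamma sigma m0 M ->
    `|\int[P]_w Phi (M ^~ w) - \int[P']_w Phi (M1 ^~ w)| <= eps.
Proof.
move=> eps0; have [F' [Ff' Bb' sde']] := ou.
(* If [s = 0] the clock stays close to 0 and any positive [rho] will do. *)
pose rho := if s == 0 then 1 else s.
have s0 : 0 <= s by exact: sqrtr_ge0.
have rho0 : 0 < rho.
  by rewrite /rho; case: eqVneq => // sn; rewrite lt_neqAle eq_sym sn.
have srho : s = rho \/ s = 0 by rewrite /rho; case: eqVneq => ?; [right|left].
have c0 : 0 <= c.
  have C0 : C0oo (fun=> 0 : R) by apply: C0oo_continuous => t; exact: cvg_cst.
  by rewrite (le_trans _ (bPhi C0)).
have e4 : 0 < eps / 4 by rewrite divr_gt0.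
have [n0 Hn0] := uniform_limit alpha gamma sigma Ff' Bb' sde' rho0 srho cPhi bPhi e4.
(* On an atypical trajectory the two expectations differ by at most [2 * c]; the [+ 1] covers
   [c = 0]. *)
have e8 : 0 < eps / 4 / (2 * c + 1) by rewrite divr_gt0// ltr_pwDr// mulr_ge0.
have d0 : 0 < n0.+1%:R^-1 :> R by rewrite invr_gt0.
have [N0 HN0] := typical_tail (ler0n R n0) d0 e8.
exists N0 => N disp T P X B M N0N N_gt0 mX XB [F [Ff Bb aX sde]].
have Xcad : forall w, cadlag_steps (X ^~ w) by case: mX.
have mXt : forall (t : R) i, 0 <= t -> measurable (X t @^-1` [set i]) by case: mX.
have CM : forall w, C0oo (M ^~ w) by case: sde.
have mM : forall t : R, 0 <= t -> measurable_fun setT (M t) by move=> t; exact: (measurable_solution Ff sde).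
have i0 := state_exists.
set E' := \int[P']_w _.
have [m nm E1] : exists2 m, (n0 < m)%N &
    `|\int[P]_w Phi (M ^~ w) - \int[P]_w Phi (lin m (fun j => M (j%:R / m%:R) w))| <= eps / 4.
  have : \int[P]_w Phi (lin m.+1 (fun j => M (j%:R / m.+1%:R) w)) @[m --> \oo] --> \int[P]_w Phi (M ^~ w).
    apply: (cvg_expectation cPhi bPhi (Y := fun m t w => lin m.+1 (fun j => M (j%:R / m.+1%:R) w) t)) => //.
    - by move=> m w; exact: C0oo_lin.
    - by move=> m t _; apply: measurable_lin => j _; apply: mM; rewrite divr_ge0.
    - by apply: aeW => w; apply: lin_sample_cvg; exact: CM.
  move=> /cvgrPdist_le /(_ _ e4) [k _ Hk]; exists (maxn n0 k).+1; first by rewrite ltnS leq_maxl.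
  by apply: Hk => /=; exact: leq_maxr.
have m_gt0 : (0 < m)%N by exact: leq_ltn_trans nm.
(* Asking [N ^ 3 < r] ensures [h * N ^ 3 <= 1] for the mesh [h = 1 / (m * r)]. *)
have [r rN E2] := euler_approximation Ff Bb Xcad mXt sde cPhi bPhi (N ^ 3) m_gt0 e4.
have r0 : (0 < r)%N by exact: leq_ltn_trans rN.
pose ka := (m * r)%N; have ka0 : (0 < ka)%N by rewrite muln_gt0 m_gt0.
have h0 : 0 < ka%:R^-1 :> R by rewrite invr_gt0 ltr0n.
(* Number of fine steps up to time [m]: it contains all [m * m * r] steps read by the interpolant,
   and since [n0 < m] it also covers the horizon [n0] of the typical trajectories. *)
pose n := (m * ka)%N.
have mrn : (m * m * r <= n)%N by rewrite /n /ka mulnA.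
move: E2; rewrite (euler_transfer alpha gamma sigma m0 Ff Bb mX XB Ff' Bb' cPhi bPhi i0 rho0 ka0 mrn).
pose Es x := \int[P']_w Phi (coarse_euler alpha gamma m0 m r ka%:R^-1 (traj i0 x)
  (clock_noise sigma B' rho ka%:R^-1 (traj i0 x) w)).
pose Sum := \sum_(x <- histories n) weight P X ka%:R^-1 n x * Es x.
rewrite -/Sum => E2.
have wt0 x : 0 <= weight P X ka%:R^-1 n x by exact: fine_ge0.
have wt1 : \sum_(x <- histories n) weight P X ka%:R^-1 n x = 1.
  have := probability_histories h0 mX n measurableT; rewrite probability_setT /= => E; rewrite [RHS]E.
  by apply: eq_bigr => x _; rewrite setTI.
have intc disp1 (T1 : measurableType disp1) (P1 : probability T1 R) (Y : R -> T1 -> R) :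
    (forall w, C0oo (Y ^~ w)) -> (forall t : R, 0 <= t -> measurable_fun setT (Y t)) ->
    `|\int[P1]_w Phi (Y ^~ w)| <= c.
  move=> CY mY; have iY := integrable_functional P1 cPhi bPhi CY mY.
  rewrite (le_trans (le_normr_Rintegral _ iY))// /Rintegral -[leRHS]/(fine c%:E) fine_le//.
    by apply: integrable_fin_num => //; exact: (integrable_abse iY).
  apply: (@le_trans _ _ (\int[P1]_w (cst c%:E w))%E); last first.
    by rewrite (integral_cst P1 measurableT c%:E) -[leRHS]mule1 lee_wpmul2l//; exact: (@probability_le1 _ _ _ P1).
  apply: ge0_le_integral => //.
  - by apply/measurable_EFinP; apply: measurableT_comp => //; exact: (measurable_functional cPhi CY mY).
  - by move=> w _; rewrite lee_fin bPhi.
have cE' : `|E'| <= c.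
  by apply: intc; [exact: (C0oo_solution sde')|exact: (measurable_solution Ff' sde')].
have cEs x : `|Es x| <= c.
  apply: (intc _ _ _ (fun t w => coarse_euler alpha gamma m0 m r ka%:R^-1 (traj i0 x) (clock_noise sigma B' rho ka%:R^-1 (traj i0 x) w) t)).
    by move=> w; exact: C0oo_lin.
  move=> t _; apply: measurable_lin => j _; apply: measurable_euler => k _.
  by apply: (measurable_clock_noise sigma Ff' Bb' rho0); exact: ltW.
pose typ x := `[< typical alpha gamma sigma a g s n0%:R n0.+1%:R^-1 ka%:R^-1 (traj i0 x) >].
have E3 : `|Sum - E'| <= eps / 4 + eps / 4.
  have -> : Sum - E' = \sum_(x <- histories n) weight P X ka%:R^-1 n x * (Es x - E').
    have e1 : E' = \sum_(x <- histories n) weight P X ka%:R^-1 n x * E'.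
      by rewrite -mulr_suml wt1 mul1r.
    by rewrite {1}e1 -sumrB; apply: eq_bigr => x _; rewrite mulrBr.
  rewrite (bigID typ) /= (le_trans (ler_normD _ _))// lerD//.
    apply: (@le_trans _ _ (\sum_(x <- histories n) weight P X ka%:R^-1 n x * (eps / 4))); last first.
      by rewrite -mulr_suml wt1 mul1r.
    rewrite (le_trans (ler_norm_sum _ _ _))// big_mkcond /=; apply: ler_sum => x _.
    case: ifP => [/asboolP tx|_]; last by rewrite mulr_ge0// ltW.
    by rewrite normrM (ger0_norm (wt0 _)) ler_wpM2l// Hn0.
  apply: (@le_trans _ _ (\sum_(x <- histories n | ~~ typ x) weight P X ka%:R^-1 n x * (2 * c + 1))).
    rewrite (le_trans (ler_norm_sum _ _ _))//; apply: ler_sum => x _.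
    rewrite normrM (ger0_norm (wt0 _)) ler_wpM2l// (le_trans (ler_normB _ _))//.
    by rewrite (le_trans (lerD (cEs x) cE'))//; lra.
  rewrite -mulr_suml -ler_pdivlMr ?ltr_pwDr ?mulr_ge0//.
  apply: (HN0 N) => //.
    rewrite -natrX ler_pdivrMl ?ltr0n// mulr1 ler_nat (leq_trans (ltnW rN))//.
    by rewrite /ka leq_pmull.
  move=> k; rewrite ler_pdivrMr ?ltr0n// -natrM ler_nat => /leq_trans; apply.
  by rewrite /n leq_mul2r (ltnW nm) orbT.
have -> : \int[P]_w Phi (M ^~ w) - E' = 
   (\int[P]_w Phi (M ^~ w) - \int[P]_w Phi (lin m (fun j => M (j%:R / m%:R) w))) +
   (\int[P]_w Phi (lin m (fun j => M (j%:R / m%:R) w)) - Sum) + (Sum - E') by ring.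
rewrite (_ : eps = eps / 4 + eps / 4 + (eps / 4 + eps / 4)); last by field.
by rewrite (le_trans (ler_normD _ _))// lerD// (le_trans (ler_normD _ _))// lerD.
Qed.

End Convergence.

Theorem corollary5p2 (R : realType) (d : nat)
    (Q : 'M[R]_d) (pi : 'cV[R]_d) (p0 : 'I_d -> R)
    (alpha gamma sigma : 'cV[R]_d) (m0 : R)
    (disp : nat -> measure_display) (T : forall N, measurableType (disp N))
    (P : forall N, probability (T N) R)
    (X : forall N, R -> T N -> 'I_d) (B : forall N, R -> T N -> R)
    (M : forall N, R -> T N -> R)
    (disp' : measure_display) (T' : measurableType disp')
    (P' : probability T' R) (B' M1 : R -> T' -> R) :
  generator Q ->
  unique_invariant_distribution Q pi ->
  (forall i, 0 < gamma i ord0) ->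
  (forall N, (0 < N)%N ->
    [/\ markov_chain (P N) (N%:R *: Q) (X N),
        initial_law (P N) p0 (X N),
        independent_processes (P N) (X N) (B N)
      & mmou_process (P N) (X N) (B N) alpha gamma sigma m0 (M N)]) ->
  let alpha_oo := dotp pi alpha in
  let gamma_oo := dotp pi gamma in
  let sigma_oo := Num.sqrt (dotp pi (map_mx (fun x => x ^+ 2) sigma)) in
  ou_process P' B' alpha_oo gamma_oo sigma_oo m0 M1 ->
  weak_cvg_C0oo P M P' M1.
Proof.
move=> Qgen pinv _ HM alpha_oo gamma_oo sigma_oo ou Phi cPhi [c bPhi].
have E' : 'E_P'[(fun w => Phi (M1 ^~ w))]%E = (\int[P']_w Phi (M1 ^~ w))%:E.
  have [F' [Ff' _ sde']] := ou; apply: (expectation_functional P' cPhi bPhi).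
    exact: (C0oo_solution sde').
  exact: (measurable_solution Ff' sde').
have cv : \int[P N]_w Phi (M N ^~ w) @[N --> \oo] --> \int[P']_w Phi (M1 ^~ w).
  apply/cvgrPdist_le => eps eps0.
  have [N0 H] := expectation_limit Qgen pinv ou cPhi bPhi eps0.
  exists (maxn 1 N0) => // N /=; rewrite geq_max => /andP[N_gt0 N0N].
  have [mX _ XB mm] := HM N N_gt0.
  by rewrite distrC; exact: (H N _ _ _ _ _ _ N0N N_gt0 mX XB mm).
have cvE : (\int[P N]_w Phi (M N ^~ w))%:E @[N --> \oo] --> (\int[P']_w Phi (M1 ^~ w))%:E.
  by apply: cvg_EFin; [exact: nearW|exact: cv].
(* The extended expectations coincide with the real integrals for positive [N], where the process is
   a solution with measurable continuous paths; the index 0 is left out of the limit. *)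
rewrite E'; apply: cvg_trans cvE; apply: near_eq_cvg; exists 1%N => // N /= N_gt0.
have [_ _ _ [F [Ff _ _ sde]]] := HM N N_gt0.
by rewrite (expectation_functional (P N) cPhi bPhi)//; [case: sde|move=> t; exact: (measurable_solution Ff sde)].
Qed.
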